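(* Let $M_0$ be the Iwasawa manifold. The space $\mathcal L^{2,2}(M_0,F)$ has dimension $7$ for any invariant balanced Hermitian structure $F$ on $M_0$. Furthermore, for $$2F=i(\omega^{1\bar1}+\omega^{2\bar2}+t^2\,\omega^{3\bar3}),\qquad t\in\mathbb R\setminus\{0\},$$ one has $$\mathcal L^{2,2}(M_0,F)=\langle\omega^{12\bar1\bar3},\,\omega^{12\bar2\bar3},\,\omega^{13\bar1\bar2},\,\omega^{13\bar2\bar3},\,\omega^{23\bar1\bar2},\,\omega^{23\bar1\bar3},\,\omega^{13\bar1\bar3}-\omega^{23\bar2\bar3}\rangle.$$
   Context: The Iwasawa manifold $M_0$ is the compact quotient of the complex 3-dimensional Heisenberg group by a lattice, with its natural (complex-parallelizable) complex structure; $\{\omega^1,\omega^2,\omega^3\}$ is the usual basis of invariant holomorphic $(1,0)$-forms with $d\omega^1=d\omega^2=0$, $d\omega^3=\omega^1\wedge\omega^2$. Multi-index notation: $\omega^{1\bar1}=\omega^1\wedge\overline{\omega^1}$, $\omega^{12\bar1\bar3}=\omega^1\wedge\omega^2\wedge\overline{\omega^1}\wedge\overline{\omega^3}$, etc.; $\langle\cdot\rangle$ denotes complex linear span. Every invariant balanced Hermitian metric on $M_0$ is equivalent to one of the displayed form $2F=i(\omega^{1\bar1}+\omega^{2\bar2}+t^2\omega^{3\bar3})$. A Hermitian structure is identified with its fundamental $(1,1)$-form $F$; in complex dimension 3 it is balanced if $dF^2=0$. For balanced $F$, $$\mathcal L^{2,2}(M_0,F)=\{\alpha\in\Omega^{2,2}(M_0)\mid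 d\alpha=0,\ \partial\bar\partial( *\alpha)=0,\ \alpha\wedge F=0\},$$ where $\Omega^{2,2}$ denotes smooth complex $(2,2)$-forms and $*$ is the Hodge star operator of the Hermitian metric. *)

(* Defs.v *)
From HB Require Import structures.
From mathcomp Require Import all_boot all_order all_algebra.
From mathcomp Require Import complex.
From mathcomp Require Import boolp classical_sets functions reals topology.
From mathcomp Require Import normedtype derive.
Set Implicit Arguments.
Unset Strict Implicit.
Unset Printing Implicit Defensive.
Import Order.TTheory GRing.Theory Num.Theory.
Import numFieldNormedType.Exports.
Local Open Scope ring_scope.
Local Open Scope complex_scope.

(* [lshift 3 j] stands for z_j and [rshift 3 j] for its conjugate. *)
Notation idx := 'I_(3 + 3).

Definition i1 : 'I_3 := @Ordinal 3 0 isT.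
Definition i2 : 'I_3 := @Ordinal 3 1 isT.
Definition i3 : 'I_3 := @Ordinal 3 2 isT.

(* C^3 as the real normed space R^6: the coordinate [lshift 3 j] of a point is
   the real part of z_j, the coordinate [rshift 3 j] is its imaginary part. *)
Notation C3 R := 'rV[R]_(3 + 3).

(* A (possibly inhomogeneous) complex differential form on C^3:  [a x S] is the
   coefficient at x of the monomial indexed by S, the wedge product of the
   dz_j (lshift 3 j \in S) and d\bar z_j (rshift 3 j \in S), taken in the order
   dz_1, dz_2, dz_3, d\bar z_1, d\bar z_2, d\bar z_3.
   Forms are a complex vector space for the pointwise operations. *)
Notation cform R := (C3 R -> {set idx} -> R[i]).

Section Definitions.
Variable R : realType.
Notation C := R[i].
Notation V := (C3 R).
Notation form := (cform R).
Implicit Types (x g : V) (S T U : {set idx}) (a b F : form).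

Definition zc x (j : 'I_3) : C := x 0 (lshift 3 j) +i* x 0 (rshift 3 j).

Definition zcoord (i : idx) x : C :=
  match fintype.split i with inl j => zc x j | inr j => conjc (zc x j) end.

Definition mkpoint (z1 z2 z3 : C) : V :=
  let z (j : 'I_3) := [:: z1; z2; z3]`_j in
  row_mx (\row_j complex.Re (z j)) (\row_j complex.Im (z j)).

Definition basis_vec (i : idx) : V := delta_mx 0 i.

Definition partial (f : V -> C) (i : idx) x : C :=
  'D_(basis_vec i) (fun y => complex.Re (f y)) x +i*
  'D_(basis_vec i) (fun y => complex.Im (f y)) x.

(* Wirtinger derivatives: d/dz_j for [lshift 3 j], d/d\bar z_j for
   [rshift 3 j]. *)
Definition wirtinger (i : idx) (f : V -> C) x : C :=
  match fintype.split i with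
  | inl j => (partial f (lshift 3 j) x - 'i%C * partial f (rshift 3 j) x) / 2%:R
  | inr j => (partial f (lshift 3 j) x + 'i%C * partial f (rshift 3 j) x) / 2%:R
  end.

Fixpoint Ck (k : nat) (f : V -> R) : Prop :=
  continuous f /\
  match k with
  | 0 => True
  | k'.+1 => forall i, (forall x, derivable f x (basis_vec i)) /\
                       Ck k' (fun x => 'D_(basis_vec i) f x)
  end.

Definition smooth (f : V -> C) : Prop :=
  forall k, Ck k (fun x => complex.Re (f x)) /\ Ck k (fun x => complex.Im (f x)).

(* For disjoint S and T, the monomial of S wedge the monomial of T is
   [sgn S T] times the monomial of S :|: T. *)
Definition sgn S T : C :=
  (-1) ^+ #|[set ij : idx * idx |
              [&& ij.1 \in S, ij.2 \in T & (ij.2 < ij.1)%N]]|.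

Definition wedge a b : form := fun x U =>
  \sum_(S : {set idx} | S \subset U)
    sgn S (U :\: S) * a x S * b x (U :\: S).

Definition dcoord (i : idx) : form := fun _ S => (S == [set i])%:R.

Definition conj_idx (i : idx) : idx :=
  match fintype.split i with inl j => rshift 3 j | inr j => lshift 3 j end.

Definition holdeg S : nat := #|[set j : 'I_3 | lshift 3 j \in S]|.
Definition antideg S : nat := #|[set j : 'I_3 | rshift 3 j \in S]|.

(* The sign reorders the conjugated monomial, whose d\bar z's come first. *)
Definition conj_form a : form := fun x S =>
  (-1) ^+ (holdeg S * antideg S) * conjc (a x (conj_idx @: S)).

Definition del a : form := fun x U =>
  \sum_(j : 'I_3 | lshift 3 j \in U)
    sgn [set lshift 3 j] (U :\ lshift 3 j) *
    wirtinger (lshift 3 j) (fun y => a y (U :\ lshift 3 j)) x.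

Definition delbar a : form := fun x U =>
  \sum_(j : 'I_3 | rshift 3 j \in U)
    sgn [set rshift 3 j] (U :\ rshift 3 j) *
    wirtinger (rshift 3 j) (fun y => a y (U :\ rshift 3 j)) x.

Definition ext_d a : form := del a + delbar a.

Definition minor (M : 'M[C]_(3 + 3)) S T : C :=
  if #|S| == #|T| then
    \det (\matrix_(k < #|S|, l < #|S|)
            M (nth ord0 (enum S) k) (nth ord0 (enum T) l))
  else 0.

Definition pullback (phi : V -> V) a : form := fun x U =>
  let jac := \matrix_(i, j) wirtinger j (fun y => zcoord i (phi y)) x in
  \sum_(T : {set idx}) a (phi x) T * minor jac T U.

Definition of_type (p q : nat) a : Prop :=
  forall x S, a x S != 0 -> holdeg S = p /\ antideg S = q.

(* (z_1, z_2, z_3) is the unitriangular matrix with rows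
   (1, z_1, z_3), (0, 1, z_2), (0, 0, 1); the unit is [0]. *)
Definition heis_mul g x : V :=
  mkpoint (zc g i1 + zc x i1) (zc g i2 + zc x i2)
          (zc g i3 + zc x i3 + zc g i1 * zc x i2).

Definition heis_inv g : V :=
  mkpoint (- zc g i1) (- zc g i2) (zc g i1 * zc g i2 - zc g i3).

(* Discrete subgroup Gamma of the Heisenberg group with compact quotient
   Gamma \ C^3. *)
Definition lattice (Gamma : set V) : Prop :=
  [/\ Gamma 0,
      forall g h, Gamma g -> Gamma h -> Gamma (heis_mul g h),
      forall g, Gamma g -> Gamma (heis_inv g),
      \forall g \near (0 : V), Gamma g -> g = 0
    & exists2 K : set V, compact K &
        forall x, exists g k, [/\ Gamma g, K k & x = heis_mul g k]].

(* Smooth (p,q)-forms on Gamma \ C^3, as the smooth Gamma-invariant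
   (p,q)-forms on the covering C^3. *)
Definition Omega (Gamma : set V) (p q : nat) : set form :=
  [set a | [/\ forall S, smooth (fun x => a x S), of_type p q a
             & forall g, Gamma g -> pullback (heis_mul g) a = a]]%classic.

Definition left_invariant a : Prop := forall g, pullback (heis_mul g) a = a.

(* The sign of omega^3 is such that d omega^3 = omega^1 /\ omega^2. *)
Definition omega (j : 'I_3) : form :=
  if j == i1 then dcoord (lshift 3 i1)
  else if j == i2 then dcoord (lshift 3 i2)
  else fun x => zc x i1 *: dcoord (lshift 3 i2) x - dcoord (lshift 3 i3) x.

Definition omegab (j : 'I_3) : form := conj_form (omega j).

Definition omega11 (j k : 'I_3) : form := wedge (omega j) (omegab k).

Definition omega22 (j k l m : 'I_3) : form :=
  wedge (wedge (omega j) (omega k)) (wedge (omegab l) (omegab m)).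

Definition comp2 a x (i j : idx) : C :=
  if (i < j)%N then a x [set i; j]
  else if (j < i)%N then - a x [set i; j] else 0.

(* Eigenvalues of the complex structure J on the d/dz_j and d/d\bar z_j. *)
Definition Jeig (i : idx) : C :=
  match fintype.split i with inl _ => 'i%C | inr _ => - 'i%C end.

(* Gram matrix, in the frame d/dz_j, d/d\bar z_j, of the complex bilinear
   extension of the Riemannian metric g(u, v) = F(u, J v). *)
Definition gram F x : 'M[C]_(3 + 3) :=
  \matrix_(i, j) (comp2 F x i j * Jeig j).

Definition hermitian_structure F : Prop :=
  [/\ forall S, smooth (fun x => F x S), of_type 1 1 F, conj_form F = F
    & forall x u, u != 0 ->
        let w := \row_i zcoord i u in 0 < (w *m gram F x *m w^T) 0 0].

Definition balanced F : Prop := ext_d (wedge F F) = 0.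

Definition volume F : form := (6%:R)^-1 *: wedge F (wedge F F).

(* Complex bilinear extension to forms of the pointwise inner product of F,
   normalized by <u_1 /\ .. /\ u_k, v_1 /\ .. /\ v_k> = det <u_i, v_j>. *)
Definition inner F a b : V -> C := fun x =>
  \sum_(S : {set idx}) \sum_(T : {set idx})
    a x S * minor (invmx (gram F x)) S T * b x T.

Definition monomial S : form := fun _ T => (T == S)%:R.

(* Complex linear Hodge star, the solution of
   b /\ star F a = <b, a> volume F for all b; taking for b the monomial of
   ~: U gives the coefficient at U. *)
Definition star F a : form := fun x U =>
  sgn (~: U) U * inner F (monomial (~: U)) a x * volume F x [set: idx]%SET.

Definition L22 (Gamma : set V) F : set form :=
  [set a | [/\ Omega Gamma 2 2 a, ext_d a = 0,
               del (delbar (star F a)) = 0 & wedge a F = 0]]%classic.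

Definition cspan n (b : 'I_n -> form) : set form :=
  [set a | exists c : 'I_n -> C, a = \sum_i c i *: b i]%classic.

Definition cfree n (b : 'I_n -> form) : Prop :=
  forall c : 'I_n -> C, \sum_i c i *: b i = 0 -> forall i, c i = 0.

Definition has_dim (L : set form) (n : nat) : Prop :=
  exists b : 'I_n -> form, cfree b /\ L = cspan b.

End Definitions.

(* Main.v *)
(* In the left-invariant frame a (2,2)-form is a 3 x 3 matrix A of functions and
   a left-invariant metric is a constant positive matrix H; the Hodge star of
   the form is, up to a constant factor, G = H A^T H.  Closedness says that the
   rows and columns of A are divergence free, and the second order condition is
   a curl-curl equation for G.  The latter writes X_m Ybar_m G as a sum of
   divergences, so that pairing with the conjugate of A makes the nonnegative
   squared H-norm of Ybar_m A a divergence of invariant vector fields; hence it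
   vanishes, and A is constant.
   Integration over the compact quotient is replaced by a mean on bounded
   functions on the Heisenberg group, built from an invariant mean on C by
   iteration in the three coordinates.  For constant A all derivatives drop out
   except the structure constant, which leaves G_33 = 0; together with the
   primitivity condition sum_jk A_jk H_jk = 0 these are two independent linear
   equations on nine unknowns. *)
From HB Require Import structures.
Require Import Defs.
From mathcomp Require Import all_boot all_order all_algebra.
From mathcomp Require Import perm spectral complex ring finmap.
From mathcomp Require Import boolp classical_sets functions reals topology.
From mathcomp Require Import normedtype derive.
Import Order.TTheory GRing.Theory Num.Theory.
Import numFieldNormedType.Exports.
Set Implicit Arguments.
Unset Strict Implicit.
Unset Printing Implicit Defensive.
Local Open Scope ring_scope.
Local Open Scope complex_scope.

(** * Smooth functions on the Heisenberg group *)

(** The frame fields are left-invariant, so they generate right translations, while the functions on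
    the quotient are [Gamma]-invariant from the left. A mean invariant under right translations
    therefore kills frame derivatives. What an integral gives for free, that a nonnegative invariant
    function of mean zero vanishes, has to be extracted from compactness: finitely many right
    translates of the function have a sum bounded below by a positive constant. Pairing with the
    conjugate of A works for every right-hand side of the shape X_j p_k + Ybar_k q_j, because after
    integration by parts p and q meet only the divergences of the conjugate of A. For m = 3 such a
    right-hand side is read off from four components of the curl equation, none of which contains a
    structure constant. For m = 1, 2 zeroth-order terms intervene, so the central derivatives must
    be disposed of first. Then G_33 is constant and the (3,3) component exhibits it as a divergence,
    whence G_33 = 0. Thus one of the two equations that cut out the answer is already needed in
    order to prove that A is constant. *)

Section LineDerivatives.
Variables (R : realType) (V : normedModType R).
Implicit Types (f : V -> R) (x v w : V).
Local Open Scope classical_set_scope.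

Lemma is_derive_cvg f x v (l : R) :
  h^-1 *: (f (h *: v + x) - f x) @[h --> 0^'] --> l -> is_derive x v f l.
Proof.
move=> fl; apply: DeriveDef; first by apply/cvg_ex; exists l.
exact: (cvg_lim (@norm_hausdorff _ _) fl).
Qed.

Lemma derivable_cvg f x v : derivable f x v ->
  h^-1 *: (f (h *: v + x) - f x) @[h --> 0^'] --> 'D_v f x.
Proof. by []. Qed.

Lemma is_derive_line f x v (s : R) : derivable f (s *: v + x) v ->
  is_derive s 1 (fun r : R => f (r *: v + x)) ('D_v f (s *: v + x)).
Proof.
move=> /derivable_cvg df.
have H : (fun h : R => h^-1 *: (f ((h *: 1 + s) *: v + x) - f (s *: v + x)))
     @ 0^' --> 'D_v f (s *: v + x).
  by under eq_fun do rewrite [_ *: 1]mulr1 scalerDl -addrA.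
apply: DeriveDef; first by apply/cvg_ex; exists ('D_v f (s *: v + x)).
exact: (cvg_lim (@norm_hausdorff _ _) H).
Qed.

Lemma MVT_line f x v (a b : R) : a <= b ->
  (forall y, derivable f y v) ->
  exists2 c, a <= c <= b &
    f (b *: v + x) - f (a *: v + x) = 'D_v f (c *: v + x) * (b - a).
Proof.
move=> ab df; have dl s := is_derive_line (df (s *: v + x)).
have cl : {within `[a, b], continuous (fun r : R => f (r *: v + x))}.
  by apply: derivable_within_continuous => s _; case: (dl s).
have [c] := @MVT_segment R (fun r => f (r *: v + x))
    (fun r => 'D_v f (r *: v + x)) a b ab (fun s _ => dl s) cl.
by rewrite in_itv /= => cab eqc; exists c.
Qed.

Lemma MVT_line0 f x v (h : R) : (forall y, derivable f y v) ->
  exists2 c, `|c| <= `|h| &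
    f (h *: v + x) - f x = 'D_v f (c *: v + x) * h.
Proof.
move=> df; have [h0|h0] := leP 0 h.
  have [c /andP[c0 ch]] := MVT_line x h0 df.
  rewrite scale0r add0r subr0 => e; exists c => //.
  by rewrite !ger0_norm.
have [c /andP[hc c0]] := MVT_line x (ltW h0) df.
rewrite scale0r add0r sub0r => e; exists c.
  by rewrite (ltr0_norm h0) ler0_norm // lerN2.
by rewrite -opprB e mulrN opprK.
Qed.

Lemma cvg_dnbhs0_scale (v : V) : (h *: v) @[h --> (0 : R)^'] --> (0 : V).
Proof.
have : (h *: v) @[h --> (0 : R)^'] --> (0 : R) *: v.
  by apply: cvgZr_tmp; exact: cvg_within.
by rewrite scale0r.
Qed.

Lemma cvg_small_scale v (k : R -> R) (c : R) : 0 <= c ->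
  (forall h, `|k h| <= c * `|h|) -> (k h *: v) @[h --> 0^'] --> 0.
Proof.
move=> c0 kh; suff : k h *: v @[h --> 0^'] --> (0 : R) *: v by rewrite scale0r.
apply: cvgZr_tmp; apply/cvgr0Pnorm_le => e e0; near=> h.
apply: (le_trans (kh h)).
have : `|h| <= e / (c + 1).
  by near: h; apply: dnbhs0_le; rewrite divr_gt0 // ltr_wpDl.
rewrite ler_pdivlMr ?ltr_wpDl // mulrDr mulr1 mulrC => /(le_trans _) -> //.
by rewrite lerDl.
Unshelve. all: by end_near. Qed.

(** Splits the increment into a step along [w] from [x], where derivability at the point suffices,
    and a step along [v] from a moving point, where the mean value theorem and continuity of the
    [v]-derivative give the limit. This passes from coordinate to arbitrary directions one
    coordinate at a time. *)
Lemma is_deriveDr f x v w (c : R) : (forall y, derivable f y v) ->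
  {for x, continuous (fun y => 'D_v f y)} -> derivable f x w ->
  is_derive x (w + c *: v) f ('D_w f x + c * 'D_v f x).
Proof.
move=> df cf dw; apply: is_derive_cvg.
have /choice[k kP] : forall h : R, exists k, `|k| <= `|h * c| /\
    f ((h * c) *: v + (h *: w + x)) - f (h *: w + x) =
    'D_v f (k *: v + (h *: w + x)) * (h * c).
  by move=> h; have [k k1 k2] := MVT_line0 (h *: w + x) (h * c) df; exists k.
apply: (@cvg_trans _ ((h^-1 *: (f (h *: w + x) - f x) +
    c * 'D_v f (k h *: v + (h *: w + x))) @[h --> 0^'])).
  apply: near_eq_cvg; near=> h.
  have h0 : h != 0 by near: h; exact: nbhs_dnbhs_neq.
  have -> : h *: (w + c *: v) + x = (h * c) *: v + (h *: w + x).
    by rewrite scalerDr scalerA addrA [h *: w + _]addrC.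
  rewrite -[in RHS](subrK (f (h *: w + x)) (f ((h * c) *: v + (h *: w + x)))).
  rewrite (kP h).2 -[in RHS]addrA [in RHS]scalerDr [LHS]addrC; congr (_ + _).
  by rewrite /GRing.scale /= mulrCA mulKf // mulrC.
apply: cvgD; first exact: derivable_cvg.
apply: cvgMl_tmp.
have dx : k h *: v + (h *: w + x) @[h --> 0^'] --> x.
  suff : k h *: v + (h *: w + x) @[h --> 0^'] --> 0 + (0 + x).
    by rewrite !add0r.
  apply: cvgD; last by apply: cvgD; [exact: cvg_dnbhs0_scale|exact: cvg_cst].
  apply: (cvg_small_scale _ (normr_ge0 c)) => h.
  by rewrite mulrC -normrM; case: (kP h).
exact: (cvg_comp _ _ dx cf).
Unshelve. all: by end_near. Qed.

Lemma derive_shift_line f a x v :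
  'D_v (fun y => f (a + y)) x = 'D_v f (a + x).
Proof. by rewrite /derive; under eq_fun do rewrite /= addrCA. Qed.

Lemma derivable_shift_line f a x v :
  derivable f (a + x) v -> derivable (fun y => f (a + y)) x v.
Proof. by rewrite /derivable; under eq_fun do rewrite /= addrCA. Qed.

(** The mean value theorem along [v] for the increment [g] in the direction [w], then along [w] for
    the [v]-derivative. *)
Lemma second_difference f x v w (h : R) :
  (forall y, derivable f y v) ->
  (forall y, derivable (fun y => 'D_v f y) y w) ->
  exists c d, [/\ `|c| <= `|h|, `|d| <= `|h| &
    f (h *: w + (h *: v + x)) - f (h *: v + x) - (f (h *: w + x) - f x) =
    'D_w (fun y => 'D_v f y) (d *: w + (c *: v + x)) * (h * h)].
Proof.
move=> df ddf; pose g y := f (h *: w + y) - f y.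
have ds y : derivable (fun y => f (h *: w + y)) y v.
  exact: derivable_shift_line.
have dg y : derivable g y v by exact: derivableB.
have [c cP ec] := MVT_line0 x h dg.
have [d dP ed] := MVT_line0 (c *: v + x) h ddf.
exists c, d; split=> //; rewrite -/(g _) -/(g x) ec mulrA -ed.
congr (_ * _); rewrite /g.
by rewrite (deriveB (ds _) (df _)) derive_shift_line.
Qed.

(** Schwarz's theorem: the second difference is symmetric in [v] and [w], and divided by [h * h] it
    tends to either mixed derivative. *)
Lemma derive_comm f x v w :
  (forall y, derivable f y v) -> (forall y, derivable f y w) ->
  (forall y, derivable (fun y => 'D_v f y) y w) ->
  (forall y, derivable (fun y => 'D_w f y) y v) ->
  {for x, continuous (fun y => 'D_w (fun y => 'D_v f y) y)} ->
  {for x, continuous (fun y => 'D_v (fun y => 'D_w f y) y)} ->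
  'D_w (fun y => 'D_v f y) x = 'D_v (fun y => 'D_w f y) x.
Proof.
move=> dv dw dvw dwv cvw cwv.
have tox (c d : R -> R) (a b : V) : (forall h, `|c h| <= `|h|) ->
    (forall h, `|d h| <= `|h|) ->
    d h *: a + (c h *: b + x) @[h --> 0^'] --> x.
  move=> ch dh.
  suff : d h *: a + (c h *: b + x) @[h --> 0^'] --> 0 + (0 + x).
    by rewrite !add0r.
  apply: cvgD; last apply: cvgD; last exact: cvg_cst.
    by apply: (cvg_small_scale _ ler01) => h; rewrite mul1r.
  by apply: (cvg_small_scale _ ler01) => h; rewrite mul1r.
have /choice[c1 /choice[d1 P1]] := fun h => second_difference x h dv dvw.
have /choice[c2 /choice[d2 P2]] := fun h => second_difference x h dw dwv.
have l1 : 'D_w (fun y => 'D_v f y) (d1 h *: w + (c1 h *: v + x)) @[h --> 0^']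
    --> 'D_w (fun y => 'D_v f y) x.
  have dx : d1 h *: w + (c1 h *: v + x) @[h --> 0^'] --> x.
    by apply: tox => h; case: (P1 h).
  exact: (cvg_comp _ _ dx cvw).
have l2 : 'D_v (fun y => 'D_w f y) (d2 h *: v + (c2 h *: w + x)) @[h --> 0^']
    --> 'D_v (fun y => 'D_w f y) x.
  have dx : d2 h *: v + (c2 h *: w + x) @[h --> 0^'] --> x.
    by apply: tox => h; case: (P2 h).
  exact: (cvg_comp _ _ dx cwv).
apply: (cvg_unique (@norm_hausdorff _ _) l1).
apply: cvg_trans l2; apply: near_eq_cvg; near=> h.
have h0 : h != 0 by near: h; exact: nbhs_dnbhs_neq.
have [_ _ e1] := P1 h; have [_ _ e2] := P2 h.
have e : 'D_v (fun y => 'D_w f y) (d2 h *: v + (c2 h *: w + x)) * (h * h) =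
         'D_w (fun y => 'D_v f y) (d1 h *: w + (c1 h *: v + x)) * (h * h).
  apply: etrans (esym e2) _; apply: etrans e1.
  by rewrite [h *: v + (h *: w + x)]addrCA !opprB addrACA [RHS]addrACA [- _ - _]addrC.
exact: (mulIf (mulf_neq0 h0 h0) e).
Unshelve. all: by end_near. Qed.

Lemma derivable_const_line f : (forall x v, derivable f x v) ->
  (forall x v, 'D_v f x = 0) -> forall x, f x = f 0.
Proof.
move=> df d0 x; have [c _] := MVT_line0 0 1 (fun y => df y x).
by rewrite d0 mul0r scale1r addr0 => /eqP; rewrite subr_eq0 => /eqP.
Qed.

End LineDerivatives.

(** * Real functions of class C^k *)

Section SmoothReal.
Variable R : realType.
Notation V := (C3 R).
Implicit Types (f g : V -> R) (x w : V) (k : nat) (i : idx).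

Lemma CkW k f : Ck k.+1 f -> Ck k f.
Proof.
elim: k f => [|k IH] f [cf df]; split=> // i.
by have [d1 d2] := df i; split=> //; exact: IH.
Qed.

Lemma CkD k f g : Ck k f -> Ck k g -> Ck k (f + g).
Proof.
elim: k f g => [|k IH] f g [cf df] [cg dg]; split=> //.
- by move=> x; exact: continuousD (cf x) (cg x).
- by move=> x; exact: continuousD (cf x) (cg x).
move=> i; have [f1 f2] := df i; have [g1 g2] := dg i.
split=> [x|]; first exact: derivableD.
rewrite (_ : (fun x => _) =
  (fun x => 'D_(basis_vec R i) f x) + (fun x => 'D_(basis_vec R i) g x)).
  exact: IH.
by apply/funext => x; rewrite deriveD.
Qed.

Lemma CkM k f g : Ck k f -> Ck k g -> Ck k (f * g).
Proof.
elim: k f g => [|k IH] f g Cf Cg; have [cf df] := Cf; have [cg dg] := Cg.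
  by split=> // x; exact: continuousM (cf x) (cg x).
split=> [x|i]; first exact: continuousM (cf x) (cg x).
have [f1 f2] := df i; have [g1 g2] := dg i.
split=> [x|]; first exact: derivableM.
rewrite (_ : (fun x => _) =
  f * (fun x => 'D_(basis_vec R i) g x) + g * (fun x => 'D_(basis_vec R i) f x)).
  by apply: CkD; apply: IH => //; exact: CkW.
by apply/funext => x; rewrite deriveM.
Qed.

Lemma Ck_cst k (c : R) : Ck k (fun _ : V => c).
Proof.
elim: k c => [|k IH] c; split=> //; try exact: cst_continuous.
move=> i; split=> [x|]; first exact: derivable_cst.
rewrite (_ : (fun x => 'D_(basis_vec R i) _ x) = fun=> 0) //.
by apply/funext => x; exact: derive_cst.
Qed.

Lemma is_derive_coord x w i : is_derive x w (fun y : V => y 0 i) (w 0 i).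
Proof.
apply: is_derive_cvg; apply: cvg_near_cst; near=> h.
rewrite !mxE addrK /GRing.scale /= mulKf //.
by near: h; exact: nbhs_dnbhs_neq.
Unshelve. all: by end_near. Qed.

Lemma Ck_coord k i : Ck k (fun x : V => x 0 i).
Proof.
case: k => [|k]; split=> //; try exact: coord_continuous.
move=> j; split=> [x|]; first by case: (is_derive_coord x (basis_vec R j) i).
rewrite (_ : (fun x => 'D_(basis_vec R j) _ x) = fun=> basis_vec R j 0 i); first exact: Ck_cst.
by apply/funext => x; case: (is_derive_coord x (basis_vec R j) i).
Qed.

(** [Ck] speaks of coordinate directions only. The frame fields point in other directions, so
    differentiability along every [w], linear in [w], is built up by [is_deriveDr]. *)
Lemma C1_is_derive f x w : Ck 1 f ->
  is_derive x w f (\sum_i w 0 i * 'D_(basis_vec R i) f x).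
Proof.
move=> [cf df]; rewrite [X in is_derive _ X](row_sum_delta w).
elim: (index_enum _) => [|i r IH]; first by rewrite !big_nil; exact: is_derive0.
rewrite !big_cons [X in is_derive _ X]addrC [X in is_derive _ _ _ X]addrC.
have [di [ci _]] := df i; case: IH => IH1 IH2.
by have := is_deriveDr (w 0 i) di (ci x) IH1; rewrite IH2.
Qed.

Lemma C2_derive_comm f i j x : Ck 2 f ->
  'D_(basis_vec R i) (fun y => 'D_(basis_vec R j) f y) x =
  'D_(basis_vec R j) (fun y => 'D_(basis_vec R i) f y) x.
Proof.
move=> [cf df].
have [di [_ ci]] := df i; have [dj [_ cj]] := df j.
have [dij [cij _]] := ci j; have [dji [cji _]] := cj i.
exact: (derive_comm dj di dji dij (cji x) (cij x)).
Qed.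

Lemma C1_const f : Ck 1 f -> (forall x i, 'D_(basis_vec R i) f x = 0) ->
  forall x, f x = f 0.
Proof.
move=> Cf d0; apply: derivable_const_line => x w.
  by case: (C1_is_derive x w Cf).
case: (C1_is_derive x w Cf) => _ ->.
by apply: big1 => i _; rewrite d0 mulr0.
Qed.

End SmoothReal.

(** * The ring of smooth complex functions *)

Section SmoothRing.
Variable R : realType.
Notation V := (C3 R).
Notation C := R[i].
Implicit Types (f g : V -> C) (x w : V) (i : idx).

Lemma creD (a b : C) : complex.Re (a + b) = complex.Re a + complex.Re b.
Proof. by case: a; case: b. Qed.
Lemma cimD (a b : C) : complex.Im (a + b) = complex.Im a + complex.Im b.
Proof. by case: a; case: b. Qed.
Lemma creM (a b : C) : complex.Re (a * b) =
  complex.Re a * complex.Re b - complex.Im a * complex.Im b.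
Proof. by case: a; case: b. Qed.
Lemma cimM (a b : C) : complex.Im (a * b) =
  complex.Re a * complex.Im b + complex.Im a * complex.Re b.
Proof. by case: a; case: b. Qed.

Lemma smoothD f g : smooth f -> smooth g -> smooth (f + g).
Proof.
move=> sf sg k; have [f1 f2] := sf k; have [g1 g2] := sg k; split.
  rewrite (_ : (fun x => _) = (fun x => complex.Re (f x)) +
    (fun x => complex.Re (g x))); first exact: CkD.
  by apply/funext => x; rewrite creD.
rewrite (_ : (fun x => _) = (fun x => complex.Im (f x)) +
  (fun x => complex.Im (g x))); first exact: CkD.
by apply/funext => x; rewrite cimD.
Qed.

Lemma CkN k (f : V -> R) : Ck k f -> Ck k (- f).
Proof.
move=> Cf; rewrite (_ : - f = (fun=> - 1) * f); last by rewrite mulN1r.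
by apply: CkM => //; exact: Ck_cst.
Qed.

Lemma smoothM f g : smooth f -> smooth g -> smooth (f * g).
Proof.
move=> sf sg k; have [f1 f2] := sf k; have [g1 g2] := sg k; split.
  rewrite (_ : (fun x => _) =
    (fun x => complex.Re (f x)) * (fun x => complex.Re (g x)) +
    - ((fun x => complex.Im (f x)) * (fun x => complex.Im (g x)))).
    by apply: CkD; [exact: CkM|apply: CkN; exact: CkM].
  by apply/funext => x; rewrite creM.
rewrite (_ : (fun x => _) =
  (fun x => complex.Re (f x)) * (fun x => complex.Im (g x)) +
  (fun x => complex.Im (f x)) * (fun x => complex.Re (g x))).
  by apply: CkD; exact: CkM.
by apply/funext => x; rewrite cimM.
Qed.

Lemma smooth_cst (c : C) : smooth (fun _ : V => c).
Proof. by move=> k; split; exact: Ck_cst. Qed.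

Lemma smooth_conj f : smooth f -> smooth (fun x => conjc (f x)).
Proof.
move=> sf k; have [f1 f2] := sf k; split.
  rewrite (_ : (fun x => _) = (fun x => complex.Re (f x))) //.
  by apply/funext => x; case: (f x).
rewrite (_ : (fun x => _) = - (fun x => complex.Im (f x))); first exact: CkN.
by apply/funext => x /=; rewrite /GRing.opp /=; case: (f x).
Qed.

Lemma smooth_zc (j : 'I_3) : smooth (fun x : V => zc x j).
Proof. by move=> k; split; exact: Ck_coord. Qed.

Lemma smooth_partial f i : smooth f -> smooth (partial f i).
Proof.
by move=> sf k; have [[_ f1] [_ f2]] := sf k.+1; split;
  [case: (f1 i)|case: (f2 i)].
Qed.

Lemma smooth_wirtinger f i : smooth f -> smooth (wirtinger i f).
Proof.
move=> sf; rewrite /wirtinger; case: (fintype.split i) => j.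
  rewrite (_ : (fun x => _) = (partial f (lshift 3 j) +
   (fun=> - 'i%C) * partial f (rshift 3 j)) * (fun=> 2%:R^-1)).
    by apply: smoothM; [apply: smoothD; [|apply: smoothM]|];
      do ?[exact: smooth_partial|exact: smooth_cst].
  by apply/funext => x; rewrite -[LHS]/(_ * _) -mulNr.
rewrite (_ : (fun x => _) = (partial f (lshift 3 j) +
 (fun=> 'i%C) * partial f (rshift 3 j)) * (fun=> 2%:R^-1)).
  by apply: smoothM; [apply: smoothD; [|apply: smoothM]|];
    do ?[exact: smooth_partial|exact: smooth_cst].
by apply/funext => x.
Qed.

Definition smooth_pred : {pred (V -> C)} := fun f => `[< smooth f >].

Lemma smooth_predP f : reflect (smooth f) (f \in smooth_pred).
Proof. exact: asboolP. Qed.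

Lemma smooth_subring_closed : GRing.subring_closed smooth_pred.
Proof.
split=> [|f g /smooth_predP sf /smooth_predP sg|f g /smooth_predP sf /smooth_predP sg];
  apply/smooth_predP.
- exact: smooth_cst.
- apply: smoothD => //.
  rewrite (_ : - g = (fun=> - 1) * g); last by rewrite mulN1r.
  by apply: smoothM => //; exact: smooth_cst.
- exact: smoothM.
Qed.

HB.instance Definition _ :=
  GRing.isSubringClosed.Build (V -> C) smooth_pred smooth_subring_closed.

(** With smooth functions as a commutative ring, derivations become additive maps of this ring and
    identities between differential expressions are within reach of [ring]. *)
Record smf := Smf { smf_val :> V -> C; _ : smf_val \in smooth_pred }.
HB.instance Definition _ := [isSub for smf_val].
HB.instance Definition _ := [Choice of smf by <:].
HB.instance Definition _ := [SubChoice_isSubComNzRing of smf by <:].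

End SmoothRing.

(** * Wirtinger derivatives as derivations *)

Section Derivations.
Variable R : realType.
Notation V := (C3 R).
Notation C := R[i].
Notation smf := (smf R).
Implicit Types (f g : smf) (x w : V) (i j : idx).

Lemma smf_smooth f : smooth f.
Proof. by apply/smooth_predP; exact: (valP f). Qed.

Definition mk_smf (f : V -> C) (sf : smooth f) : smf :=
  Smf (introT (smooth_predP f) sf).

Lemma smf_eq f g : (forall x, f x = g x) -> f = g.
Proof. by move=> fg; apply: val_inj; apply/funext. Qed.

Lemma smfD f g x : (f + g) x = f x + g x. Proof. by []. Qed.
Lemma smfN f x : (- f) x = - f x. Proof. by []. Qed.
Lemma smfB f g x : (f - g) x = f x - g x. Proof. by []. Qed.
Lemma smfM f g x : (f * g) x = f x * g x. Proof. by []. Qed.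
Lemma smf0 x : (0 : smf) x = 0. Proof. by []. Qed.
Lemma smf1 x : (1 : smf) x = 1. Proof. by []. Qed.
Lemma smf_sum (I : Type) (r : seq I) (P : pred I) (F : I -> smf) x :
  (\sum_(i <- r | P i) F i) x = \sum_(i <- r | P i) F i x.
Proof. by elim/big_rec2: _ => // k u v _ <-; rewrite smfD. Qed.
Definition smfE := (smfD, smfN, smfM, smf0, smf1, smf_sum).

Lemma Re_derivable f x i : derivable (fun y => complex.Re (f y)) x (basis_vec R i).
Proof. by have [[_ /(_ i)[]]] := smf_smooth f 1. Qed.

Lemma Im_derivable f x i : derivable (fun y => complex.Im (f y)) x (basis_vec R i).
Proof. by have [_ [_ /(_ i)[]]] := smf_smooth f 1. Qed.

Lemma partialD f g i x : partial (f + g) i x = partial f i x + partial g i x.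
Proof.
rewrite /partial.
rewrite (_ : (fun y => complex.Re ((f + g) y)) =
    (fun x => complex.Re (f x)) + (fun x => complex.Re (g x))); last first.
  by apply/funext => y; exact: creD.
rewrite (_ : (fun y => complex.Im ((f + g) y)) =
    (fun x => complex.Im (f x)) + (fun x => complex.Im (g x))); last first.
  by apply/funext => y; exact: cimD.
rewrite deriveD; try exact: Re_derivable.
by rewrite deriveD; try exact: Im_derivable.
Qed.

Lemma partialM f g i x :
  partial (f * g) i x = partial f i x * g x + f x * partial g i x.
Proof.
have rf := @Re_derivable f x i; have rg := @Re_derivable g x i.
have mf := @Im_derivable f x i; have mg := @Im_derivable g x i.
rewrite /partial.
rewrite (_ : (fun y => complex.Re ((f * g) y)) =
    (fun x => complex.Re (f x)) * (fun x => complex.Re (g x)) -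
    (fun x => complex.Im (f x)) * (fun x => complex.Im (g x))); last first.
  by apply/funext => y; exact: creM.
rewrite (_ : (fun y => complex.Im ((f * g) y)) =
    (fun x => complex.Re (f x)) * (fun x => complex.Im (g x)) +
    (fun x => complex.Im (f x)) * (fun x => complex.Re (g x))); last first.
  by apply/funext => y; exact: cimM.
rewrite (deriveB (derivableM rf rg) (derivableM mf mg)).
rewrite (deriveD (derivableM rf mg) (derivableM mf rg)).
rewrite (deriveM rf rg) (deriveM mf mg) (deriveM rf mg) (deriveM mf rg).
move: ('D_ _ _ _) ('D_ _ _ _) ('D_ _ _ _) ('D_ _ _ _) => p q r s.
rewrite /GRing.scale /=; case: (f x) => a b; case: (g x) => c d.
by apply/eqP; rewrite eq_complex /=; apply/andP; split; apply/eqP; ring.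
Qed.

Lemma partial_comm f i j x :
  partial (partial f j) i x = partial (partial f i) j x.
Proof.
have [c1 c2] := smf_smooth f 2.
have r1 := C2_derive_comm i j x c1; have r2 := C2_derive_comm i j x c2.
exact: (f_equal2 (fun p q => p +i* q) r1 r2).
Qed.

Lemma partial_cst (c : C) i x : partial (fun=> c) i x = 0.
Proof. by rewrite /partial !derive_cst. Qed.

Lemma partial_conj f i x :
  partial (fun y => conjc (f y)) i x = conjc (partial f i x).
Proof.
rewrite /partial.
rewrite (_ : (fun y => complex.Re (conjc (f y))) = (fun x => complex.Re (f x)));
  last by apply/funext => y; case: (f y).
rewrite (_ : (fun y => complex.Im (conjc (f y))) = - (fun x => complex.Im (f x)));
  last by apply/funext => y; rewrite fctE; case: (f y).
by rewrite deriveN; last exact: Im_derivable.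
Qed.

Lemma partial_zc (k : 'I_3) i x :
  partial (fun y => zc y k) i x =
  (lshift 3 k == i)%:R +i* (rshift 3 k == i)%:R.
Proof.
rewrite /partial /=.
have [_ ->] := is_derive_coord x (basis_vec R i) (lshift 3 k).
have [_ ->] := is_derive_coord x (basis_vec R i) (rshift 3 k).
by rewrite !mxE /=.
Qed.

(** With [wirt_sign] this writes d/dz_j and d/d\bar z_j as one formula (p + s q) / 2 with s = -i or
    i, so both kinds are treated at once. *)
Definition idx_base i : 'I_3 :=
  match fintype.split i with inl k => k | inr k => k end.
Definition wirt_sign i : C :=
  match fintype.split i with inl k => - 'i%C | inr k => 'i%C end.

Lemma wirtingerE i (f : V -> C) x : wirtinger i f x =
  (partial f (lshift 3 (idx_base i)) x +
   wirt_sign i * partial f (rshift 3 (idx_base i)) x) / 2%:R.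
Proof.
by rewrite /wirtinger /idx_base /wirt_sign; case: (fintype.split i) => // k;
  rewrite mulNr.
Qed.

Lemma conjD (a b : C) : conjc (a + b) = conjc a + conjc b.
Proof. exact: rmorphD. Qed.
Lemma conjM (a b : C) : conjc (a * b) = conjc a * conjc b.
Proof. exact: rmorphM. Qed.

Definition dd i f : smf := mk_smf (smooth_wirtinger i (smf_smooth f)).

Lemma ddE i f x : dd i f x = wirtinger i f x. Proof. by []. Qed.

Lemma ddD i : {morph dd i : f g / f + g}.
Proof.
move=> f g; apply: smf_eq => x; rewrite smfD !ddE !wirtingerE !partialD.
by move: (partial _ _ _) (partial _ _ _) (partial _ _ _) (partial _ _ _) => p q r s; ring.
Qed.

Lemma ddM i f g : dd i (f * g) = dd i f * g + f * dd i g.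
Proof.
apply: smf_eq => x; rewrite !smfE !ddE !wirtingerE !partialM.
by move: (partial _ _ _) (partial _ _ _) (partial _ _ _) (partial _ _ _) => p q r s; ring.
Qed.

Lemma ddB i : {morph dd i : f g / f - g}.
Proof.
have dd0 : dd i 0 = 0 by apply: (addrI (dd i 0)); rewrite -ddD !addr0.
move=> f g; rewrite ddD; congr (_ + _); apply: (addrI (dd i g)).
by rewrite -ddD !subrr.
Qed.
HB.instance Definition _ i := GRing.isZmodMorphism.Build smf smf (dd i) (@ddB i).

Definition cs (c : C) : smf := mk_smf (@smooth_cst R c).
Lemma csE c x : cs c x = c. Proof. by []. Qed.

Lemma csB : {morph cs : a b / a - b}.
Proof. by move=> a b; apply: smf_eq => x. Qed.
Lemma cs_monoid : monoid_morphism cs.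
Proof. by split=> [|a b]; apply: smf_eq => x. Qed.
HB.instance Definition _ := GRing.isZmodMorphism.Build C smf cs csB.
HB.instance Definition _ := GRing.isMonoidMorphism.Build C smf cs cs_monoid.

Lemma dd_cs i c : dd i (cs c) = 0.
Proof.
by apply: smf_eq => x; rewrite ddE wirtingerE !partial_cst mulr0 addr0 mul0r.
Qed.

Lemma dd_csM i c f : dd i (cs c * f) = cs c * dd i f.
Proof. by rewrite ddM dd_cs mul0r add0r. Qed.

(** Real partial derivatives as operators on [smf], through which Schwarz's theorem passes to [dd]
    by linearity. *)
Definition ps i f : smf := mk_smf (smooth_partial i (smf_smooth f)).

Lemma psE i f x : ps i f x = partial f i x. Proof. by []. Qed.

Lemma dd_ps i f : dd i f = cs (2%:R^-1) *
  (ps (lshift 3 (idx_base i)) f + cs (wirt_sign i) * ps (rshift 3 (idx_base i)) f).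
Proof. by apply: smf_eq => x; rewrite ddE wirtingerE mulrC. Qed.

Lemma psD i : {morph ps i : f g / f + g}.
Proof. by move=> f g; apply: smf_eq => x; rewrite smfD !psE partialD. Qed.

Lemma ps_csM i c f : ps i (cs c * f) = cs c * ps i f.
Proof.
apply: smf_eq => x; rewrite psE partialM !smfE psE csE.
by rewrite partial_cst mul0r add0r.
Qed.

Lemma ps_comm i j f : ps i (ps j f) = ps j (ps i f).
Proof. by apply: smf_eq => x; exact: partial_comm. Qed.

Lemma dd_comm i j f : dd i (dd j f) = dd j (dd i f).
Proof.
rewrite !dd_ps !(ps_csM, psD).
rewrite !(ps_comm (lshift 3 (idx_base i))) !(ps_comm (rshift 3 (idx_base i))).
ring.
Qed.

Definition cj f : smf := mk_smf (smooth_conj (smf_smooth f)).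
Lemma cjE f x : cj f x = conjc (f x). Proof. by []. Qed.
Lemma cjB : {morph cj : f g / f - g}.
Proof. by move=> f g; apply: smf_eq => x; rewrite !(smfE, cjE) rmorphB. Qed.
Lemma cj_monoid : monoid_morphism cj.
Proof.
by split=> [|f g]; apply: smf_eq => x; rewrite !(smfE, cjE) ?rmorph1 ?rmorphM.
Qed.
HB.instance Definition _ := GRing.isZmodMorphism.Build smf smf cj cjB.
HB.instance Definition _ := GRing.isMonoidMorphism.Build smf smf cj cj_monoid.

Lemma cjK : involutive cj.
Proof. by move=> f; apply: smf_eq => x; rewrite !cjE conjcK. Qed.

Lemma cj_cs c : cj (cs c) = cs (conjc c).
Proof. by apply: smf_eq. Qed.

Lemma split_conj i : fintype.split (conj_idx i) =
  match fintype.split i with inl k => inr k | inr k => inl k end.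
Proof.
rewrite /conj_idx; case: (fintype.split i) => k.
  exact: (unsplitK (inr k)).
exact: (unsplitK (inl k)).
Qed.

Lemma dd_cj i f : dd i (cj f) = cj (dd (conj_idx i) f).
Proof.
have eb : idx_base (conj_idx i) = idx_base i.
  by rewrite /idx_base split_conj; case: (fintype.split i).
have es : wirt_sign (conj_idx i) = conjc (wirt_sign i).
  by rewrite /wirt_sign split_conj; case: (fintype.split i) => k; simpc.
apply: smf_eq => x; rewrite cjE !ddE !wirtingerE !partial_conj eb es.
have c2 : conjc (2%:R^-1 : C) = 2%:R^-1 by rewrite fmorphV rmorph_nat.
by rewrite conjM conjD conjM c2 conjcK.
Qed.

Definition zs (k : 'I_3) : smf := mk_smf (@smooth_zc R k).
Lemma zsE k x : zs k x = zc x k. Proof. by []. Qed.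

Lemma dd_zs i k : dd i (zs k) = (lshift 3 k == i)%:R.
Proof.
apply: smf_eq => x; rewrite ddE wirtingerE !partial_zc.
rewrite !(eq_lshift, eq_rshift, eq_lrshift, eq_rlshift).
have ii : 'i%C * 'i%C = -1 :> C by rewrite -expr2 sqr_i.
have e0 : (0 +i* 0 : C) = 0 by [].
have e1 : (1 +i* 0 : C) = 1 by [].
have ei : (0 +i* 1 : C) = 'i%C by [].
have n2 : (2%:R : C) != 0 by rewrite pnatr_eq0.
rewrite /idx_base /wirt_sign; move: (splitK i).
case: (fintype.split i) => l /= <-; rewrite ?eq_lshift ?eq_lrshift.
  have [_|_] := eqVneq k l; rewrite ?(e0, e1, ei, smf0, smf1).
    by rewrite mulNr ii opprK; exact: mulfV.
  by rewrite mulr0 addr0 mul0r.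
have [_|_] := eqVneq k l; rewrite ?(e0, e1, ei, smf0, smf1).
  by rewrite ii subrr mul0r.
by rewrite mulr0 addr0 mul0r.
Qed.

End Derivations.

(** * The Heisenberg group and its left-invariant frame *)

Section Frame.
Variable R : realType.
Notation V := (C3 R).
Notation C := R[i].
Notation smf := (smf R).
Implicit Types (f g : smf) (x w : V) (i : idx) (j k : 'I_3).

Lemma I3P (P : 'I_3 -> Prop) : P i1 -> P i2 -> P i3 -> forall j, P j.
Proof.
move=> p1 p2 p3 [[|[|[|m]]] lt] //.
- by rewrite (_ : Ordinal lt = i1) //; apply: val_inj.
- by rewrite (_ : Ordinal lt = i2) //; apply: val_inj.
- by rewrite (_ : Ordinal lt = i3) //; apply: val_inj.
Qed.

Lemma big_I3 (T : nmodType) (F : 'I_3 -> T) :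
  \sum_j F j = F i1 + F i2 + F i3.
Proof.
rewrite !big_ord_recl big_ord0 addr0 addrA.
by congr (F _ + F _ + F _); apply: val_inj.
Qed.

Lemma zcD x y j : zc (x + y) j = zc x j + zc y j.
Proof. by rewrite /zc !mxE; apply/eqP; rewrite eq_complex /= !eqxx. Qed.

Lemma zcZ (h : R) x j : zc (h *: x) j = h%:C * zc x j.
Proof.
by rewrite /zc !mxE; apply/eqP; rewrite eq_complex /= !mul0r subr0 addr0 !eqxx.
Qed.

Lemma zc0 j : zc (0 : V) j = 0.
Proof. by rewrite /zc !mxE. Qed.

Lemma zc_mkpoint (z1 z2 z3 : C) j :
  zc (mkpoint z1 z2 z3) j = [:: z1; z2; z3]`_j.
Proof. by rewrite /zc /mkpoint row_mxEl row_mxEr !mxE; case: (_`_j). Qed.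

Lemma zc_mk1 (z1 z2 z3 : C) : zc (mkpoint z1 z2 z3) i1 = z1.
Proof. by rewrite zc_mkpoint. Qed.
Lemma zc_mk2 (z1 z2 z3 : C) : zc (mkpoint z1 z2 z3) i2 = z2.
Proof. by rewrite zc_mkpoint. Qed.
Lemma zc_mk3 (z1 z2 z3 : C) : zc (mkpoint z1 z2 z3) i3 = z3.
Proof. by rewrite zc_mkpoint. Qed.
Definition zcE := (zcD, zcZ, zc0, zc_mk1, zc_mk2, zc_mk3).

Lemma point_eq x y : (forall j, zc x j = zc y j) -> x = y.
Proof.
move=> xy; apply/rowP => i; rewrite -(splitK i).
by case: (fintype.split i) => j /=; case: (xy j).
Qed.

Lemma point_eq3 x y : zc x i1 = zc y i1 -> zc x i2 = zc y i2 ->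
  zc x i3 = zc y i3 -> x = y.
Proof. by move=> e1 e2 e3; apply: point_eq; apply: I3P. Qed.

Lemma heis_mulA x y z : heis_mul x (heis_mul y z) = heis_mul (heis_mul x y) z.
Proof. by apply: point_eq3; rewrite /heis_mul !zcE; ring. Qed.

Lemma heis_mulx0 x : heis_mul x 0 = x.
Proof. by apply: point_eq3; rewrite /heis_mul !zcE; ring. Qed.

Lemma heis_mul0x x : heis_mul 0 x = x.
Proof. by apply: point_eq3; rewrite /heis_mul !zcE; ring. Qed.

Lemma heis_mulxV x : heis_mul x (heis_inv x) = 0.
Proof. by apply: point_eq3; rewrite /heis_mul /heis_inv !zcE; ring. Qed.

(* The left-invariant vector field with value w at the unit. *)
Definition frame w x : V := w + mkpoint 0 0 (zc x i1 * zc w i2).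

(** In these coordinates right translation by multiples of [w] moves every point along a straight
    line, so line derivatives are all that is needed. *)
Lemma heis_mul_frame x w (h : R) : heis_mul x (h *: w) = h *: frame w x + x.
Proof. by apply: point_eq3; rewrite /heis_mul /frame !zcE; ring. Qed.

(** Under the condition on [w] its real multiples form a one-parameter subgroup. The field is then
    constant along its own integral line, so differentiating twice along the line is applying the
    field twice. *)
Lemma frame_line x w (s : R) : zc w i1 * zc w i2 = 0 ->
  frame w (s *: frame w x + x) = frame w x.
Proof.
move=> w0; apply: point_eq3; rewrite /frame !zcE //.
transitivity (zc w i3 + (s%:C * (zc w i1 * zc w i2) + zc x i1 * zc w i2)).
  by ring.
by rewrite w0; ring.
Qed.

Definition dir w (f : V -> C) x : C :=
  'D_w (fun y => complex.Re (f y)) x +i* 'D_w (fun y => complex.Im (f y)) x.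

Lemma complex_sumE (I : Type) (r : seq I) (F G : I -> R) :
  (\sum_(i <- r) F i) +i* (\sum_(i <- r) G i) = \sum_(i <- r) (F i +i* G i) :> C.
Proof.
by elim: r => [|i r IH]; rewrite ?(big_nil, big_cons) // -IH.
Qed.

Lemma dirE f w x : dir w f x = \sum_i (w 0 i)%:C * partial f i x.
Proof.
have [c1 c2] := smf_smooth f 1; rewrite /dir.
case: (C1_is_derive x w c1) => _ ->; case: (C1_is_derive x w c2) => _ ->.
rewrite complex_sumE; apply: eq_bigr => i _; rewrite /partial.
by apply/eqP; rewrite eq_complex /= !mul0r subr0 addr0 !eqxx.
Qed.

Lemma dirE3 f w x : dir w f x =
  \sum_j ((complex.Re (zc w j))%:C * partial f (lshift 3 j) x +
          (complex.Im (zc w j))%:C * partial f (rshift 3 j) x).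
Proof. by rewrite dirE big_split_ord /= big_split. Qed.

Lemma zc_basis i j : zc (basis_vec R i) j =
  (lshift 3 j == i)%:R +i* (rshift 3 j == i)%:R.
Proof. by rewrite /zc /basis_vec !mxE. Qed.

(* The left-invariant frame d/dz_1, d/dz_2 + z_1 d/dz_3, d/dz_3, dual to
   omega^1, omega^2, - omega^3, and (for Y) its conjugate. *)
Definition X j f : smf := dd (lshift 3 j) f +
  (if j == i2 then zs R i1 * dd (lshift 3 i3) f else 0).
Definition Y j f : smf := dd (rshift 3 j) f +
  (if j == i2 then cj (zs R i1) * dd (rshift 3 i3) f else 0).

Lemma XB j : {morph X j : f g / f - g}.
Proof. by move=> f g; rewrite /X !raddfB /=; case: ifP => _; ring. Qed.
HB.instance Definition _ j := GRing.isZmodMorphism.Build smf smf (X j) (@XB j).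

Lemma YE j f : Y j f = cj (X j (cj f)).
Proof.
rewrite /X /Y raddfD /= !dd_cj cjK.
have cl k : conj_idx (lshift 3 k) = rshift 3 k.
  by rewrite /conj_idx (unsplitK (inl k)).
rewrite !cl; case: ifP => _; last by rewrite raddf0.
by rewrite rmorphM /= cjK.
Qed.

Lemma YB j : {morph Y j : f g / f - g}.
Proof. by move=> f g; rewrite !YE !raddfB. Qed.
HB.instance Definition _ j := GRing.isZmodMorphism.Build smf smf (Y j) (@YB j).

Lemma cjX j f : cj (X j f) = Y j (cj f).
Proof. by rewrite YE cjK. Qed.
Lemma cjY j f : cj (Y j f) = X j (cj f).
Proof. by rewrite YE cjK. Qed.

Lemma XM j f g : X j (f * g) = X j f * g + f * X j g.
Proof. by rewrite /X !ddM; case: ifP => _; ring. Qed.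
Lemma YM j f g : Y j (f * g) = Y j f * g + f * Y j g.
Proof. by rewrite !YE rmorphM XM rmorphD !rmorphM /= !cjK. Qed.

Lemma X_cs j c : X j (cs c) = 0.
Proof. by rewrite /X !dd_cs mulr0; case: ifP => _; rewrite addr0. Qed.
Lemma Y_cs j c : Y j (cs c) = 0.
Proof. by rewrite YE cj_cs X_cs raddf0. Qed.
Lemma X_csM j c f : X j (cs c * f) = cs c * X j f.
Proof. by rewrite XM X_cs mul0r add0r. Qed.
Lemma Y_csM j c f : Y j (cs c * f) = cs c * Y j f.
Proof. by rewrite YM Y_cs mul0r add0r. Qed.

Lemma dd_cj_zs k j : dd (lshift 3 j) (cj (zs R k)) = 0.
Proof.
by rewrite dd_cj dd_zs /conj_idx (unsplitK (inl j)) eq_lrshift raddf0.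
Qed.

Lemma dd_r_zs k j : dd (rshift 3 j) (zs R k) = 0.
Proof. by rewrite dd_zs eq_lrshift. Qed.

(** The only variable coefficient in [X] is holomorphic and the one in [Y] antiholomorphic, so
    neither is differentiated by the other field: the structure is complex parallelizable. *)
Lemma XY_comm j k f : X j (Y k f) = Y k (X j f).
Proof.
rewrite /X /Y !raddfD /=.
case: (j == i2); case: (k == i2); rewrite ?raddf0 ?ddM ?dd_cj_zs ?dd_r_zs;
  rewrite ![dd (rshift _ _) (dd (lshift _ _) _)]dd_comm; ring.
Qed.

(** [X i3] spans the centre of the Lie algebra. *)
Lemma X3_comm j f : X i3 (X j f) = X j (X i3 f).
Proof.
rewrite /X /= !addr0 raddfD /= (dd_comm _ (lshift 3 j)).
by case: (j == i2); rewrite ?raddf0 // ddM dd_zs eq_lshift /= mul0r add0r.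
Qed.

Lemma Y3_comm j f : Y i3 (Y j f) = Y j (Y i3 f).
Proof. by rewrite !YE !cjK X3_comm. Qed.
Lemma frame_dirE w f x : dir (frame w x) f x =
  dir w f x + dir (mkpoint 0 0 (zc x i1 * zc w i2)) f x.
Proof.
rewrite !dirE -big_split; apply: eq_bigr => i _ /=; rewrite -mulrDl mxE.
by congr (_ * _); apply/eqP; rewrite eq_complex /= addr0 !eqxx.
Qed.

Lemma dir_basis i f x : dir (basis_vec R i) f x = partial f i x.
Proof. by []. Qed.

Lemma dir3 (c : C) f x : dir (mkpoint 0 0 c) f x =
  (complex.Re c)%:C * partial f (lshift 3 i3) x +
  (complex.Im c)%:C * partial f (rshift 3 i3) x.
Proof. have r0 : (0 : R)%:C = 0 :> C by [].
rewrite dirE3 big_I3 zc_mk1 zc_mk2 zc_mk3.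
do 6!move: (partial f _ x) => ?.
by rewrite [in LHS]/(complex.Re 0) [in LHS]/(complex.Im 0) r0 !mul0r !addr0 !add0r. Qed.

Lemma split_l j : fintype.split (lshift 3 j) = inl j :> 'I_3 + 'I_3.
Proof. exact: (unsplitK (inl j)). Qed.
Lemma split_r j : fintype.split (rshift 3 j) = inr j :> 'I_3 + 'I_3.
Proof. exact: (unsplitK (inr j)). Qed.

Lemma zc_basis_l j k : zc (basis_vec R (lshift 3 j)) k = (k == j)%:R.
Proof.
by rewrite zc_basis eq_lshift eq_rlshift; case: eqP.
Qed.
Lemma zc_basis_r j k : zc (basis_vec R (rshift 3 j)) k = (k == j)%:R * 'i%C.
Proof.
rewrite zc_basis eq_lrshift eq_rshift; case: eqP => _; first by rewrite mul1r.
by rewrite mul0r.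
Qed.

(** Presents [X j] as a combination of two real left-invariant fields; its compatibility with
    [Gamma] and the vanishing of its mean are inherited from them. *)
Lemma X_dir j f x : X j f x =
  (dir (frame (basis_vec R (lshift 3 j)) x) f x -
   'i%C * dir (frame (basis_vec R (rshift 3 j)) x) f x) / 2%:R.
Proof.
have d0 : dir (mkpoint 0 0 0) f x = 0.
  rewrite dir3; move: (partial f _ x) (partial f _ x) => p q.
  by rewrite /= !mul0r addr0.
rewrite !frame_dirE !dir_basis /X.
rewrite (fun_if (fun g : smf => (dd (lshift 3 j) f + g) x)).
rewrite !(smfE, ddE) /wirtinger !split_l zsE zc_basis_l zc_basis_r eq_sym.
case: (i2 == j); last by rewrite mul0r !mulr0 d0 !addr0.
rewrite mulr1 mul1r !dir3 ReiNIm ImiRe.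
case: (zc x i1) => a b /=.
have -> : a +i* b = a%:C + 'i%C * b%:C :> C.
  by apply/eqP; rewrite eq_complex /= !(mul0r, mul1r, subr0, add0r, addr0) !eqxx.
have ii : 'i%C * 'i%C = -1 :> C by rewrite -expr2 sqr_i.
rewrite (rmorphN (@real_complex R)); move: (2%:R^-1 : C) => c.
set p := partial f (lshift 3 i3) x; set q := partial f (rshift 3 i3) x.
set A := a%:C; set B := b%:C; set I := 'i%C in ii *.
move: (partial f (lshift 3 j) x) (partial f (rshift 3 j) x) => P Q.
transitivity ((P - I * Q + A * p - A * I * q + I * B * p - (I * I) * B * q) * c).
  by ring.
by rewrite ii; ring.
Qed.

Lemma derive_comp_line (F : V -> R) (phi : V -> V) v w x :
  (forall h : R, phi (h *: v + x) = h *: w + phi x) ->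
  'D_w F (phi x) = 'D_v (fun y => F (phi y)) x.
Proof.
move=> e.
have E : (fun h : R => h^-1 *: ((F \o shift (phi x)) (h *: w) - F (phi x))) =
    (fun h => h^-1 *: (((fun y => F (phi y)) \o shift x) (h *: v) - F (phi x))).
  by apply/funext => h /=; rewrite e.
by rewrite /derive E.
Qed.

(** Left translation by [g] sends the line of right translates of [x] to that of [heis_mul g x], by
    associativity. *)
Lemma dir_heis_mul (g : V) f x i :
  dir (frame (basis_vec R i) (heis_mul g x)) f (heis_mul g x) =
  dir (frame (basis_vec R i) x) (fun y => f (heis_mul g y)) x.
Proof.
have e (h : R) : heis_mul g (h *: frame (basis_vec R i) x + x) =
   h *: frame (basis_vec R i) (heis_mul g x) + heis_mul g x.
  by rewrite -!heis_mul_frame heis_mulA.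
by rewrite /dir !(derive_comp_line _ e).
Qed.

Definition Ginv (Gamma : set V) (f : V -> C) :=
  forall g : V, Gamma g -> forall x, f (heis_mul g x) = f x.

Lemma Ginv_X Gamma j f : Ginv Gamma f -> Ginv Gamma (X j f).
Proof.
move=> fi g Gg x; rewrite (X_dir j f (heis_mul g x)) (X_dir j f x).
rewrite (dir_heis_mul g f x (lshift 3 j)) (dir_heis_mul g f x (rshift 3 j)).
have -> : (fun y => f (heis_mul g y)) = f by apply/funext => y; exact: fi.
by [].
Qed.

Lemma Ginv_cj Gamma f : Ginv Gamma f -> Ginv Gamma (cj f).
Proof. by move=> fi g Gg x; rewrite !cjE fi. Qed.

Lemma Ginv_Y Gamma j f : Ginv Gamma f -> Ginv Gamma (Y j f).
Proof. by move=> fi; rewrite YE; apply: Ginv_cj; apply: Ginv_X; apply: Ginv_cj. Qed.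

(** The central derivatives vanish first, which removes the correction terms in [X i2] and [Y i2];
    then all Wirtinger derivatives, hence all real partial derivatives, are zero. *)
Lemma const_of_frame f : (forall j, X j f = 0) -> (forall j, Y j f = 0) ->
  f = cs (f 0).
Proof.
move=> X0 Y0.
have d3 : dd (lshift 3 i3) f = 0 by rewrite -(X0 i3) /X addr0.
have d3' : dd (rshift 3 i3) f = 0 by rewrite -(Y0 i3) /Y addr0.
have dl j : dd (lshift 3 j) f = 0.
  by have := X0 j; rewrite /X d3 mulr0 if_same addr0.
have dr j : dd (rshift 3 j) f = 0.
  by have := Y0 j; rewrite /Y d3' mulr0 if_same addr0.
have n2 : (2%:R : C) != 0 by rewrite pnatr_eq0.
have p0 j x : partial f (lshift 3 j) x = 0 /\ partial f (rshift 3 j) x = 0.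
  have := congr1 (fun g : smf => g x) (dl j).
  have := congr1 (fun g : smf => g x) (dr j).
  rewrite !ddE /wirtinger split_l split_r smf0.
  move: (partial f (lshift 3 j) x) (partial f (rshift 3 j) x) => p q.
  move=> /eqP; rewrite mulf_eq0 invr_eq0 (negPf n2) orbF => /eqP e1.
  move=> /eqP; rewrite mulf_eq0 invr_eq0 (negPf n2) orbF => /eqP e2.
  have pl : p = 0.
    have : p + p = 0.
      by rewrite -[RHS]addr0 -{1}e1 -e2; ring.
    by rewrite -mulr2n => /eqP; rewrite mulrn_eq0 => /eqP.
  split=> //; move/eqP: e1; rewrite pl add0r mulf_eq0 => /orP[|/eqP//].
  by rewrite eq_complex /= oner_eq0 andbF.
have p0' i x : partial f i x = 0.
  by rewrite -(splitK i); case: (fintype.split i) => j; case: (p0 j x).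
apply: smf_eq => x; rewrite csE.
have [c1 c2] := smf_smooth f 1.
have r : complex.Re (f x) = complex.Re (f 0).
  by apply: (C1_const c1) => y i; have := p0' i y; rewrite /partial => -[].
have m : complex.Im (f x) = complex.Im (f 0).
  by apply: (C1_const c2) => y i; have := p0' i y; rewrite /partial => -[].
by apply/eqP; rewrite eq_complex r m !eqxx.
Qed.

End Frame.

(** * Nonnegative divergences vanish *)

Section UltraLimit.
Variables (R : realType) (I : Type) (U : set_system I).
Hypothesis UU : UltraFilter U.
Local Open Scope classical_set_scope.

(** Compactness of the interval provides a cluster point, and an ultrafilter converges to each of
    its cluster points. *)
Lemma ultra_bounded_cvg (a : I -> R) (B : R) :
  (forall i, `|a i| <= B) -> cvg (a @ U).
Proof.
move=> aB; have UI : U (a @^-1` [set` `[- B, B]%R]).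
  apply: filterE => i; have : a i \in `[- B, B]%R by rewrite in_itv /= -ler_norml.
  by [].
have [p [_ pU]] := @segment_compact R (- B) B (a @ U) _ UI.
apply/cvg_ex; exists p => N pN.
have [//|UN] := in_ultra_setVsetC (a @^-1` N) UU.
have [y [yN1 yN2]] := pU (~` N) N UN pN.
by case: yN1.
Qed.
End UltraLimit.

(** * Means on bounded functions *)

Section Mean.
Variables (R : realType) (T : Type).
Implicit Types (B : R).

Definition bnd (B : R) (f : T -> R) := forall x : T, `|f x| <= B.

(** [M] is total, so each law asks for a bound. The last law contains both positivity and, used for
    a constant and its opposite, the normalization of constants. *)
Record mean (M : (T -> R) -> R) : Prop := Mean {
  meanD : forall B (f g : T -> R), bnd B f -> bnd B g ->
    M (fun x => f x + g x) = M f + M g;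
  meanZ : forall B (f : T -> R) (c : R), bnd B f -> M (fun x => c * f x) = c * M f;
  mean_ge : forall B (f : T -> R) (c : R), bnd B f -> (forall x, c <= f x) -> c <= M f }.

End Mean.

Section InvariantMean.
Variables (R : realType) (Z : zmodType).
Implicit Types (f g : Z -> R) (B c : R) (t x : Z) (s : seq Z) (n : nat).

Definition avg n t f x : R := n.+1%:R^-1 * \sum_(k < n.+1) f (x + t *+ k).

(** The average over the box of all sums of multiples k t, with t in [s] and 0 <= k <= n: a Folner
    set of the subgroup generated by [s]. *)
Definition avgs n s f : Z -> R := foldr (avg n) f s.

Lemma avg_ge n t f c : (forall x, c <= f x) -> forall x, c <= avg n t f x.
Proof.
move=> cf x; rewrite /avg mulrC ler_pdivlMr // mulr_natr.
rewrite -[n.+1 in X in X <= _]card_ord -sumr_const.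
by apply: ler_sum => i _.
Qed.

Lemma avgD n t f g x : avg n t (fun x => f x + g x) x = avg n t f x + avg n t g x.
Proof. by rewrite /avg big_split mulrDr. Qed.

Lemma avgZ n t f c x : avg n t (fun x => c * f x) x = c * avg n t f x.
Proof. by rewrite /avg -mulr_sumr mulrCA. Qed.

Lemma avgs_ge n s f c : (forall x, c <= f x) -> forall x, c <= avgs n s f x.
Proof. by move=> cf; elim: s => //= t s IH x; exact: avg_ge. Qed.

Lemma avgsD n s f g : avgs n s (fun x => f x + g x) = (fun x => avgs n s f x + avgs n s g x).
Proof.
elim: s => //= t s ->; apply/funext => x; exact: avgD.
Qed.

Lemma avgsZ n s f c : avgs n s (fun x => c * f x) = (fun x => c * avgs n s f x).
Proof.
elim: s => //= t s ->; apply/funext => x; exact: avgZ.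
Qed.

Lemma avgsB n s f g x :
  avgs n s (fun x => f x - g x) x = avgs n s f x - avgs n s g x.
Proof.
rewrite avgsD; congr (_ + _).
have := avgsZ n s g (-1) => /(congr1 (fun h => h x)); rewrite mulN1r => <-.
by congr (avgs _ _ _ _); apply/funext => z; rewrite mulN1r.
Qed.

Lemma avgs_bnd n s f B : bnd B f -> bnd B (avgs n s f).
Proof.
move=> fB x; rewrite ler_norml; apply/andP; split.
  by apply: avgs_ge => y; have := fB y; rewrite ler_norml => /andP[].
rewrite -lerN2 -[- avgs _ _ _ _]mulN1r; have := avgsZ n s f (-1) => /(congr1 (fun h => h x)) <-.
by apply: avgs_ge => y; rewrite mulN1r lerN2; have := fB y; rewrite ler_norml => /andP[].
Qed.

Lemma avgs_shift n s f t : avgs n s (fun x => f (x + t)) = (fun x => avgs n s f (x + t)).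
Proof.
elim: s => //= u s ->; apply/funext => x; rewrite /avg.
by congr (_ * _); apply: eq_bigr => k _; rewrite addrAC.
Qed.

Lemma avg_diff n t f B x : bnd B f ->
  `|avg n t (fun x => f (x + t) - f x) x| <= n.+1%:R^-1 * (B + B).
Proof.
move=> fB; rewrite /avg normrM ger0_norm ?invr_ge0 //.
rewrite ler_wpM2l ?invr_ge0 //.
have -> : \sum_(k < n.+1) (f (x + t *+ k + t) - f (x + t *+ k)) =
    f (x + t *+ n.+1) - f x.
  elim: n => [|n IH]; first by rewrite big_ord1 mulr0n addr0 mulr1n.
  rewrite big_ord_recr /= IH -[x + t *+ n.+1 + t]addrA -mulrSr.
  by rewrite addrC addrA subrK.
by apply: (le_trans (ler_normB _ _)); apply: lerD.
Qed.

Lemma avg_bnd n t f B : bnd B f -> bnd B (avg n t f).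
Proof. exact: (@avgs_bnd n [:: t]). Qed.

(** The average in the direction [t] telescopes, leaving two boundary terms; the averages taken
    after it do not increase the bound, and those taken before it commute with the shift. *)
Lemma avgs_diff n s t f B : t \in s -> bnd B f ->
  bnd (n.+1%:R^-1 * (B + B)) (avgs n s (fun x => f (x + t) - f x)).
Proof.
elim: s => //= u s IH; rewrite in_cons => /orP[/eqP <-|ts] fB; last first.
  by apply: avg_bnd; exact: IH.
move=> x.
have -> : avgs n s (fun x => f (x + t) - f x) =
    fun x => avgs n s f (x + t) - avgs n s f x.
  by apply/funext => y; rewrite avgsB avgs_shift.
by apply: avg_diff; exact: avgs_bnd.
Qed.

Local Open Scope classical_set_scope.

Definition avg_filter : set_system (seq Z * nat) :=
  [set S : set (seq Z * nat) | exists s N,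
     forall p : seq Z * nat, {subset s <= p.1} -> (N <= p.2)%N -> S p].

Lemma avg_filter_proper : ProperFilter avg_filter.
Proof.
apply: Build_ProperFilter.
  by move=> [s [N /(_ (s, N))]]; apply.
split.
- by exists [::], 0%N.
- move=> P Q [s [N sN]] [s' [N' sN']]; exists (s ++ s'), (maxn N N') => p sp.
  rewrite geq_max => /andP[Np N'p]; split.
    by apply: sN => // x xs; apply: sp; rewrite mem_cat xs.
  by apply: sN' => // x xs; apply: sp; rewrite mem_cat xs orbT.
- by move=> P Q PQ [s [N sN]]; exists s, N => p sp Np; apply: PQ; exact: sN.
Qed.

(* The mean is the limit, along an ultrafilter refining the directed set of
   finite lists of translations, of the averages over long multiples of them. *)
Lemma exists_invariant_mean : exists2 M : (Z -> R) -> R, mean M &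
  forall B f t, bnd B f -> M (fun x => f (x + t)) = M f.
Proof.
have [U [UU FU]] := ultraFilterLemma avg_filter_proper.
pose a f (p : seq Z * nat) := avgs p.2 p.1 f 0.
have cv B f : bnd B f -> cvg (a f @ U).
  by move=> fB; apply: (ultra_bounded_cvg UU (B := B)) => p; exact: avgs_bnd.
exists (fun f => lim (a f @ U)).
  split=> [B f g fB gB|B f c fB|B f c fB cf].
  - rewrite (_ : a (fun x => f x + g x) = a f + a g).
      exact: (limD (cv _ _ fB) (cv _ _ gB)).
    by apply/funext => p; rewrite /a avgsD.
  - apply: cvg_lim => //; rewrite (_ : a _ = fun p => c * a f p).
      exact: (cvgMl_tmp (cv _ _ fB)).
    by apply/funext => p; rewrite /a avgsZ.
  - apply: limr_ge; first exact: (cv _ _ fB).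
    by apply: filterE => p; exact: avgs_ge.
move=> B f t fB.
have ftB : bnd B (fun x => f (x + t)) by move=> x; exact: fB.
apply/eqP; rewrite -subr_eq0; apply/eqP.
have NfB : bnd B (fun x => - f x) by move=> x; rewrite normrN; exact: fB.
rewrite -(limB (cv _ _ ftB) (cv _ _ fB)).
apply: cvg_lim => //.
apply/cvgr0Pnorm_le => e e0.
(* A shift by a member of the list changes the average by at most 2B / (n + 1), which is at most [e]
   as soon as n >= N. *)
have [N BN] : exists N : nat, B + B <= N%:R * e.
  exists (Num.trunc ((B + B) / e)).+1.
  rewrite -ler_pdivrMr //; apply: ltW.
  exact: truncnS_gt.
apply: FU; exists [:: t], N => -[s n] /= ts Nn.
have {}ts : t \in s by apply: ts; rewrite mem_head.
rewrite -[X in `|X|]/(avgs n s (fun x => f (x + t)) 0 - avgs n s f 0) -avgsB.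
apply: (le_trans (avgs_diff n ts fB 0)).
rewrite mulrC ler_pdivrMr // mulrC; apply: (le_trans BN).
by rewrite ler_wpM2r ?ler_nat ?(leq_trans Nn) // ltW.
Qed.

End InvariantMean.

Section MeanTheory.
Variables (R : realType) (T : Type) (M : (T -> R) -> R).
Hypothesis MM : mean M.
Implicit Types (B c : R) (f g : T -> R).

Lemma bndD B B' f g : bnd B f -> bnd B' g -> bnd (B + B') (fun x => f x + g x).
Proof. by move=> fB gB x; apply: (le_trans (ler_normD _ _)); exact: lerD. Qed.

Lemma bndZ B c f : bnd B f -> bnd (`|c| * B) (fun x => c * f x).
Proof. by move=> fB x; rewrite normrM ler_wpM2l. Qed.

Lemma bndW B B' f : B <= B' -> bnd B f -> bnd B' f.
Proof. by move=> BB fB x; exact: le_trans (fB x) BB. Qed.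

Lemma mean_add B B' f g : bnd B f -> bnd B' g ->
  M (fun x => f x + g x) = M f + M g.
Proof.
move=> fB gB; apply: (meanD MM (B := Num.max B B')).
  by apply: bndW fB; rewrite le_max lexx.
by apply: bndW gB; rewrite le_max lexx orbT.
Qed.

Lemma mean_bnd B f : bnd B f -> `|M f| <= B.
Proof.
move=> fB; rewrite ler_norml; apply/andP; split.
  by apply: (mean_ge MM fB) => x; have := fB x; rewrite ler_norml => /andP[].
rewrite -lerN2 -[- M f]mulN1r -(meanZ MM _ fB).
apply: (mean_ge MM (bndZ _ fB)) => x.
by rewrite mulN1r lerN2; have := fB x; rewrite ler_norml => /andP[].
Qed.

Lemma mean_sum (I : Type) (r : seq I) (B : I -> R) (F : I -> T -> R) :
  (forall i, bnd (B i) (F i)) ->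
  M (fun x => \sum_(i <- r) F i x) = \sum_(i <- r) M (F i).
Proof.
move=> FB; elim: r => [|i r IH].
  rewrite big_nil -[RHS](mul0r (M (fun=> 0))).
  rewrite -(meanZ MM (B := 0)); last by move=> x; rewrite normr0.
  by congr M; apply/funext => x; rewrite big_nil mul0r.
have rB : bnd (\sum_(i <- r) B i) (fun x => \sum_(i <- r) F i x).
  move=> x; elim: r {IH} => [|j r IH]; first by rewrite !big_nil normr0.
  by rewrite !big_cons; apply: (le_trans (ler_normD _ _)); apply: lerD => //; exact: FB.
rewrite big_cons -IH -(mean_add (FB i) rB).
by congr M; apply/funext => x; rewrite big_cons.
Qed.

End MeanTheory.

(** * A right-invariant mean on the Heisenberg group *)

Section HeisenbergMean.
Variable R : realType.
Notation V := (C3 R).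
Notation C := R[i].

(** The order of the iterated means matters. Right translation by [g] shifts z_3 by an amount
    depending on z_1; with z_3 innermost, z_1 is fixed there and the shift is an honest translation
    of C. *)
Lemma exists_heis_mean : exists2 M : (V -> R) -> R, mean M &
  forall (B : R) f (g : V), bnd B f -> M (fun x => f (heis_mul x g)) = M f.
Proof.
have [L ML Lt] := exists_invariant_mean R C.
have b3 (B : R) (f : V -> R) : bnd B f -> forall z1 z2, bnd B (fun z3 => f (mkpoint z1 z2 z3)).
  by move=> fB z1 z2 z3; exact: fB.
have b2 (B : R) (f : V -> R) : bnd B f ->
    forall z1, bnd B (fun z2 => L (fun z3 => f (mkpoint z1 z2 z3))).
  by move=> fB z1 z2; exact: (mean_bnd ML (b3 _ _ fB z1 z2)).
have b1 (B : R) (f : V -> R) : bnd B f ->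
    bnd B (fun z1 => L (fun z2 => L (fun z3 => f (mkpoint z1 z2 z3)))).
  by move=> fB z1; exact: (mean_bnd ML (b2 _ _ fB z1)).
exists (fun f => L (fun z1 => L (fun z2 => L (fun z3 => f (mkpoint z1 z2 z3))))).
  split=> [B f g fB gB|B f c fB|B f c fB cf].
  - rewrite -(meanD ML (b1 _ _ fB) (b1 _ _ gB)).
    congr L; apply/funext => z1; rewrite -(meanD ML (b2 _ _ fB z1) (b2 _ _ gB z1)).
    congr L; apply/funext => z2.
    by rewrite -(meanD ML (b3 _ _ fB z1 z2) (b3 _ _ gB z1 z2)).
  - rewrite -(meanZ ML _ (b1 _ _ fB)).
    congr L; apply/funext => z1; rewrite -(meanZ ML _ (b2 _ _ fB z1)).
    by congr L; apply/funext => z2; rewrite -(meanZ ML _ (b3 _ _ fB z1 z2)).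
  - apply: (mean_ge ML (b1 _ _ fB)) => z1.
    apply: (mean_ge ML (b2 _ _ fB z1)) => z2.
    by apply: (mean_ge ML (b3 _ _ fB z1 z2)) => z3; exact: cf.
move=> B f g fB.
rewrite -[RHS](Lt B _ (zc g i1) (b1 _ _ fB)).
congr L; apply/funext => z1.
rewrite -[RHS](Lt B _ (zc g i2) (b2 _ _ fB _)).
congr L; apply/funext => z2.
rewrite -[RHS](Lt B _ (zc g i3 + z1 * zc g i2) (b3 _ _ fB _ _)).
by congr L; apply/funext => z3; rewrite /heis_mul !zc_mkpoint /= addrA.
Qed.

End HeisenbergMean.

Lemma heis_mulr_continuous (R : realType) (g : C3 R) :
  continuous (fun z => heis_mul z g).
Proof.
have e (z : C3 R) : heis_mul z g = z + g +
  (z 0 (lshift 3 i1) *: mkpoint 0 0 (zc g i2) +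
   z 0 (rshift 3 i1) *: mkpoint 0 0 ('i%C * zc g i2)).
  apply: point_eq3; rewrite /heis_mul !zcE; try ring.
  have -> : zc z i1 = (z 0 (lshift 3 i1))%:C + 'i%C * (z 0 (rshift 3 i1))%:C.
    by rewrite [LHS]complexE.
  ring.
have cz i (w z : C3 R) : {for z, continuous (fun z : C3 R => z 0 i *: w)}.
  by apply: continuousZr_tmp; exact: coord_continuous.
rewrite (funext e) => z.
have c1 : {for z, continuous (fun z : C3 R => id z + cst g z)}.
  by apply: continuousD; [exact: cvg_id|exact: cst_continuous].
exact: (continuousD c1 (continuousD (cz _ _ z) (cz _ _ z))).
Qed.

(** * Divergences on the compact quotient have mean zero *)

Section NullFunctions.
Variables (R : realType) (Gamma : set (C3 R)).
Hypothesis hGamma : lattice Gamma.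
Notation V := (C3 R).
Notation C := R[i].
Notation smf := (smf R).
Notation inv := (@Ginv R Gamma).
Implicit Types (f g u v : smf) (x y : V).

(** All values of [f] are taken on the compact set [K] that meets every orbit of the lattice. *)
Lemma inv_bounded (f : V -> R) : continuous f ->
  (forall g : V, Gamma g -> forall x, f (heis_mul g x) = f x) ->
  exists B, bnd B f.
Proof.
move=> cf fi; have [_ _ _ _ [K cK KV]] := hGamma.
have K0 : (K !=set0)%classic by have [g [k [_ Kk _]]] := KV 0; exists k.
have [|c _ cmax] := @compact_EVT_max _ R (fun x => `|f x|) K K0 cK.
  apply: continuous_subspaceT => x.
  exact: (continuous_comp (cf x) (@norm_continuous _ R _)).
exists `|f c| => x; have [g [k [Gg Kk ->]]] := KV x.
by rewrite fi //; apply: cmax; rewrite inE.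
Qed.

Lemma inv_Re_bounded f : inv f -> exists B, bnd B (fun x => complex.Re (f x)).
Proof.
move=> fi; apply: inv_bounded; first by case: (smf_smooth f 0) => -[].
by move=> g Gg x; rewrite fi.
Qed.

Lemma inv_Im_bounded f : inv f -> exists B, bnd B (fun x => complex.Im (f x)).
Proof.
move=> fi; apply: inv_bounded; first by case: (smf_smooth f 0) => _ [].
by move=> g Gg x; rewrite fi.
Qed.

(* The derivative along a real direction of the left-invariant frame. *)
Definition W (i : idx) f : smf :=
  match fintype.split i with
  | inl j => X j f + Y j f
  | inr j => cs 'i%C * (X j f - Y j f)
  end.

Lemma dir_conj w (f : smf) x : dir w (fun y => conjc (f y)) x = conjc (dir w f x).
Proof.
have e (a : R) (p : C) : a%:C * conjc p = conjc (a%:C * p).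
  by rewrite conjM conjc_real.
rewrite (@dirE R (cj f) w x) (@dirE R f w x) (rmorph_sum (@conjc R)).
by apply: eq_bigr => i _; rewrite partial_conj; exact: e.
Qed.

Lemma Y_dir j f x : Y j f x =
  (dir (frame (basis_vec R (lshift 3 j)) x) f x +
   'i%C * dir (frame (basis_vec R (rshift 3 j)) x) f x) / 2%:R.
Proof.
rewrite YE cjE X_dir !dir_conj.
move: (dir _ _ _) (dir _ _ _) => p q.
have c2 : conjc (2%:R^-1 : C) = 2%:R^-1 by rewrite fmorphV rmorph_nat.
rewrite conjM c2; congr (_ * _); rewrite -mulNr conjD conjM !conjcK; congr (_ + _ * _).
by simpc.
Qed.

Lemma W_dir i f x : W i f x = dir (frame (basis_vec R i) x) f x.
Proof.
have n2 : (2%:R : C) != 0 by rewrite pnatr_eq0.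
have ii : 'i%C * 'i%C = -1 :> C by rewrite -expr2 sqr_i.
have dbl (a : C) : a + a = a * 2%:R by rewrite mulr_natr mulr2n.
rewrite /W; move: (splitK i); case: (fintype.split i) => j <-.
  rewrite -[LHS]/(X j f x + Y j f x) X_dir Y_dir.
  move: (dir _ _ _) (dir _ _ _) => p q.
  by rewrite -mulrDl addrACA addNr addr0 dbl mulfK.
rewrite -[LHS]/('i%C * (X j f x - Y j f x)) X_dir Y_dir.
move: (dir _ _ _) (dir _ _ _) => p q.
rewrite -mulrBl opprD addrACA subrr add0r -opprD dbl -mulNr mulfK //.
by rewrite mulrN mulrA ii mulN1r opprK.
Qed.

Lemma GinvD f g : inv f -> inv g -> inv (f + g).
Proof. by move=> fi gi h Gh x; rewrite !smfD (fi h Gh) (gi h Gh). Qed.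

Lemma GinvB f g : inv f -> inv g -> inv (f - g).
Proof. by move=> fi gi h Gh x; rewrite !smfB (fi h Gh) (gi h Gh). Qed.

Lemma GinvM f g : inv f -> inv g -> inv (f * g).
Proof. by move=> fi gi h Gh x; rewrite !smfM (fi h Gh) (gi h Gh). Qed.

Lemma Ginv_cs c : inv (cs c).
Proof. by []. Qed.

Lemma Ginv_sum (I : Type) (r : seq I) (P : pred I) (F : I -> smf) :
  (forall i, inv (F i)) -> inv (\sum_(i <- r | P i) F i).
Proof.
by move=> Fi; elim/big_rec: _ => // i g _; exact: GinvD.
Qed.

Lemma Ginv_W i f : inv f -> inv (W i f).
Proof.
move=> fi; rewrite /W; case: (fintype.split i) => j.
  by apply: GinvD; [exact: Ginv_X|exact: Ginv_Y].
apply: GinvM; first exact: Ginv_cs.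
by apply: GinvB; [exact: Ginv_X|exact: Ginv_Y].
Qed.

(* Second-order Taylor bound along the flow s |-> x * exp (s e_i). *)
Lemma mean_derive (M : (V -> R) -> R) (u u' u'' : V -> R) (i : idx) (B0 B1 B2 : R) :
  mean M ->
  (forall (B : R) (f : V -> R) (g : V), bnd B f -> M (fun x => f (heis_mul x g)) = M f) ->
  bnd B0 u -> bnd B1 u' -> bnd B2 u'' ->
  (forall y v : V, derivable u y v) -> (forall y v : V, derivable u' y v) ->
  (forall x, 'D_(frame (basis_vec R i) x) u x = u' x) ->
  (forall x, 'D_(frame (basis_vec R i) x) u' x = u'' x) ->
  M u' = 0.
Proof.
move=> MM Mt uB u'B u''B du du' e e'.
(* A basis direction has only one nonzero complex coordinate, so [frame_line] applies to it. *)
have b0 : zc (basis_vec R i) i1 * zc (basis_vec R i) i2 = 0.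
  rewrite -(splitK i); case: (fintype.split i) => j /=.
    rewrite !zc_basis_l; have [<-|_] := eqVneq i1 j; last by rewrite mul0r.
    by rewrite mulr0.
  rewrite !zc_basis_r; have [<-|_] := eqVneq i1 j; last by rewrite !mul0r.
  by rewrite !mul0r mulr0.
have B20 : 0 <= B2 by apply: le_trans (u''B 0).
have T s x : `|u (heis_mul x (s *: basis_vec R i)) - u x - s * u' x| <= B2 * s ^+ 2.
  rewrite heis_mul_frame; set v := frame _ x.
  have [c cs ec] := MVT_line0 x s (fun y => du y v).
  have [d ds ed] := MVT_line0 x c (fun y => du' y v).
  have eu : 'D_v u (c *: v + x) = u' (c *: v + x) by rewrite -e frame_line.
  have eu' : 'D_v u' (d *: v + x) = u'' (d *: v + x) by rewrite -e' frame_line.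
  rewrite ec eu [s * _]mulrC -mulrBl ed eu' !normrM -mulrA.
  apply: ler_pM => //; first by rewrite mulr_ge0.
  have -> : s ^+ 2 = `|s| * `|s| by rewrite -normrM -expr2 ger0_norm ?sqr_ge0.
  by rewrite ler_wpM2r.
(* The mean of the Taylor remainder: the translate of [u] and [u] itself have equal means, so only
   the first-order term is left. *)
have key s : `|s * M u'| <= B2 * s ^+ 2.
  have uhB : bnd B0 (fun x => u (heis_mul x (s *: basis_vec R i))).
    by move=> x; exact: uB.
  have := mean_bnd MM (T s).
  have nuB := bndZ (-1) uB; have nu'B := bndZ (- s) u'B.
  have -> : M (fun x => u (heis_mul x (s *: basis_vec R i)) - u x - s * u' x) =
      - (s * M u').
    rewrite (_ : (fun x => _) = (fun x => (u (heis_mul x (s *: basis_vec R i)) +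
       - 1 * u x) + (- s) * u' x)); last first.
      by apply/funext => x; rewrite mulN1r mulNr.
    rewrite (mean_add MM (bndD uhB nuB) nu'B) (mean_add MM uhB nuB).
    rewrite (meanZ MM _ uB) (meanZ MM _ u'B) (Mt _ _ _ uB).
    by rewrite mulN1r subrr add0r mulNr.
  by rewrite normrN.
apply/eqP; rewrite -normr_le0; apply/ler_addgt0Pr => s s0; rewrite add0r.
(* [B2] may be zero, so the step s / (B2 + 1) is used to bring the remainder below [s]. *)
have B21 : 0 < B2 + 1 by rewrite ltr_wpDl.
have := key (s / (B2 + 1)); set r := s / (B2 + 1).
have r0 : 0 < r by rewrite divr_gt0.
rewrite normrM (gtr0_norm r0) expr2 mulrCA ler_pM2l // => /le_trans; apply.
rewrite /r mulrA ler_pdivrMr // mulrC ler_wpM2l ?(ltW s0) //.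
by rewrite lerDl.
Qed.

(* Divergences of invariant vector fields: the invariant functions known to
   have vanishing integral over the quotient. *)
Definition null f := exists u v : 'I_3 -> smf,
  [/\ forall j, inv (u j), forall j, inv (v j) &
      f = \sum_j X j (u j) + \sum_j Y j (v j)].

Section Mean0.
Local Open Scope classical_set_scope.
Variable M : (V -> R) -> R.
Hypotheses (MM : mean M)
  (Mt : forall (B : R) (f : V -> R) (g : V),
    bnd B f -> M (fun x => f (heis_mul x g)) = M f).

Definition mean0 (h : V -> R) := (exists B, bnd B h) /\ M h = 0.

Lemma mean0D (h k : V -> R) : mean0 h -> mean0 k -> mean0 (fun x => h x + k x).
Proof.
move=> [[B hB] h0] [[B' kB] k0]; split; first by exists (B + B'); exact: bndD.
by rewrite (mean_add MM hB kB) h0 k0 addr0.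
Qed.

Lemma mean0Z (c : R) (h : V -> R) : mean0 h -> mean0 (fun x => c * h x).
Proof.
move=> [[B hB] h0]; split; first by exists (`|c| * B); exact: bndZ.
by rewrite (meanZ MM _ hB) h0 mulr0.
Qed.

Lemma mean0_sum3 (h : 'I_3 -> V -> R) : (forall j, mean0 (h j)) ->
  mean0 (fun x => \sum_j h j x).
Proof.
move=> h0; rewrite (_ : (fun x => _) = fun x => h i1 x + h i2 x + h i3 x).
  by do 2?apply: mean0D.
by apply/funext => x; rewrite big_I3.
Qed.

Lemma smf_derivable f (x v : V) : derivable (fun y => complex.Re (f y)) x v /\
  derivable (fun y => complex.Im (f y)) x v.
Proof.
have [c1 c2] := smf_smooth f 1.
by split; [case: (C1_is_derive x v c1)|case: (C1_is_derive x v c2)].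
Qed.

Lemma mean0_W i f : inv f -> mean0 (fun x => complex.Re (W i f x)) /\
  mean0 (fun x => complex.Im (W i f x)).
Proof.
move=> fi; have Wi := Ginv_W i fi; have WWi := Ginv_W i Wi.
have [B0 b0] := inv_Re_bounded fi; have [B0' b0'] := inv_Im_bounded fi.
have [B1 b1] := inv_Re_bounded Wi; have [B1' b1'] := inv_Im_bounded Wi.
have [B2 b2] := inv_Re_bounded WWi; have [B2' b2'] := inv_Im_bounded WWi.
split; (split; first by [exists B1|exists B1']).
  apply: (mean_derive MM Mt b0 b1 b2 (i := i)) => [y v|y v|x|x].
  - by case: (smf_derivable f y v).
  - by case: (smf_derivable (W i f) y v).
  - by rewrite W_dir.
  - by rewrite W_dir.
apply: (mean_derive MM Mt b0' b1' b2' (i := i)) => [y v|y v|x|x].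
- by case: (smf_derivable f y v).
- by case: (smf_derivable (W i f) y v).
- by rewrite W_dir.
- by rewrite W_dir.
Qed.

Lemma Re_half (p q : C) : complex.Re ((p - 'i%C * q) / 2%:R) =
  2%:R^-1 * (complex.Re p + complex.Im q).
Proof.
have -> : 2%:R^-1 = (2%:R^-1 : R)%:C :> C by rewrite rmorphV ?unitfE ?pnatr_eq0 // rmorph_nat.
by case: p => a b; case: q => c d /=; ring.
Qed.

(** The mean is real-valued, so divergences enter through their real parts; this suffices because
    they are finally compared with a nonnegative function. *)
Lemma mean0_X j f : inv f -> mean0 (fun x => complex.Re (X j f x)).
Proof.
move=> fi; have [r _] := mean0_W (lshift 3 j) fi.
have [_ m] := mean0_W (rshift 3 j) fi.
rewrite (_ : (fun x => _) = fun x => 2%:R^-1 *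
  (complex.Re (W (lshift 3 j) f x) + complex.Im (W (rshift 3 j) f x))).
  by apply: mean0Z; exact: mean0D.
by apply/funext => x; rewrite X_dir -!W_dir Re_half.
Qed.

Lemma mean0_null f : null f -> mean0 (fun x => complex.Re (f x)).
Proof.
move=> [u [v [ui vi ->]]].
(* Real parts do not see conjugation, so each [Y j (v j)] may be replaced by its conjugate
   [X j (cj (v j))]. *)
rewrite (_ : (fun x => _) = fun x => \sum_j complex.Re (X j (u j) x) +
  \sum_j complex.Re (X j (cj (v j)) x)).
  apply: mean0D; apply: mean0_sum3 => j; apply: mean0_X => //.
  exact: Ginv_cj.
have Re_sum (F : 'I_3 -> C) : complex.Re (\sum_j F j) = \sum_j complex.Re (F j).
  exact: (big_morph (@complex.Re R) (@creD R) erefl).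
apply/funext => x; rewrite smfD creD !smf_sum !Re_sum; congr (_ + _).
by apply: eq_bigr => j _; rewrite YE cjE; case: (X _ _ _).
Qed.

(* By compactness finitely many right translates of r have a sum bounded below
   by a positive constant, unless r vanishes. *)
Lemma mean0_ge0 (r : V -> R) : continuous r ->
  (forall g : V, Gamma g -> forall x, r (heis_mul g x) = r x) ->
  mean0 r -> (forall x, 0 <= r x) -> forall x, r x = 0.
Proof.
move=> cr ri [[B rB] Mr] r0 x0; apply/eqP; apply: contraT => rx0.
have {rx0} rx0 : 0 < r x0 by rewrite lt_def rx0 r0.
have [_ _ _ _ [K cK KV]] := hGamma.
(* Right translation by [h y] carries [y] to [x0], where [r] is positive; hence [y] lies in the open
   set [O y]. *)
pose h (y : V) := heis_mul (heis_inv y) x0.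
pose c := r x0 / 2%:R.
have c0 : 0 < c by rewrite divr_gt0.
pose O (y : V) : set V := [set z | c < r (heis_mul z (h y))]%classic.
have chg (g : V) : continuous (fun z => r (heis_mul z g)).
  by move=> z; exact: (continuous_comp (@heis_mulr_continuous R g z) (cr _)).
have cover : K `<=` cover setT O.
  move=> y Ky; exists y => //; rewrite /O /= /h heis_mulA heis_mulxV heis_mul0x.
  by rewrite /c ltr_pdivrMr // mulr_natr mulr2n ltrDl.
have oO y : setT y -> open (O y).
  move=> _; apply: (@open_comp _ _ (fun z => r (heis_mul z (h y))) [set t | c < t]).
    by move=> z _; exact: chg.
  exact: open_gt.
move: cK; rewrite compact_cover => /(_ V setT O oO cover) [D _ KD].
(* The bound holds on [K] by the finite cover and everywhere else because left translations by the
   lattice commute with right translations. The mean of the sum is nevertheless zero by right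
   invariance. *)
have Dge (y : V) : c <= \sum_(a <- D) r (heis_mul y (h a)).
  have [g [k [Gg Kk ->]]] := KV y.
  under eq_bigr do rewrite -heis_mulA ri //.
  have [a /= aD ak] := KD k Kk.
  rewrite (big_rem a) //=; apply: ler_wpDr; last exact: ltW.
  by apply: sumr_ge0 => b _; exact: r0.
have Db a : bnd B (fun y => r (heis_mul y (h a))) by move=> y; exact: rB.
have SB : bnd (\sum_(a <- D) B) (fun y => \sum_(a <- D) r (heis_mul y (h a))).
  move=> y; apply: (le_trans (ler_norm_sum _ _ _)).
  by apply: ler_sum => a _; exact: Db.
have := mean_ge MM SB Dge.
rewrite (mean_sum MM _ Db) big1 ?leNgt ?c0 // => a _.
by rewrite (Mt _ rB).
Qed.

End Mean0.

(** The substitute for Stokes' theorem on the quotient, through which all later integrations by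
    parts pass. *)
Lemma null_ge0 f : inv f -> null f -> (forall x, 0 <= f x) -> f = 0.
Proof.
move=> fi nf f0; have [M MM Mt] := exists_heis_mean R.
have fE x : f x = (complex.Re (f x))%:C.
  by have := f0 x; case: (f x) => a b; rewrite lecE /= => /andP[/eqP -> _].
apply: smf_eq => x; rewrite fE smf0.
rewrite (mean0_ge0 MM Mt _ _ (mean0_null MM Mt nf)) //.
- by case: (smf_smooth f 0) => -[].
- by move=> g Gg y; rewrite fi.
- by move=> y; have := f0 y; rewrite lecE /= => /andP[].
Qed.

End NullFunctions.

(** * Rigidity of the first order system *)

Section PositiveDefinite.
Local Open Scope sesquilinear_scope.
Variables (F : numClosedFieldType) (n : nat) (H : 'M[F]_n).
Hypotheses (Hh : H ^t* = H)
  (Hpos : forall u : 'rV_n, u != 0 -> 0 < (u *m H *m u ^t*) 0 0).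

(** In an orthonormal eigenbasis of [H] the trace becomes the sum of d_i d_j |c_ij|^2 with all d_i
    positive, where c is the conjugate of [b] by the unitary [P]. *)
Lemma posdef_tr (b : 'M[F]_n) : 0 <= \tr (H *m b *m H *m b ^t*) /\
  (\tr (H *m b *m H *m b ^t*) = 0 -> b = 0).
Proof.
have /orthomx_spectralP : H \is normalmx by apply/normalmxP; rewrite Hh.
set P := spectralmx H; set d := spectral_diag H => HE.
have uP : P \is unitarymx := spectral_unitarymx H.
have PP : P *m P ^t* = 1%:M := elimT unitarymxP uP.
have PP' : P ^t* *m P = 1%:M by exact: mulmx1C.
rewrite (invmx_unitary uP) in HE.
have d0 i : 0 < d 0 i.
  have ui : row i P != 0.
    apply/eqP => r0; have := congr1 (row i) PP.
    by rewrite row_mul r0 mul0mx row1 => /rowP/(_ i)/eqP; rewrite !mxE !eqxx eq_sym oner_eq0.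
  have := Hpos ui; rewrite HE !mulmxA -row_mul PP row1.
  rewrite -(mulmxA _ P) -rowE.
  rewrite (_ : P *m (row i P) ^t* = (delta_mx 0 i)^T); last first.
    by rewrite tr_row map_col colE mulmxA PP mul1mx trmx_delta.
  rewrite row_diag_mx -scalemxAl mxE trmx_delta mul_delta_mx_cond eqxx mulr1n.
  by rewrite mxE !eqxx mulr1.
set c := P *m b *m P ^t*.
have trE : \tr (H *m b *m H *m b ^t*) = \sum_i \sum_j d 0 i * d 0 j * `|c i j| ^+ 2.
  have cE : c ^t* = P *m b ^t* *m P ^t*.
    by rewrite /c !trmx_mul !map_mxM trmxCK mulmxA.
  have -> : \tr (H *m b *m H *m b ^t*) = \tr (diag_mx d *m c *m diag_mx d *m c ^t*).
    rewrite cE /c HE !mulmxA [RHS]mxtrace_mulC !mulmxA //.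
  rewrite /mxtrace; apply: eq_bigr => i _.
  rewrite mxE; apply: eq_bigr => j _.
  rewrite mul_mx_diag mul_diag_mx !mxE normCK; ring.
have dij i j : 0 < d 0 i * d 0 j by rewrite mulr_gt0.
have t0 i j : 0 <= d 0 i * d 0 j * `|c i j| ^+ 2.
  by rewrite mulr_ge0 ?exprn_ge0 // ltW.
rewrite trE; split; first by apply: sumr_ge0 => i _; exact: sumr_ge0.
move=> /eqP; rewrite psumr_eq0 => [/allP c0|i _]; last exact: sumr_ge0.
have {}c0 : c = 0.
  apply/matrixP => i j; rewrite [RHS]mxE.
  have := c0 i; rewrite mem_index_enum /= => /(_ isT).
  rewrite psumr_eq0 // => /allP/(_ j); rewrite mem_index_enum /= => /(_ isT).
  rewrite mulf_eq0 (gt_eqF (dij i j)) /= expf_eq0 /= normr_eq0.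
  by move/eqP.
have -> : b = P ^t* *m c *m P.
  by rewrite /c !mulmxA PP' mul1mx -mulmxA PP' mulmx1.
by rewrite c0 mulmx0 mul0mx.
Qed.
End PositiveDefinite.

(** * Divergence-free matrices satisfying the curl-curl equation *)

Section Core.
Variables (R : realType) (Gamma : set (C3 R)).
Hypothesis hGamma : lattice Gamma.
Notation V := (C3 R).
Notation C := R[i].
Notation smf := (smf R).
Notation inv := (@Ginv R Gamma).
Notation null := (@null R Gamma).
Implicit Types (f g u v : smf) (x y : V) (j k l m n : 'I_3).

Lemma nullX j f : inv f -> null (X j f).
Proof.
move=> fi; exists (fun k => if k == j then f else 0), (fun=> 0); split=> // [k|].
  by case: ifP.
rewrite [X in _ + X]big1 => [|k _]; last exact: raddf0.
by rewrite addr0 (bigD1 j) //= eqxx big1 ?addr0 // => k /negPf ->; rewrite raddf0.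
Qed.

Lemma nullY j f : inv f -> null (Y j f).
Proof.
move=> fi; exists (fun=> 0), (fun k => if k == j then f else 0); split=> // [k|].
  by case: ifP.
rewrite [X in X + _]big1 => [|k _]; last exact: raddf0.
by rewrite add0r (bigD1 j) //= eqxx big1 ?addr0 // => k /negPf ->; rewrite raddf0.
Qed.

Lemma nullB f g : null f -> null g -> null (f - g).
Proof.
move=> [u [v [ui vi ->]]] [u' [v' [ui' vi' ->]]].
exists (fun j => u j - u' j), (fun j => v j - v' j); split=> [j|j|].
- exact: GinvB.
- exact: GinvB.
- by rewrite opprD addrACA -!sumrB; congr (_ + _);
    apply: eq_bigr => j _; rewrite raddfB.
Qed.

Lemma null0 : null 0.
Proof. by rewrite -(subrr (X i1 0)); apply: nullB; exact: nullX. Qed.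

Lemma nullD f g : null f -> null g -> null (f + g).
Proof.
by move=> nf ng; rewrite -[g]opprK -[- g]sub0r; do 2?apply: nullB => //; exact: null0.
Qed.

Lemma null_sum (F : 'I_3 -> smf) : (forall j, null (F j)) -> null (\sum_j F j).
Proof. by move=> nF; rewrite big_I3; do 2?apply: nullD. Qed.

Lemma null_mulc f g : inv g -> (forall j, X j g = 0) -> (forall j, Y j g = 0) ->
  null f -> null (f * g).
Proof.
move=> gi Xg Yg [u [v [ui vi ->]]].
exists (fun j => u j * g), (fun j => v j * g); split=> [j|j|]; try exact: GinvM.
rewrite mulrDl !mulr_suml; congr (_ + _); apply: eq_bigr => j _.
  by rewrite XM Xg mulr0 addr0.
by rewrite YM Yg mulr0 addr0.
Qed.

Lemma normsq_eq0 f : (forall x, f x * cj f x = 0) -> f = 0.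
Proof.
move=> f0; apply: smf_eq => x; apply/eqP; have /eqP := f0 x.
by rewrite cjE mulf_eq0 => /orP[//|]; rewrite fmorph_eq0.
Qed.

Lemma normsq_ge0 f x : 0 <= (f * cj f) x.
Proof. by rewrite smfM cjE; exact: mul_conjC_ge0. Qed.

Lemma null_normsq f : inv f -> null (f * cj f) -> f = 0.
Proof.
move=> fi nf; have f0 := null_ge0 hGamma (GinvM fi (Ginv_cj fi)) nf (normsq_ge0 f).
by apply: normsq_eq0 => x; rewrite -smfM f0.
Qed.

(** A divergence times a constant is a divergence, so the squared modulus of [f] is one too. *)
Lemma const_null f : inv f -> null f -> (forall j, X j f = 0) ->
  (forall j, Y j f = 0) -> f = 0.
Proof.
move=> fi nf Xf Yf; apply: null_normsq => //; apply: null_mulc => // [|j|j].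
- exact: Ginv_cj.
- by rewrite -cjY Yf raddf0.
- by rewrite -cjX Xf raddf0.
Qed.

(* The skew-adjointness of X_m and its conjugate makes a solution of X_m f = 0
   antiholomorphic in all directions at once. *)
Lemma Y_eq0 m f : inv f -> X m (Y m f) = 0 -> Y m f = 0.
Proof.
move=> fi XY0; apply: null_normsq; first exact: Ginv_Y.
have -> : Y m f * cj (Y m f) = X m (Y m f * cj f).
  by rewrite XM XY0 mul0r add0r cjY.
by apply: nullX; apply: GinvM; [exact: Ginv_Y|exact: Ginv_cj].
Qed.

Lemma X_eq0 m f : inv f -> Y m f = 0 -> X m f = 0.
Proof.
move=> fi Y0; apply: (inv_inj (@cjK R)); rewrite cjX raddf0.
apply: Y_eq0; first exact: Ginv_cj.
by rewrite XY_comm -cjY Y0 !raddf0.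
Qed.

Lemma Y_eq0' m f : inv f -> X m f = 0 -> Y m f = 0.
Proof. by move=> fi X0; apply: Y_eq0 => //; rewrite XY_comm X0 raddf0. Qed.

(* The components of the derivative of a (1,0)-form with coefficients p in the
   left-invariant coframe; the term - p i3 comes from its structure equation. *)
Definition curlX (p : 'I_3 -> smf) (m : 'I_3) : smf :=
  if m == i1 then X i2 (p i3) - X i3 (p i2)
  else if m == i2 then X i3 (p i1) - X i1 (p i3)
  else X i1 (p i2) - X i2 (p i1) - p i3.

Definition curlY (p : 'I_3 -> smf) (m : 'I_3) : smf :=
  if m == i1 then Y i2 (p i3) - Y i3 (p i2)
  else if m == i2 then Y i3 (p i1) - Y i1 (p i3)
  else Y i1 (p i2) - Y i2 (p i1) - p i3.

Definition vec3 (f1 f2 f3 : smf) j : smf :=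
  if j == i1 then f1 else if j == i2 then f2 else f3.

Lemma vec3_inv f1 f2 f3 : inv f1 -> inv f2 -> inv f3 ->
  forall j, inv (vec3 f1 f2 f3 j).
Proof. by move=> ? ? ? j; rewrite /vec3; case: ifP => // _; case: ifP. Qed.

Lemma curlX_inv (p : 'I_3 -> smf) m : (forall j, inv (p j)) -> inv (curlX p m).
Proof.
move=> pi; rewrite /curlX; case: ifP => _; last case: ifP => _.
- exact: (GinvB (Ginv_X _ (pi _)) (Ginv_X _ (pi _))).
- exact: (GinvB (Ginv_X _ (pi _)) (Ginv_X _ (pi _))).
- exact: (GinvB (GinvB (Ginv_X _ (pi _)) (Ginv_X _ (pi _))) (pi _)).
Qed.

Lemma GinvN f : inv f -> inv (- f).
Proof. by move=> fi; rewrite -sub0r; exact: (GinvB (Ginv_cs 0) fi). Qed.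

Lemma XN j f : X j (- f) = - X j f. Proof. exact: raddfN. Qed.
Lemma YN j f : Y j (- f) = - Y j f. Proof. exact: raddfN. Qed.
Lemma X0 j : X j 0 = 0 :> smf. Proof. exact: raddf0. Qed.
Lemma Y0 j : Y j 0 = 0 :> smf. Proof. exact: raddf0. Qed.
Definition XYE := (XB, YB, XN, YN, X0, Y0).

Section CurlFree.
Variable (g : 'I_3 -> 'I_3 -> smf).
Hypothesis curl0 : forall m n, curlX (fun j => curlY (fun k => g j k) n) m = 0.

(* The components of the curl equation, rearranged so that a second derivative
   of every g j k is a divergence plus a conjugate divergence. *)
Lemma curl_direction3 j k : X i3 (Y i3 (g j k)) = X j (Y i3 (g i3 k)) +
  Y k (vec3 (curlX (fun j => g j i3) i2) (- curlX (fun j => g j i3) i1) 0 j).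
Proof.
have := curl0 i1 i1; have := curl0 i1 i2; have := curl0 i2 i1; have := curl0 i2 i2.
rewrite /curlX /curlY /= !XYE => e22 e21 e12 e11.
move: j k; apply: I3P; apply: I3P;
  rewrite /vec3 /= !XYE -?XY_comm ?X3_comm ?Y3_comm; try ring.
- by rewrite -[LHS]subr0 -e22; ring.
- by rewrite -[LHS]addr0 -e21; ring.
- by rewrite -[LHS]addr0 -e12; ring.
- by rewrite -[LHS]subr0 -e11; ring.
Qed.

Hypotheses (gi : forall j k, inv (g j k)) (X3g : forall j k, X i3 (g j k) = 0)
  (Y3g : forall j k, Y i3 (g j k) = 0).

Lemma X3Yg l j k : X i3 (Y l (g j k)) = 0.
Proof. by rewrite XY_comm X3g Y0. Qed.

Definition g3E := (X3Yg, X3g, Y3g, X0, Y0, subr0, sub0r, addr0, add0r).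

(** Without central derivatives the (1,1) and (2,2) components reduce to X_2 Y_2 g_33 = 0 and X_1
    Y_1 g_33 = 0, to which [Y_eq0] applies. *)
Lemma g33_const j : X j (g i3 i3) = 0 /\ Y j (g i3 i3) = 0.
Proof.
have e11 := curl0 i1 i1; have e22 := curl0 i2 i2.
rewrite /curlX /curlY /= !XYE !g3E !opprK in e11 e22.
have y1 := Y_eq0 (gi _ _) e22; have y2 := Y_eq0 (gi _ _) e11.
have x1 := X_eq0 (gi _ _) y1; have x2 := X_eq0 (gi _ _) y2.
by move: j; apply: I3P; rewrite ?y1 ?y2 ?x1 ?x2 ?X3g ?Y3g.
Qed.

Lemma Xg33 j : X j (g i3 i3) = 0. Proof. by case: (g33_const j). Qed.
Lemma Yg33 j : Y j (g i3 i3) = 0. Proof. by case: (g33_const j). Qed.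

(** The difference [w] is itself a divergence, and the (1,3) and (2,3) components make it constant
    because g_33 is; a constant divergence is zero. [col3_closed] is the mirror argument. *)
Lemma row3_closed : Y i1 (g i3 i2) = Y i2 (g i3 i1).
Proof.
set w := Y i1 (g i3 i2) - Y i2 (g i3 i1).
have wi : inv w by exact: (GinvB (Ginv_Y _ (gi _ _)) (Ginv_Y _ (gi _ _))).
have Xw j : X j w = 0.
  have e1 := curl0 i1 i3; have e2 := curl0 i2 i3.
  rewrite /curlX /curlY /= !XYE !g3E ?opprB ?Xg33 in e1 e2.
  rewrite /w XB; move: j; apply: I3P.
  - by rewrite -[RHS]oppr0 -e2; ring.
  - by rewrite -e1; ring.
  - by rewrite !g3E.
have w0 : w = 0.
  apply: const_null => // [|j]; last exact: Y_eq0'.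
  by apply: nullB; apply: nullY; exact: gi.
by apply/eqP; rewrite -subr_eq0 -/w w0.
Qed.

Lemma col3_closed : X i1 (g i2 i3) = X i2 (g i1 i3).
Proof.
set w := X i1 (g i2 i3) - X i2 (g i1 i3).
have wi : inv w by exact: (GinvB (Ginv_X _ (gi _ _)) (Ginv_X _ (gi _ _))).
have Yw j : Y j w = 0.
  have e1 := curl0 i3 i1; have e2 := curl0 i3 i2.
  rewrite /curlX /curlY /= !XYE !g3E ?Yg33 in e1 e2.
  rewrite /w YB -!XY_comm; move: j; apply: I3P.
  - by rewrite -[RHS]oppr0 -e2; ring.
  - by rewrite -e1; ring.
  - by rewrite !g3E.
have w0 : w = 0.
  apply: const_null => // [|j]; last exact: X_eq0.
  by apply: nullB; apply: nullX; exact: gi.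
by apply/eqP; rewrite -subr_eq0 -/w w0.
Qed.

(** Both curls have a zeroth-order term here. The terms in which only one of them acts cancel by
    [row3_closed] and [col3_closed]; the product of the two leaves g_33. *)
Lemma curl33 : X i1 (Y i1 (g i2 i2)) - X i1 (Y i2 (g i2 i1)) -
  X i2 (Y i1 (g i1 i2)) + X i2 (Y i2 (g i1 i1)) + g i3 i3 = 0.
Proof.
have e := curl0 i3 i3; rewrite /curlX /curlY /= !XYE row3_closed col3_closed in e.
by rewrite -e; ring.
Qed.

(** [curl33] writes the constant g_33 as a sum of divergences. *)
Lemma g33_eq0 : g i3 i3 = 0.
Proof.
apply: const_null (gi _ _) _ Xg33 Yg33.
have -> : g i3 i3 = X i1 (Y i2 (g i2 i1)) - X i1 (Y i1 (g i2 i2)) +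
    (X i2 (Y i1 (g i1 i2)) - X i2 (Y i2 (g i1 i1))).
  by rewrite -[LHS]subr0 -curl33; ring.
by apply: nullD; apply: nullB; apply: nullX; exact: (Ginv_Y _ (gi _ _)).
Qed.

(** Only the (2,2) entry is the equation [curl33], now without its last term. In the third row and
    column closedness and the constancy of g_33 enter; the other entries are identities. *)
Lemma curl_direction1 j k : X i1 (Y i1 (g j k)) =
  X j (vec3 0 (Y i1 (g i1 i2) - Y i2 (g i1 i1)) (Y i1 (g i1 i3)) k) +
  Y k (X i1 (g j i1)).
Proof.
have e := curl33; rewrite g33_eq0 addr0 in e.
move: j k; apply: I3P; apply: I3P; rewrite /vec3 /= ?XYE -?XY_comm ?g3E
  ?Xg33 ?Yg33 ?g3E ?row3_closed //; try ring.
- by rewrite -[LHS]subr0 -e; ring.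
- by rewrite XY_comm col3_closed -XY_comm.
Qed.

Lemma curl_direction2 j k : X i2 (Y i2 (g j k)) =
  X j (vec3 (Y i2 (g i2 i1) - Y i1 (g i2 i2)) 0 (Y i2 (g i2 i3)) k) +
  Y k (X i2 (g j i2)).
Proof.
have e := curl33; rewrite g33_eq0 addr0 in e.
move: j k; apply: I3P; apply: I3P; rewrite /vec3 /= ?XYE -?XY_comm ?g3E
  ?Xg33 ?Yg33 ?g3E ?row3_closed //; try ring.
- by rewrite -[LHS]subr0 -e; ring.
- by rewrite [RHS]XY_comm col3_closed -XY_comm.
Qed.

End CurlFree.

Variables (A : 'I_3 -> 'I_3 -> smf) (H : 'M[C]_3).
Hypotheses (Hh : forall j k, conjc (H k j) = H j k)
  (Hpos : forall u : 'rV[C]_3, u != 0 ->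
     0 < \sum_j \sum_k u 0 j * H j k * conjc (u 0 k)).
Hypotheses (Ai : forall j k, inv (A j k))
  (divX : forall k, \sum_j X j (A j k) = 0)
  (divY : forall j, \sum_k Y k (A j k) = 0).

(** The entries of H B^T H, written out because [B] has function entries while [H] is a matrix of
    numbers. *)
Definition flat (B : 'I_3 -> 'I_3 -> smf) j k : smf :=
  \sum_l \sum_m cs (H j l) * B m l * cs (H m k).

Let g := flat A.

Hypothesis curl0 : forall m n, curlX (fun j => curlY (fun k => g j k) n) m = 0.

Lemma gi j k : inv (g j k).
Proof.
apply: Ginv_sum => l; apply: Ginv_sum => m.
by apply: GinvM => //; apply: GinvM.
Qed.

Lemma flatX m (B : 'I_3 -> 'I_3 -> smf) j k : X m (flat B j k) =
  flat (fun j k => X m (B j k)) j k.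
Proof.
rewrite /flat raddf_sum; apply: eq_bigr => l _; rewrite raddf_sum.
apply: eq_bigr => n _ /=.
by rewrite mulrC X_csM X_csM mulrC.
Qed.

Lemma flatY m (B : 'I_3 -> 'I_3 -> smf) j k : Y m (flat B j k) =
  flat (fun j k => Y m (B j k)) j k.
Proof.
rewrite /flat raddf_sum; apply: eq_bigr => l _; rewrite raddf_sum.
apply: eq_bigr => n _ /=.
by rewrite mulrC Y_csM Y_csM mulrC.
Qed.

(** With b the transpose of the value of [B] at [x], the pairing is the trace form of [posdef_tr];
    this dictates the swapped indices in [cj (B k j)]. *)
Lemma flat_tr (B : 'I_3 -> 'I_3 -> smf) x :
  let b := \matrix_(j, k) B k j x in
  (\sum_j \sum_k flat B j k * cj (B k j)) x = \tr (H *m b *m H *m (b ^t*)%sesqui).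
Proof.
move=> b; rewrite smf_sum /mxtrace; apply: eq_bigr => j _.
rewrite smf_sum mxE; apply: eq_bigr => k _; rewrite smfM cjE /flat !mxE.
congr (_ * _).
rewrite smf_sum (eq_bigr (fun l => \sum_m H j l * B m l x * H m k)); last first.
  by move=> l _; rewrite smf_sum.
rewrite exchange_big /=; apply: eq_bigr => m _.
by rewrite !mxE mulr_suml; apply: eq_bigr => l _; rewrite mxE.
Qed.

Lemma flat_pos (B : 'I_3 -> 'I_3 -> smf) :
  (forall x, 0 <= (\sum_j \sum_k flat B j k * cj (B k j)) x) /\
  (\sum_j \sum_k flat B j k * cj (B k j) = 0 -> forall j k, B j k = 0).
Proof.
have HhM : (H ^t*)%sesqui = H by apply/matrixP => j k; rewrite !mxE; exact: Hh.
have HposM (u : 'rV[C]_3) : u != 0 -> 0 < (u *m H *m (u ^t*)%sesqui) 0 0.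
  move=> u0; have := Hpos u0; rewrite exchange_big /= => /lt_le_trans; apply.
  rewrite le_eqVlt; apply/orP; left; apply/eqP; rewrite mxE.
  apply: eq_bigr => k _; rewrite !mxE mulr_suml; apply: eq_bigr => j _.
  by [].
split=> [x|B0 j k].
  by rewrite flat_tr; case: (posdef_tr HhM HposM (\matrix_(j, k) B k j x)).
apply: smf_eq => x; have [_] := posdef_tr HhM HposM (\matrix_(j, k) B k j x).
by rewrite -flat_tr B0 => /(_ erefl) /matrixP/(_ k j); rewrite !mxE.
Qed.

(* Pairing the divergence identity e with the conjugate of A, whose rows and
   columns are divergence free, shows that the positive function
   flat (Y m A) * conj (Y m A) is null. *)
Lemma frame_deriv_eq0 m (p q : 'I_3 -> smf) : (forall k, inv (p k)) -> (forall j, inv (q j)) ->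
  (forall j k, X m (Y m (g j k)) = X j (p k) + Y k (q j)) ->
  forall j k, X m (A j k) = 0 /\ Y m (A j k) = 0.
Proof.
move=> pi qi e.
suff Y0 : forall j k, Y m (A j k) = 0 by move=> j k; split=> //; exact: X_eq0.
(* Conjugation exchanges [X] with [Y] and the transpose exchanges rows with columns, so [b] is again
   divergence free in both indices. *)
pose b j k := cj (A k j).
have bi j k : inv (b j k) by exact: Ginv_cj.
have bX k : \sum_j X j (b j k) = 0.
  transitivity (cj (\sum_j Y j (A k j))); last by rewrite divY raddf0.
  by rewrite raddf_sum; apply: eq_bigr => j _; rewrite /= cjY.
have bY j : \sum_k Y k (b j k) = 0.
  transitivity (cj (\sum_k X k (A k j))); last by rewrite divX raddf0.
  by rewrite raddf_sum; apply: eq_bigr => k _; rewrite /= cjX.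
(* Leibniz rule: the second-order terms cancel by [e], and the leftover terms are [p] and [q] times
   divergences of [b]. *)
have E : \sum_j \sum_k flat (fun j k => Y m (A j k)) j k * cj (Y m (A k j)) =
    \sum_j \sum_k (X m (Y m (g j k) * b j k) - X j (p k * b j k) -
      Y k (q j * b j k)).
  transitivity (\sum_j \sum_k (X m (Y m (g j k) * b j k) - X j (p k * b j k) -
      Y k (q j * b j k)) + (\sum_k p k * \sum_j X j (b j k) +
      \sum_j q j * \sum_k Y k (b j k))).
    have S1 : \sum_k p k * \sum_j X j (b j k) = \sum_j \sum_k p k * X j (b j k).
      by rewrite exchange_big; apply: eq_bigr => k _; rewrite mulr_sumr.
    have S2 : \sum_j q j * \sum_k Y k (b j k) = \sum_j \sum_k q j * Y k (b j k).
      by apply: eq_bigr => j _; rewrite mulr_sumr.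
    rewrite S1 S2 -!big_split /=; apply: eq_bigr => j _.
    rewrite -!big_split; apply: eq_bigr => k _ /=.
    rewrite !XM YM -flatY cjY e /b /g; ring.
  rewrite [X in _ + X](_ : _ = 0) ?addr0 //.
  by rewrite !big1 ?addr0 // => k _; rewrite ?bX ?bY mulr0.
have [pos zero] := flat_pos (fun j k => Y m (A j k)).
apply: zero; apply: (null_ge0 hGamma _ _ pos); rewrite E.
  apply: Ginv_sum => j; apply: Ginv_sum => k; apply: GinvB; first apply: GinvB.
  - by apply: Ginv_X; apply: GinvM => //; apply: Ginv_Y; exact: gi.
  - by apply: Ginv_X; exact: GinvM.
  - by apply: Ginv_Y; exact: GinvM.
apply: null_sum => j; apply: null_sum => k; apply: nullB; first apply: nullB.
- by apply: nullX; apply: GinvM => //; apply: Ginv_Y; exact: gi.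
- by apply: nullX; exact: GinvM.
- by apply: nullY; exact: GinvM.
Qed.

(** The central direction comes first because its divergence identity holds unconditionally; those
    of the other two directions presuppose it. *)
Lemma A_deriv3 j k : X i3 (A j k) = 0 /\ Y i3 (A j k) = 0.
Proof.
apply: (frame_deriv_eq0 (p := fun k => Y i3 (g i3 k)) _ _ (curl_direction3 curl0)) => l.
  by apply: Ginv_Y; exact: gi.
apply: vec3_inv; first by apply: curlX_inv => n; exact: gi.
  by apply: GinvN; apply: curlX_inv => n; exact: gi.
exact: (Ginv_cs 0).
Qed.

Lemma X3g j k : X i3 (g j k) = 0.
Proof.
rewrite /g flatX; apply: big1 => l _; apply: big1 => m _.
by have [-> _] := A_deriv3 m l; rewrite mulr0 mul0r.
Qed.

Lemma Y3g j k : Y i3 (g j k) = 0.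
Proof.
rewrite /g flatY; apply: big1 => l _; apply: big1 => m _.
by have [_ ->] := A_deriv3 m l; rewrite mulr0 mul0r.
Qed.

Lemma A_deriv1 j k : X i1 (A j k) = 0 /\ Y i1 (A j k) = 0.
Proof.
apply: (frame_deriv_eq0 _ _ (curl_direction1 curl0 gi X3g Y3g)) => l.
  apply: vec3_inv; first exact: (Ginv_cs 0).
    exact: (GinvB (Ginv_Y _ (gi _ _)) (Ginv_Y _ (gi _ _))).
  exact: (Ginv_Y _ (gi _ _)).
exact: (Ginv_X _ (gi _ _)).
Qed.

Lemma A_deriv2 j k : X i2 (A j k) = 0 /\ Y i2 (A j k) = 0.
Proof.
apply: (frame_deriv_eq0 _ _ (curl_direction2 curl0 gi X3g Y3g)) => l.
  apply: vec3_inv; first exact: (GinvB (Ginv_Y _ (gi _ _)) (Ginv_Y _ (gi _ _))).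
    exact: (Ginv_cs 0).
  exact: (Ginv_Y _ (gi _ _)).
exact: (Ginv_X _ (gi _ _)).
Qed.

Theorem invariant_data_const : (forall j k, A j k = cs (A j k 0)) /\ g i3 i3 = 0.
Proof.
split=> [j k|]; last exact: (g33_eq0 curl0 gi X3g Y3g).
by apply: const_of_frame; apply: I3P;
  [case: (A_deriv1 j k)|case: (A_deriv2 j k)|case: (A_deriv3 j k)|
   case: (A_deriv1 j k)|case: (A_deriv2 j k)|case: (A_deriv3 j k)].
Qed.

End Core.

(** * Forms of type (1,1) and (2,2) in coordinates *)

Section IndexSets.
Implicit Types (S T U : {set idx}) (i : idx) (j k l m : 'I_3).

Definition S11 j k : {set idx} := [set lshift 3 j; rshift 3 k].
(** A monomial of type (2,2) is named by the two indices it misses, so that the coefficients form a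
    3 x 3 matrix. *)
Definition S22 j k : {set idx} := ~: S11 j k.

Lemma idx_cases (P : idx -> Prop) :
  (forall j, P (lshift 3 j)) -> (forall j, P (rshift 3 j)) -> forall i, P i.
Proof.
by move=> pl pr i; rewrite -(splitK i); case: (fintype.split i) => j /=.
Qed.

Lemma setP_idx S T : (forall j, (lshift 3 j \in S) = (lshift 3 j \in T)) ->
  (forall j, (rshift 3 j \in S) = (rshift 3 j \in T)) -> S = T.
Proof. by move=> l r; apply/setP; exact: idx_cases. Qed.

Lemma lshift_S11 l j k : (lshift 3 l \in S11 j k) = (l == j).
Proof. by rewrite !inE eq_lshift eq_lrshift orbF. Qed.
Lemma rshift_S11 l j k : (rshift 3 l \in S11 j k) = (l == k).
Proof. by rewrite !inE eq_rshift eq_rlshift. Qed.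
Lemma lshift_S22 l j k : (lshift 3 l \in S22 j k) = (l != j).
Proof. by rewrite inE lshift_S11. Qed.
Lemma rshift_S22 l j k : (rshift 3 l \in S22 j k) = (l != k).
Proof. by rewrite inE rshift_S11. Qed.
Definition inS := (lshift_S11, rshift_S11, lshift_S22, rshift_S22).

Lemma holdegE S : holdeg S = (\sum_j (lshift 3 j \in S))%N.
Proof. by rewrite /holdeg -sum1dep_card big_mkcond; apply: eq_bigr => j _; case: ifP. Qed.
Lemma antidegE S : antideg S = (\sum_j (rshift 3 j \in S))%N.
Proof. by rewrite /antideg -sum1dep_card big_mkcond; apply: eq_bigr => j _; case: ifP. Qed.

Lemma card_idx S : #|S| = (holdeg S + antideg S)%N.
Proof.
rewrite holdegE antidegE -sum1_card big_mkcond /= big_split_ord.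
by congr (_ + _)%N; apply: eq_bigr => j _; case: ifP.
Qed.

Lemma holdeg_S11 j k : holdeg (S11 j k) = 1%N.
Proof.
rewrite /holdeg (_ : [set l | _] = [set j]) ?cards1 //.
by apply/setP => l; rewrite finset.in_set inS finset.in_set1.
Qed.
Lemma antideg_S11 j k : antideg (S11 j k) = 1%N.
Proof.
rewrite /antideg (_ : [set l | _] = [set k]) ?cards1 //.
by apply/setP => l; rewrite finset.in_set inS finset.in_set1.
Qed.

Lemma holdegC S : (holdeg S + holdeg (~: S) = 3)%N.
Proof.
rewrite !holdegE -big_split /= (eq_bigr (fun=> 1%N)) ?sum1_card ?card_ord // => j _.
by rewrite inE; case: (_ \in _).
Qed.
Lemma antidegC S : (antideg S + antideg (~: S) = 3)%N.
Proof.
rewrite !antidegE -big_split /= (eq_bigr (fun=> 1%N)) ?sum1_card ?card_ord // => j _.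
by rewrite inE; case: (_ \in _).
Qed.

Lemma holdeg_S22 j k : holdeg (S22 j k) = 2%N.
Proof. by have := holdegC (S11 j k); rewrite holdeg_S11 => -[]. Qed.
Lemma antideg_S22 j k : antideg (S22 j k) = 2%N.
Proof. by have := antidegC (S11 j k); rewrite antideg_S11 => -[]. Qed.

Lemma type11P S : holdeg S = 1%N -> antideg S = 1%N -> exists j k, S = S11 j k.
Proof.
move=> /eqP/cards1P[j hj] /eqP/cards1P[k hk]; exists j, k.
apply: setP_idx => l; rewrite inS.
  by have /setP/(_ l) := hj; rewrite !inE.
by have /setP/(_ l) := hk; rewrite !inE.
Qed.

Lemma type22P S : holdeg S = 2%N -> antideg S = 2%N -> exists j k, S = S22 j k.
Proof.
move=> h a; have [||j [k e]] := @type11P (~: S).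
- by have := holdegC S; rewrite h => -[].
- by have := antidegC S; rewrite a => -[].
by exists j, k; rewrite /S22 -e finset.setCK.
Qed.

Lemma S11_inj j k j' k' : S11 j k = S11 j' k' -> (j, k) = (j', k').
Proof.
move=> e; have := lshift_S11 j j' k'; have := rshift_S11 k j' k'.
by rewrite -e !inS !eqxx => /esym/eqP -> /esym/eqP ->.
Qed.

Lemma S22_inj j k j' k' : S22 j k = S22 j' k' -> (j, k) = (j', k').
Proof. by move/finset.setC_inj; exact: S11_inj. Qed.

(** Brings sums over all 64 index sets down to the nine of the relevant type. *)
Lemma big_supp (T : nmodType) (I J : finType) (G : I -> J) (F : J -> T) :
  injective G -> (forall s, (forall p, s <> G p) -> F s = 0) ->
  \sum_s F s = \sum_p F (G p).
Proof.
move=> Gi F0; rewrite (bigID (mem [set G p | p in [set: I]])) /=.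
rewrite [X in _ + X]big1 ?addr0 => [|s /imsetP sG]; last first.
  by apply: F0 => p e; apply: sG; exists p.
rewrite big_imset /=; last by move=> p q _ _; exact: Gi.
by apply: eq_bigl => p; rewrite inE.
Qed.

Lemma big_S11 (T : nmodType) (F : {set idx} -> T) :
  (forall S, F S != 0 -> holdeg S = 1%N /\ antideg S = 1%N) ->
  \sum_S F S = \sum_j \sum_k F (S11 j k).
Proof.
move=> F0; rewrite pair_big /= (big_supp (G := fun p : 'I_3 * 'I_3 => S11 p.1 p.2)) //.
  by move=> [j k] [j' k'] /S11_inj.
move=> S Sn; apply/eqP; apply: contraT => /F0[h a].
by have [j [k e]] := type11P h a; case: (Sn (j, k)).
Qed.

Lemma big_S22 (T : nmodType) (F : {set idx} -> T) :
  (forall S, F S != 0 -> holdeg S = 2%N /\ antideg S = 2%N) ->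
  \sum_S F S = \sum_j \sum_k F (S22 j k).
Proof.
move=> F0; rewrite pair_big /= (big_supp (G := fun p : 'I_3 * 'I_3 => S22 p.1 p.2)) //.
  by move=> [j k] [j' k'] /S22_inj.
move=> S Sn; apply/eqP; apply: contraT => /F0[h a].
by have [j [k e]] := type22P h a; case: (Sn (j, k)).
Qed.

End IndexSets.

(** * Signs of shuffles of monomials *)

Section Signs.
Variable R : realType.
Notation C := R[i].
Implicit Types (S T U : {set idx}) (i : idx) (j k l m n : 'I_3).

(** The inversion count as a sum of booleans over the six indices, whose parity can be computed case
    by case. *)
Definition nsgn S T : nat := \sum_(i : idx) \sum_(t : idx)
  [&& i \in S, t \in T & (t < i)%N].

Lemma sgnE S T : sgn R S T = (-1) ^+ nsgn S T.
Proof.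
rewrite /sgn /nsgn pair_big /=; congr (_ ^+ _).
by rewrite -sum1dep_card big_mkcond; apply: eq_bigr => p _; case: ifP.
Qed.

Lemma big_idx (T : nmodType) (F : idx -> T) : \sum_i F i =
  F (lshift 3 i1) + F (lshift 3 i2) + F (lshift 3 i3) +
  (F (rshift 3 i1) + F (rshift 3 i2) + F (rshift 3 i3)).
Proof. by rewrite big_split_ord /= !big_I3. Qed.

Lemma sgn_odd S T p : odd (nsgn S T) = odd p -> sgn R S T = (-1) ^+ p.
Proof. by move=> e; rewrite sgnE -signr_odd e signr_odd. Qed.

Definition inI := (inS, finset.in_setD1, finset.in_set1, finset.in_set2,
  eq_lshift, eq_rshift, eq_lrshift, eq_rlshift).

Lemma sgn_S22_S11 j k : sgn R (S22 j k) (S11 j k) = (-1) ^+ (j + k).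
Proof.
apply: sgn_odd; rewrite /nsgn; move: j k; apply: I3P; apply: I3P;
  by rewrite !big_idx !inS /=.
Qed.

Lemma sgn_S11_S22 j k : sgn R (S11 j k) (S22 j k) = (-1) ^+ (j + k).
Proof.
apply: sgn_odd; rewrite /nsgn; move: j k; apply: I3P; apply: I3P;
  by rewrite !big_idx !inS /=.
Qed.

Lemma sgn_l_S22 j k : sgn R [set lshift 3 j] (S22 j k) = (-1) ^+ j.
Proof.
apply: sgn_odd; rewrite /nsgn; move: j k; apply: I3P; apply: I3P;
  by rewrite !big_idx !inI /=.
Qed.

Lemma sgn_r_S22 j k : sgn R [set rshift 3 k] (S22 j k) = (-1) ^+ k.
Proof.
apply: sgn_odd; rewrite /nsgn; move: j k; apply: I3P; apply: I3P;
  by rewrite !big_idx !inI /=.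
Qed.

End Signs.

(** * Minors of block matrices *)

Section Minors.
Variable R : realType.
Notation C := R[i].
Implicit Types (S T U : {set idx}) (i : idx) (j k l m n : 'I_3) (M : 'M[C]_(3 + 3)).

(** Replaces the size [#|S|], which does not compute, by a literal dimension, so that block
    decompositions and expansions apply. *)
Lemma minor_enum M S T (s t : seq idx) (d : nat) : enum S = s -> enum T = t ->
  size s = d -> size t = d ->
  minor M S T = \det (\matrix_(k < d, l < d) M (nth ord0 s k) (nth ord0 t l)).
Proof.
move=> es et ss st; rewrite /minor.
have cS : #|S| = d by rewrite cardE es.
have cT : #|T| = d by rewrite cardE et.
rewrite cT {1}cS eqxx es et.
suff D p : p = d -> \det (\matrix_(k < p, l < p) M (nth ord0 s k) (nth ord0 t l)) =
  \det (\matrix_(k < d, l < d) M (nth ord0 s k) (nth ord0 t l)) by exact: (D _ cS).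
by move=> ->.
Qed.

Lemma enum_idx : enum 'I_(3 + 3) =
  [:: lshift 3 i1; lshift 3 i2; lshift 3 i3; rshift 3 i1; rshift 3 i2; rshift 3 i3].
Proof. by apply: (inj_map val_inj); rewrite val_enum_ord. Qed.

Lemma enum_S11 j k : enum (S11 j k) = [:: lshift 3 j; rshift 3 k].
Proof.
rewrite /enum_mem -enumT enum_idx /= !inS.
by move: j k; apply: I3P; apply: I3P.
Qed.

Lemma enum_S22 j k : enum (S22 j k) =
  [:: lshift 3 (lift j ord0); lshift 3 (lift j ord_max);
      rshift 3 (lift k ord0); rshift 3 (lift k ord_max)].
Proof.
rewrite /enum_mem -enumT enum_idx /= !inS.
move: j k; apply: I3P; apply: I3P => /=;
  by congr [:: _; _; _; _]; apply: val_inj.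
Qed.

(* Each term of the Leibniz formula pairs the elements of S satisfying a with
   the elements of T satisfying b. *)
Lemma minor_vanish M S T (a b : pred idx) :
  (forall i t, M i t != 0 -> a i = b t) ->
  #|[set i in S | a i]| <> #|[set t in T | b t]| -> minor M S T = 0.
Proof.
move=> Mab ne; rewrite /minor; case: eqP => // cST; apply: big1 => s _.
have [k Mk|Mn0] := pickP (fun k : 'I_#|S| =>
    M (nth ord0 (enum S) k) (nth ord0 (enum T) (s k)) == 0).
  by rewrite (bigD1 k) //= mxE (eqP Mk) mul0r mulr0.
case: ne; have Mn (k : 'I_#|S|) : a (nth ord0 (enum S) k) = b (nth ord0 (enum T) (s k)).
  by apply: Mab; rewrite Mn0.
have cnt (U : {set idx}) (c : pred idx) (d : nat) : #|U| = d ->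
    #|[set i in U | c i]| = (\sum_(k < d) c (nth ord0 (enum U) k))%N.
  move=> cU; rewrite -sum1dep_card big_mkcondr /= -big_enum /=.
  rewrite (big_nth ord0) -cardE cU big_mkord; apply: eq_bigr => k _.
  by case: (c _).
rewrite (cnt S a #|S| erefl) (cnt T b #|S| (esym cST)).
rewrite [RHS](reindex_inj (@perm_inj _ s)) /=.
by apply: eq_bigr => k _; rewrite Mn.
Qed.

(** The block swap with one sign is the product [U *m L *m U] of unipotent matrices, of determinant
    1; the sign left on [Q] disappears in even size. *)
Lemma det_antiblock (P Q : 'M[C]_2) : \det (block_mx 0 P Q 0) = \det P * \det Q.
Proof.
pose U : 'M[C]_(2 + 2) := block_mx 1%:M 1%:M 0 1%:M.
pose L : 'M[C]_(2 + 2) := block_mx 1%:M 0 (- 1%:M) 1%:M.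
have UL : U *m L = block_mx 0 1%:M (- 1%:M) 1%:M.
  by rewrite mulmx_block !mul1mx !mul0mx ?mulmx1 subrr !add0r.
have ULU : U *m L *m U = block_mx 0 1%:M (- 1%:M) 0.
  by rewrite UL mulmx_block !mul1mx !mul0mx ?mulmx1 ?mulmx0 ?add0r ?addr0 ?addNr.
have -> : block_mx 0 P Q 0 = block_mx P 0 0 (- Q) *m (U *m L *m U).
  rewrite ULU mulmx_block !mul0mx !mulmx0 ?mulmx1 ?mulmxN ?mulNmx ?mulmx1 ?opprK.
  by rewrite ?addr0 ?add0r.
rewrite !det_mulmx det_lblock !det_ublock det_lblock !det1 !mulr1 -scaleN1r detZ.
by rewrite sqrrN expr1n mul1r.
Qed.

(** The shape of an inverse Gram matrix, which pairs holomorphic with antiholomorphic directions. *)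
Lemma minor_anti M (P Q : 'M[C]_3) :
  (forall j k, M (lshift 3 j) (lshift 3 k) = 0) ->
  (forall j k, M (rshift 3 j) (rshift 3 k) = 0) ->
  (forall j k, M (lshift 3 j) (rshift 3 k) = P j k) ->
  (forall j k, M (rshift 3 j) (lshift 3 k) = Q j k) ->
  forall j k j' k', minor M (S22 j k) (S22 j' k') =
    \det (row' j (col' k' P)) * \det (row' k (col' j' Q)).
Proof.
move=> ll rr lr rl j k j' k'.
rewrite (minor_enum (d := 2 + 2) M (enum_S22 j k) (enum_S22 j' k')) //.
rewrite -det_antiblock; congr (\det _); apply/matrixP => p q.
have o2 (a : 'I_2) : a = ord0 \/ a = ord_max.
  by case: a => [[|[|]] ?] //; [left|right]; apply: val_inj.
rewrite -(splitK p) -(splitK q).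
by case: (fintype.split p) => a; case: (fintype.split q) => b;
  rewrite /= ?(block_mxEul, block_mxEur, block_mxEdl, block_mxEdr) !mxE /=;
  case: (o2 a) => ->; case: (o2 b) => -> /=; rewrite ?(ll, lr, rl, rr).
Qed.

(** The shape of the Jacobian of a holomorphic map, here a left translation. *)
Lemma minor_diag M (P Q : 'M[C]_3) :
  (forall j k, M (lshift 3 j) (lshift 3 k) = P j k) ->
  (forall j k, M (rshift 3 j) (rshift 3 k) = Q j k) ->
  (forall j k, M (lshift 3 j) (rshift 3 k) = 0) ->
  (forall j k, M (rshift 3 j) (lshift 3 k) = 0) ->
  forall j k j' k', minor M (S22 j k) (S22 j' k') =
    \det (row' j (col' j' P)) * \det (row' k (col' k' Q)).
Proof.
move=> ll rr lr rl j k j' k'.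
rewrite (minor_enum (d := 2 + 2) M (enum_S22 j k) (enum_S22 j' k')) //.
rewrite -(det_ublock _ 0); congr (\det _); apply/matrixP => p q.
have o2 (a : 'I_2) : a = ord0 \/ a = ord_max.
  by case: a => [[|[|]] ?] //; [left|right]; apply: val_inj.
rewrite -(splitK p) -(splitK q).
by case: (fintype.split p) => a; case: (fintype.split q) => b;
  rewrite /= ?(block_mxEul, block_mxEur, block_mxEdl, block_mxEdr) !mxE /=;
  case: (o2 a) => ->; case: (o2 b) => -> /=; rewrite ?(ll, lr, rl, rr).
Qed.

Lemma minor_diag11 M (P Q : 'M[C]_3) :
  (forall j k, M (lshift 3 j) (lshift 3 k) = P j k) ->
  (forall j k, M (rshift 3 j) (rshift 3 k) = Q j k) ->
  (forall j k, M (lshift 3 j) (rshift 3 k) = 0) ->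
  forall j k j' k', minor M (S11 j k) (S11 j' k') = P j j' * Q k k'.
Proof.
move=> ll rr lr j k j' k'.
rewrite (minor_enum (d := 2) M (enum_S11 j k) (enum_S11 j' k')) //.
rewrite (expand_det_row _ ord0) !big_ord_recl big_ord0 /cofactor !det_mx11 !mxE /=.
by rewrite ll rr lr mul0r !addr0 expr0 mul1r.
Qed.

End Minors.

(** * Divergence and curl in coordinates and in the invariant frame *)

Section FrameChange.
Variable R : realType.
Notation V := (C3 R).
Notation C := R[i].
Notation smf := (smf R).
Notation z1 := (zs R i1).
Implicit Types (f : 'I_3 -> smf) (j k l m n : 'I_3) (x : V).

(** From coordinate components to frame components: [vecfr] for vector fields, [covfr] for 1-forms
    (evaluation on the frame), with suffix b for the conjugate versions. *)
Definition vecfr f j := if j == i3 then f i3 - z1 * f i2 else f j.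
Definition vecfrb f k := if k == i3 then f i3 - cj z1 * f i2 else f k.
Definition covfr f j := if j == i2 then f i2 + z1 * f i3 else f j.
Definition covfrb f k := if k == i2 then f i2 + cj z1 * f i3 else f k.

Definition dl j (u : smf) : smf := dd (lshift 3 j) u.
Definition dr j (u : smf) : smf := dd (rshift 3 j) u.

Lemma dlB j (u v : smf) : dl j (u - v) = dl j u - dl j v. Proof. exact: ddB. Qed.
Lemma drB j (u v : smf) : dr j (u - v) = dr j u - dr j v. Proof. exact: ddB. Qed.
Lemma dlD j (u v : smf) : dl j (u + v) = dl j u + dl j v. Proof. exact: ddD. Qed.
Lemma drD j (u v : smf) : dr j (u + v) = dr j u + dr j v. Proof. exact: ddD. Qed.
Lemma dlM j (u v : smf) : dl j (u * v) = dl j u * v + u * dl j v. Proof. exact: ddM. Qed.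
Lemma drM j (u v : smf) : dr j (u * v) = dr j u * v + u * dr j v. Proof. exact: ddM. Qed.
Lemma dlN j (u : smf) : dl j (- u) = - dl j u. Proof. exact: raddfN. Qed.
Lemma drN j (u : smf) : dr j (- u) = - dr j u. Proof. exact: raddfN. Qed.
Lemma dlz1 j : dl j z1 = (i1 == j)%:R.
Proof. by rewrite /dl dd_zs eq_lshift. Qed.
Lemma drz1 j : dr j z1 = 0. Proof. exact: dd_r_zs. Qed.
Lemma dlz1b j : dl j (cj z1) = 0. Proof. exact: dd_cj_zs. Qed.
Lemma drz1b j : dr j (cj z1) = (i1 == j)%:R.
Proof.
rewrite /dr dd_cj dd_zs /conj_idx split_r eq_lshift.
by case: (i1 == j); rewrite ?rmorph1 ?rmorph0.
Qed.
Lemma X1E u : X i1 u = dl i1 u. Proof. by rewrite /X addr0. Qed.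
Lemma X2E u : X i2 u = dl i2 u + z1 * dl i3 u. Proof. by []. Qed.
Lemma X3E u : X i3 u = dl i3 u. Proof. by rewrite /X addr0. Qed.
Lemma Y1E u : Y i1 u = dr i1 u. Proof. by rewrite /Y addr0. Qed.
Lemma Y2E u : Y i2 u = dr i2 u + cj z1 * dr i3 u. Proof. by []. Qed.
Lemma Y3E u : Y i3 u = dr i3 u. Proof. by rewrite /Y addr0. Qed.
Definition frE := (X1E, X2E, X3E, Y1E, Y2E, Y3E, dlB, drB, dlD, drD, dlN, drN, dlM, drM,
  dlz1, drz1, dlz1b, drz1b).

(** The frame fields are themselves divergence free. *)
Lemma div_vecfr f : \sum_j X j (vecfr f j) = \sum_j dl j (f j).
Proof. by rewrite !big_I3 /vecfr /= !frE /=; ring. Qed.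

Lemma div_vecfrb f : \sum_j Y j (vecfrb f j) = \sum_j dr j (f j).
Proof. by rewrite !big_I3 /vecfrb /= !frE /=; ring. Qed.

Lemma vecfrC (a : 'I_3 -> 'I_3 -> smf) j k :
  vecfr (fun j => vecfrb (a j) k) j = vecfrb (fun k => vecfr (fun j => a j k) j) k.
Proof. by rewrite /vecfr /vecfrb; case: ifP => _; case: ifP => _ //; ring. Qed.

Definition curld f m : smf :=
  if m == i1 then dl i2 (f i3) - dl i3 (f i2)
  else if m == i2 then dl i1 (f i3) - dl i3 (f i1)
  else dl i1 (f i2) - dl i2 (f i1).
Definition curldb f m : smf :=
  if m == i1 then dr i2 (f i3) - dr i3 (f i2)
  else if m == i2 then dr i1 (f i3) - dr i3 (f i1)
  else dr i1 (f i2) - dr i2 (f i1).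

(** [curld] lists the components of the differential on increasing pairs, [curlX] on cyclic pairs;
    hence the sign at [i2]. *)
Definition curlfr f m : smf :=
  if m == i1 then f i1 else if m == i2 then - f i2 else f i3 + z1 * f i2.
Definition curlfrb f m : smf :=
  if m == i1 then f i1 else if m == i2 then - f i2 else f i3 + cj z1 * f i2.

(** In the third component the derivative of the coefficient [z1] of [covfr] is cancelled by the
    structure term of [curlX]. *)
Lemma curl_covfr f m : curlX (covfr f) m = curlfr (curld f) m.
Proof.
by move: m; apply: I3P; rewrite /curlX /covfr /curlfr /curld /= !frE /=; ring.
Qed.

Lemma curl_covfrb f m : curlY (covfrb f) m = curlfrb (curldb f) m.
Proof.
by move: m; apply: I3P; rewrite /curlY /covfrb /curlfrb /curldb /= !frE /=; ring.
Qed.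

Lemma covfr_curlfrb (g : 'I_3 -> 'I_3 -> smf) j n :
  curlY (fun k => covfr (fun j => covfrb (g j) k) j) n =
  covfr (fun j => curlfrb (curldb (g j)) n) j.
Proof.
rewrite /covfr; case: ifP => _; last exact: curl_covfrb.
by rewrite -!curl_covfrb; move: n; apply: I3P;
  rewrite /curlY /= !frE /=; ring.
Qed.

(** The coefficient [cj z1] of the conjugate frame change is a constant for the holomorphic
    derivatives. *)
Lemma curld_curlfrb (h : 'I_3 -> 'I_3 -> smf) m n :
  curld (fun j => curlfrb (h j) n) m = curlfrb (fun k => curld (fun j => h j k) m) n.
Proof.
by move: m n; apply: I3P; apply: I3P;
  rewrite /curld /curlfrb //= ?frE /=; ring.
Qed.

Lemma curl_curl_covfr (g : 'I_3 -> 'I_3 -> smf) m n :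
  curlX (fun j => curlY (fun k => covfr (fun j => covfrb (g j) k) j) n) m =
  curlfr (fun m => curlfrb (fun n => curld (fun j => curldb (g j) n) m) n) m.
Proof.
transitivity (curlX (covfr (fun j => curlfrb (curldb (g j)) n)) m).
  by rewrite /curlX !covfr_curlfrb.
rewrite curl_covfr /curlfr.
by rewrite !(curld_curlfrb (fun j => curldb (g j))).
Qed.

(** The frame change is triangular with diagonal entries 1 or -1 in either index, hence
    invertible. *)
Lemma curlfr_eq0 (h : 'I_3 -> 'I_3 -> smf) :
  (forall m n, curlfr (fun m => curlfrb (h m) n) m = 0) <-> (forall m n, h m n = 0).
Proof.
split=> h0 m n; last first.
  by rewrite /curlfr /curlfrb; do ?case: (_ == _);
    rewrite !h0 ?mulr0 ?oppr0 ?addr0 ?mulr0 ?oppr0 ?addr0.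
have r0 (k : 'I_3) : forall m, curlfrb (h m) k = 0.
  have e1 := h0 i1 k; have e2 := h0 i2 k; have e3 := h0 i3 k.
  rewrite /curlfr /= in e1 e2 e3.
  have f2 : curlfrb (h i2) k = 0 by rewrite -[LHS]opprK e2 oppr0.
  by apply: I3P => //; rewrite -e3 f2 mulr0 addr0.
have e1 := r0 i1 m; have e2 := r0 i2 m; have e3 := r0 i3 m.
rewrite /curlfrb /= in e1 e2 e3.
have f2 : h m i2 = 0 by rewrite -[LHS]opprK e2 oppr0.
by move: n; apply: I3P => //; rewrite -e3 f2 mulr0 addr0.
Qed.

End FrameChange.

(** * Coefficient matrices and left translations *)

Section FrameMatrices.
Variable R : realType.
Notation V := (C3 R).
Notation C := R[i].
Notation smf := (smf R).
Implicit Types (j k l m n : 'I_3) (x g : V) (z w : C) (a b F : cform R).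

(* The rows of ez z1 are the coordinates of the left-invariant frame; tz is the
   contragredient. *)
Definition ez z : 'M[C]_3 := 1%:M + z *: delta_mx i2 i3.
Definition tz z : 'M[C]_3 := (ez (- z))^T.

Lemma ezE z j k : ez z j k = (j == k)%:R + z * ((j == i2) && (k == i3))%:R.
Proof. by rewrite !mxE. Qed.

Lemma ez0 : ez 0 = 1%:M.
Proof. by rewrite /ez scale0r addr0. Qed.

Lemma ezD z w : ez z *m ez w = ez (z + w).
Proof.
rewrite /ez mulmxDl mul1mx -scalemxAl mulmxDr mulmx1 -scalemxAr.
rewrite mul_delta_mx_0 // scaler0 addr0 scalerDl -addrA.
by rewrite [w *: _ + _]addrC.
Qed.

Lemma tzD z w : tz z *m tz w = tz (z + w).
Proof. by rewrite /tz -trmx_mul ezD opprD addrC. Qed.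

Lemma ez_tz z : (ez z)^T *m tz z = 1%:M.
Proof. by rewrite /tz -trmx_mul ezD addNr ez0 trmx1. Qed.

Lemma tz_ez z : tz z *m (ez z)^T = 1%:M.
Proof. by rewrite /tz -trmx_mul ezD subrr ez0 trmx1. Qed.

Lemma det_ez z : \det (ez z) = 1.
Proof.
rewrite -det_tr det_trig.
  by rewrite !big_ord_recl big_ord0 !mxE /= !mulr0 !addr0 !mulr1.
by apply/is_trig_mxP; apply: I3P; apply: I3P => //= _; rewrite !mxE /= mulr0 addr0.
Qed.

Lemma adj_ezT z : \adj (ez z)^T = tz z.
Proof.
rewrite -[LHS]mulmx1 -(ez_tz z) mulmxA mul_adj_mx det_tr det_ez mul1mx.
by [].
Qed.

Lemma cofactor_ezT z j k : cofactor (ez z)^T j k = tz z k j.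
Proof. by rewrite -adj_ezT mxE. Qed.

Lemma tzT_ez z : (tz z)^T *m ez z = 1%:M.
Proof. by rewrite /tz trmxK ezD addNr ez0. Qed.

Lemma ez_tzT z : ez z *m (tz z)^T = 1%:M.
Proof. by rewrite /tz trmxK ezD subrr ez0. Qed.

Lemma ezTE z j k : (ez z)^T j k = ez z k j.
Proof. by rewrite mxE. Qed.

Lemma tzE z j k : tz z j k = (k == j)%:R - z * ((k == i2) && (j == i3))%:R.
Proof. by rewrite mxE ezE mulNr. Qed.

Lemma conj_ez z j k : conjc (ez z j k) = ez (conjc z) j k.
Proof. by rewrite !ezE conjD conjM !rmorph_nat. Qed.

#[global] Opaque ez tz.

Lemma mulmx3E (A B D : 'M[C]_3) j k :
  (A *m B *m D^T) j k = \sum_l \sum_m A j m * B m l * D k l.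
Proof.
rewrite mxE; apply: eq_bigr => l _; rewrite mxE mulr_suml.
by apply: eq_bigr => m _; rewrite mxE.
Qed.

(* The sign identifies (2,2)-forms with sections of the tensor product of the
   holomorphic and antiholomorphic tangent bundles, by contraction with the
   volume. *)
Definition c22 a x : 'M[C]_3 := \matrix_(j, k) ((-1) ^+ (j + k) * a x (S22 j k)).
Definition c11 a x : 'M[C]_3 := \matrix_(j, k) a x (S11 j k).

(** Components in the invariant frame. After contraction with the volume a (2,2)-form transforms
    like a tensor of vectors, hence [tz]; a (1,1)-form is evaluated on the frame, hence [ez]. *)
Definition frame22 a x := tz (zc x i1) *m c22 a x *m (tz (conjc (zc x i1)))^T.
Definition frame11 a x := ez (zc x i1) *m c11 a x *m (ez (conjc (zc x i1)))^T.

Lemma type_neq0 p q a x S : of_type p q a ->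
  ~ (holdeg S = p /\ antideg S = q) -> a x S = 0.
Proof. by move=> ta nS; apply/eqP; apply: contraT => /ta. Qed.

Lemma form22_eq a b : of_type 2 2 a -> of_type 2 2 b ->
  (forall x, c22 a x = c22 b x) -> a = b.
Proof.
move=> ta tb ab; apply/funext => x; apply/funext => S.
have [[h d]|nS] := pselect (holdeg S = 2 /\ antideg S = 2); last first.
  by rewrite (type_neq0 _ ta nS) (type_neq0 _ tb nS).
have [j [k ->]] := type22P h d.
have := ab x => /matrixP/(_ j k); rewrite !mxE; apply: mulfI.
by rewrite signr_eq0.
Qed.

Definition hz g k : smf := cs (zc g k) + zs R k +
  (if k == i3 then cs (zc g i1) * zs R i2 else 0).

Lemma hzE g k : (fun y => zc (heis_mul g y) k) = hz g k.
Proof.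
apply/funext => y.
have e0 : (if k == i3 then cs (zc g i1) * zs R i2 else 0 : smf) y =
  if k == i3 then zc g i1 * zc y i2 else 0 by case: ifP.
rewrite /hz !smfD e0 csE zsE /heis_mul zc_mkpoint {e0}.
by move: k; apply: I3P => /=; rewrite ?addr0 // addrA.
Qed.

Lemma zcoord_l j x : zcoord (lshift 3 j) x = zc x j.
Proof. by rewrite /zcoord split_l. Qed.
Lemma zcoord_r j x : zcoord (rshift 3 j) x = conjc (zc x j).
Proof. by rewrite /zcoord split_r. Qed.

Definition jac g x : 'M[C]_(3 + 3) :=
  \matrix_(i, j) wirtinger j (fun y => zcoord i (heis_mul g y)) x.

Lemma dd_hz g k i : dd i (hz g k) =
  (lshift 3 k == i)%:R + (k == i3)%:R * (cs (zc g i1) * (lshift 3 i2 == i)%:R).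
Proof.
rewrite /hz !raddfD /= dd_cs add0r dd_zs; congr (_ + _).
case: (k == i3); last by rewrite raddf0 mul0r.
by rewrite dd_csM dd_zs mul1r.
Qed.

Lemma jac_l g x k i : jac g x (lshift 3 k) i = dd i (hz g k) x.
Proof.
rewrite mxE -[RHS]/(wirtinger i (hz g k) x) -hzE.
by under eq_fun do rewrite zcoord_l.
Qed.

Lemma jac_r g x k i : jac g x (rshift 3 k) i = dd i (cj (hz g k)) x.
Proof.
rewrite mxE -[RHS]/(wirtinger i (fun y => conjc (hz g k y)) x) -hzE.
by under eq_fun do rewrite zcoord_r.
Qed.

Lemma smf_nat (b : bool) x : (b%:R : smf) x = b%:R.
Proof. by case: b. Qed.

Lemma jac_ll g x k j : jac g x (lshift 3 k) (lshift 3 j) = (ez (zc g i1))^T k j.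
Proof.
rewrite jac_l dd_hz ezTE ezE !eq_lshift !(smfE, csE, smf_nat) eq_sym.
by rewrite [i2 == j]eq_sym; case: (k == i3); case: (j == i2) => /=; ring.
Qed.

Lemma jac_lr g x k j : jac g x (lshift 3 k) (rshift 3 j) = 0.
Proof. by rewrite jac_l dd_hz !eq_lrshift !mulr0 addr0 smf0. Qed.

Lemma jac_rr g x k j : jac g x (rshift 3 k) (rshift 3 j) = (ez (conjc (zc g i1)))^T k j.
Proof.
have := jac_ll g x k j; rewrite jac_r jac_l dd_cj /conj_idx split_r cjE => ->.
by rewrite !ezTE conj_ez.
Qed.

Lemma jac_rl g x k j : jac g x (rshift 3 k) (lshift 3 j) = 0.
Proof.
have := jac_lr g x k j; rewrite jac_r jac_l dd_cj /conj_idx split_l cjE => ->.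
by rewrite conjc0.
Qed.

Lemma pullbackE g a x U : pullback (heis_mul g) a x U =
  \sum_T a (heis_mul g x) T * minor (jac g x) T U.
Proof. by []. Qed.

Lemma idx_lt3 (i : idx) : (i < 3)%N = (if fintype.split i is inl _ then true else false).
Proof.
by rewrite -{1}(splitK i); case: (fintype.split i) => j /=;
  rewrite ?ltn_ord // -[X in (_ < X)%N]addn0 ltn_add2l ltn0.
Qed.

Lemma card_hol (S : {set idx}) : #|[set i in S | (i < 3)%N]| = holdeg S.
Proof.
rewrite holdegE -sum1dep_card big_mkcond /= big_split_ord /=.
rewrite [X in (_ + X)%N]big1 ?addn0 => [|j _]; last first.
  by rewrite -[X in (_ < X)%N]addn0 ltn_add2l ltn0 andbF.
by apply: eq_bigr => j _; rewrite ltn_ord andbT; case: ifP.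
Qed.

(** Left translations are holomorphic, so their pullback preserves bidegrees. *)
Lemma minor_jac_neq0 g x (T U : {set idx}) : minor (jac g x) T U != 0 ->
  holdeg T = holdeg U /\ antideg T = antideg U.
Proof.
move=> m0; have cTU : #|T| = #|U|.
  by apply/eqP; move: m0; rewrite /minor; case: ifP => //; rewrite eqxx.
have hTU : holdeg T = holdeg U.
  apply: contrapT => hn; move/eqP: m0; apply.
  apply: (@minor_vanish _ _ _ _ (fun i => (i < 3)%N) (fun i => (i < 3)%N)).
    move=> i t; rewrite !idx_lt3 -{1}(splitK i) -{1}(splitK t).
    by case: (fintype.split i) => p; case: (fintype.split t) => q //=;
      rewrite ?jac_lr ?jac_rl ?eqxx.
  by rewrite !card_hol.
split=> //; move: cTU; rewrite !card_idx hTU; exact: addnI.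
Qed.

Lemma of_type_pullback p q g a : of_type p q a -> of_type p q (pullback (heis_mul g) a).
Proof.
move=> ta x U; rewrite pullbackE => s0.
apply: contrapT => nU; move/eqP: s0; apply; apply: big1 => T _.
have [->|aT] := eqVneq (a (heis_mul g x) T) 0; first by rewrite mul0r.
have [->|mT] := eqVneq (minor (jac g x) T U) 0; first by rewrite mulr0.
by have [h d] := minor_jac_neq0 mT; case: nU; rewrite -h -d; exact: ta aT.
Qed.

(** The 2 x 2 minors of a matrix of determinant 1 are, up to sign, the entries of its inverse; the
    signs are those built into [c22]. *)
Lemma c22_pullback g a x : of_type 2 2 a -> c22 (pullback (heis_mul g) a) x =
  tz (zc g i1) *m c22 a (heis_mul g x) *m (tz (conjc (zc g i1)))^T.
Proof.
move=> ta; apply/matrixP => j k; rewrite mulmx3E mxE pullbackE big_S22; last first.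
  by move=> S; rewrite mulf_eq0 negb_or => /andP[/ta].
have sq (p : nat) : (-1) ^+ p * (-1) ^+ p = 1 :> C by rewrite -expr2 sqrr_sign.
have cof z p q : \det (row' p (col' q (ez z)^T)) = (-1) ^+ p * (-1) ^+ q * tz z q p.
  by rewrite -cofactor_ezT /cofactor -exprD mulrA sq mul1r.
rewrite exchange_big mulr_sumr /=; apply: eq_bigr => k' _.
rewrite mulr_sumr; apply: eq_bigr => j' _.
rewrite (minor_diag (jac_ll g x) (jac_rr g x) (jac_lr g x) (jac_rl g x)) !cof.
rewrite [c22 _ _ _ _]mxE !exprD.
move: (tz _ _ _) (tz _ _ _) (a _ _) => t' t u.
transitivity (((-1) ^+ j * (-1) ^+ j) * ((-1) ^+ k * (-1) ^+ k) *
  (t * ((-1) ^+ j' * (-1) ^+ k' * u) * t')); first by ring.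
by rewrite !sq !mul1r.
Qed.

Lemma conjcV z : conjc (- z) = - conjc z. Proof. exact: raddfN. Qed.

(** The first coordinate is additive on the group and [tz] turns sums into products, so the Jacobian
    and the frame change at [x] combine into the frame change at the translated point. *)
Lemma frame22_pullback g a x : of_type 2 2 a ->
  frame22 (pullback (heis_mul g) a) x = frame22 a (heis_mul g x).
Proof.
have e : zc (heis_mul g x) i1 = zc x i1 + zc g i1 by rewrite zc_mk1 addrC.
move=> ta; rewrite /frame22 (c22_pullback _ _ ta) e conjD -!tzD trmx_mul.
by rewrite !mulmxA.
Qed.

Lemma c11_pullback g a x : of_type 1 1 a -> c11 (pullback (heis_mul g) a) x =
  ez (zc g i1) *m c11 a (heis_mul g x) *m (ez (conjc (zc g i1)))^T.
Proof.
move=> ta; apply/matrixP => j k; rewrite mulmx3E mxE pullbackE big_S11; last first.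
  by move=> S; rewrite mulf_eq0 negb_or => /andP[/ta].
rewrite exchange_big /=; apply: eq_bigr => k' _.
apply: eq_bigr => j' _.
rewrite (minor_diag11 (jac_ll g x) (jac_rr g x) (jac_lr g x)).
rewrite [c11 _ _ _ _]mxE !ezTE.
move: (ez _ _ _) (ez _ _ _) (a _ _) => t t' u; ring.
Qed.

Lemma frame11_pullback g a x : of_type 1 1 a ->
  frame11 (pullback (heis_mul g) a) x = frame11 a (heis_mul g x).
Proof.
have e : zc (heis_mul g x) i1 = zc x i1 + zc g i1 by rewrite zc_mk1 addrC.
move=> ta; rewrite /frame11 (c11_pullback _ _ ta) e conjD -!ezD trmx_mul.
by rewrite !mulmxA.
Qed.

Lemma frame22_inj a b x : frame22 a x = frame22 b x -> c22 a x = c22 b x.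
Proof.
rewrite /frame22 => e; set z := zc x i1 in e.
have K M : (ez z)^T *m (tz z *m M *m (tz (conjc z))^T) *m ez (conjc z) = M.
  by rewrite !mulmxA ez_tz mul1mx -mulmxA tzT_ez mulmx1.
by rewrite -(K (c22 a x)) e K.
Qed.

Lemma pullback22P g a : of_type 2 2 a ->
  (pullback (heis_mul g) a = a <-> forall x, frame22 a (heis_mul g x) = frame22 a x).
Proof.
move=> ta; split=> [e x|e]; first by rewrite -(frame22_pullback _ _ ta) e.
apply: form22_eq => // [|x]; first exact: of_type_pullback.
by apply: frame22_inj; rewrite frame22_pullback.
Qed.

Lemma left_inv11 a : of_type 1 1 a -> left_invariant a ->
  forall x, frame11 a x = frame11 a 0.
Proof.
by move=> ta ia x; rewrite -[X in frame11 a X]heis_mulx0 -frame11_pullback // ia.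
Qed.

End FrameMatrices.

(** * Bidegrees and the closedness of (2,2)-forms *)

Section TypeCalculus.
Variable R : realType.
Notation V := (C3 R).
Notation C := R[i].
Notation smf := (smf R).
Implicit Types (j k l m n : 'I_3) (x g : V) (a b F : cform R) (S T U : {set idx}).

Lemma holdegD1l U j : lshift 3 j \in U -> holdeg U = (holdeg (U :\ lshift 3 j)).+1.
Proof.
move=> jU; rewrite /holdeg (cardsD1 j) finset.in_set jU add1n; congr _.+1.
by apply: eq_card => k; rewrite !inE eq_lshift.
Qed.
Lemma antidegD1l U j : antideg (U :\ lshift 3 j) = antideg U.
Proof. by apply: eq_card => k; rewrite !inE eq_rlshift. Qed.
Lemma antidegD1r U j : rshift 3 j \in U -> antideg U = (antideg (U :\ rshift 3 j)).+1.
Proof.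
move=> jU; rewrite /antideg (cardsD1 j) finset.in_set jU add1n; congr _.+1.
by apply: eq_card => k; rewrite !inE eq_rshift.
Qed.
Lemma holdegD1r U j : holdeg (U :\ rshift 3 j) = holdeg U.
Proof. by apply: eq_card => k; rewrite !inE eq_lrshift. Qed.

Lemma wirtinger0 i (f : V -> C) x : (forall y, f y = 0) -> wirtinger i f x = 0.
Proof.
move=> f0; have -> : f = cs 0 by apply/funext => y; rewrite f0.
by rewrite -ddE dd_cs.
Qed.

Lemma of_type_del p q a : of_type p q a -> of_type p.+1 q (del a).
Proof.
move=> ta x U; apply: contra_neqP => nU; apply: big1 => j jU.
rewrite (wirtinger0 _ _ (fun y => _)) ?mulr0 // => y.
apply: (type_neq0 _ ta) => -[h d]; apply: nU.
by rewrite (holdegD1l jU) h -d antidegD1l.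
Qed.

Lemma of_type_delbar p q a : of_type p q a -> of_type p q.+1 (delbar a).
Proof.
move=> ta x U; apply: contra_neqP => nU; apply: big1 => j jU.
rewrite (wirtinger0 _ _ (fun y => _)) ?mulr0 // => y.
apply: (type_neq0 _ ta) => -[h d]; apply: nU.
by rewrite (antidegD1r jU) d -h holdegD1r.
Qed.

Lemma holdegDs S U : S \subset U -> holdeg U = (holdeg S + holdeg (U :\: S))%N.
Proof.
move=> /fintype.subsetP SU; rewrite !holdegE -big_split; apply: eq_bigr => j _.
by rewrite finset.in_setD; case: (boolP (_ \in S)) => [/SU ->|].
Qed.
Lemma antidegDs S U : S \subset U -> antideg U = (antideg S + antideg (U :\: S))%N.
Proof.
move=> /fintype.subsetP SU; rewrite !antidegE -big_split; apply: eq_bigr => j _.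
by rewrite finset.in_setD; case: (boolP (_ \in S)) => [/SU ->|].
Qed.

Lemma of_type_wedge p q p' q' a b : of_type p q a -> of_type p' q' b ->
  of_type (p + p') (q + q') (wedge a b).
Proof.
move=> ta tb x U; apply: contra_neqP => nU; apply: big1 => S SU.
have [->|aS] := eqVneq (a x S) 0; first by rewrite mulr0 mul0r.
have [->|bS] := eqVneq (b x (U :\: S)) 0; first by rewrite mulr0.
case: nU; have [<- <-] := ta _ _ aS; have [<- <-] := tb _ _ bS.
by rewrite (holdegDs SU) (antidegDs SU).
Qed.

Lemma type_eq0 p q a : of_type p q a ->
  (forall x U, holdeg U = p -> antideg U = q -> a x U = 0) -> a = 0.
Proof.
move=> ta a0; apply/funext => x; apply/funext => U.
have [[h d]|nU] := pselect (holdeg U = p /\ antideg U = q); first exact: a0.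
exact: type_neq0 ta nU.
Qed.

(** The two summands have different types, so no cancellation between them is possible. *)
Lemma ext_d_eq0 p q a : of_type p q a ->
  ext_d a = 0 <-> del a = 0 /\ delbar a = 0.
Proof.
move=> ta; split=> [e|[e1 e2]]; last by rewrite /ext_d e1 e2 addr0.
have tl := of_type_del ta; have tr := of_type_delbar ta.
have e' x U : del a x U + delbar a x U = 0 by rewrite -[LHS]/(ext_d a x U) e.
split.
  apply: (type_eq0 tl) => x U h d; rewrite -[LHS]addr0 -[X in _ + X](@type_neq0 _ _ _ _ x U tr) //.
  by rewrite h d => -[_]; elim: (q) => // ? IH [].
apply: (type_eq0 tr) => x U h d; rewrite -[LHS]add0r -[X in X + _](@type_neq0 _ _ _ _ x U tl) //.
by rewrite h d => -[+ _]; elim: (p) => // ? IH [].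
Qed.

(** Index sets of types (3,2) and, for [U23], (2,3), again named by the missing index. *)
Definition U32 k : {set idx} := ~: [set rshift 3 k].
Definition U23 j : {set idx} := ~: [set lshift 3 j].

Lemma U32D j k : U32 k :\ lshift 3 j = S22 j k.
Proof.
by apply: setP_idx => l; rewrite !inE ?eq_lshift ?eq_rshift ?eq_lrshift ?eq_rlshift ?orbF ?andbT.
Qed.
Lemma U23D j k : U23 j :\ rshift 3 k = S22 j k.
Proof.
by apply: setP_idx => l; rewrite !inE ?eq_lshift ?eq_rshift ?eq_lrshift ?eq_rlshift ?orbF ?andbT.
Qed.

Lemma type32P U : holdeg U = 3%N -> antideg U = 2%N -> exists k, U = U32 k.
Proof.
move=> h d; have h' : holdeg (~: U) = 0%N by have := holdegC U; rewrite h => -[].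
have d' : antideg (~: U) = 1%N by have := antidegC U; rewrite d => -[].
move/eqP/cards1P: d' => [k ek]; move/eqP: h'; rewrite cards_eq0 => /eqP eh.
exists k; rewrite -[U]finset.setCK; congr (~: _); apply: setP_idx => l.
  by have /setP/(_ l) := eh; rewrite !inE eq_lrshift.
by have /setP/(_ l) := ek; rewrite !inE eq_rshift.
Qed.

Lemma type23P U : holdeg U = 2%N -> antideg U = 3%N -> exists j, U = U23 j.
Proof.
move=> h d; have h' : antideg (~: U) = 0%N by have := antidegC U; rewrite d => -[].
have d' : holdeg (~: U) = 1%N by have := holdegC U; rewrite h => -[].
move/eqP/cards1P: d' => [k ek]; move/eqP: h'; rewrite cards_eq0 => /eqP eh.
exists k; rewrite -[U]finset.setCK; congr (~: _); apply: setP_idx => l.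
  by have /setP/(_ l) := ek; rewrite !inE eq_lshift.
by have /setP/(_ l) := eh; rewrite !inE eq_rlshift.
Qed.

Section Del22.
Variables (a : cform R) (al : 'I_3 -> 'I_3 -> smf).
Hypotheses (ta : of_type 2 2 a)
  (aE : forall j k x, a x (S22 j k) = (cs ((-1) ^+ (j + k)) * al j k) x).

Let aF j k : (fun y => a y (S22 j k)) = (cs ((-1) ^+ (j + k)) * al j k : smf).
Proof. by apply/funext => y; rewrite aE. Qed.

Lemma del22E k x : del a x (U32 k) = (-1) ^+ k * (\sum_j dl j (al j k)) x.
Proof.
rewrite /del smf_sum mulr_sumr big_mkcond; apply: eq_bigr => j _.
rewrite !inE eq_lrshift /= U32D sgn_l_S22 aF -ddE dd_csM smfM csE mulrA exprD mulrA.
by rewrite -expr2 sqrr_sign mul1r.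
Qed.

Lemma delbar22E j x : delbar a x (U23 j) = (-1) ^+ j * (\sum_k dr k (al j k)) x.
Proof.
rewrite /delbar smf_sum mulr_sumr big_mkcond; apply: eq_bigr => k _.
rewrite !inE eq_rlshift /= U23D sgn_r_S22 aF -ddE dd_csM smfM csE mulrA exprD.
by rewrite [_ ^+ j * _]mulrC mulrA -expr2 sqrr_sign mul1r.
Qed.

(** The sign in [aE] cancels that of the exterior derivative, leaving plain divergences of columns
    and rows. *)
Lemma ext_d22 : ext_d a = 0 <->
  (forall k, \sum_j dl j (al j k) = 0) /\ (forall j, \sum_k dr k (al j k) = 0).
Proof.
rewrite (ext_d_eq0 ta); split=> [[e1 e2]|[e1 e2]]; split.
- move=> k; apply: smf_eq => x; have /eqP := del22E k x.
  by rewrite e1 eq_sym mulf_eq0 signr_eq0 => /eqP.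
- move=> j; apply: smf_eq => x; have /eqP := delbar22E j x.
  by rewrite e2 eq_sym mulf_eq0 signr_eq0 => /eqP.
- apply: (type_eq0 (of_type_del ta)) => x U h d.
  by have [k ->] := type32P h d; rewrite del22E e1 mulr0.
- apply: (type_eq0 (of_type_delbar ta)) => x U h d.
  by have [j ->] := type23P h d; rewrite delbar22E e2 mulr0.
Qed.
End Del22.

End TypeCalculus.

(** * Second derivatives of (1,1)-forms, wedge products and the volume *)

Section Coefficients.
Variable R : realType.
Notation V := (C3 R).
Notation C := R[i].
Notation smf := (smf R).
Implicit Types (j k l m n : 'I_3) (x g : V) (a b F : cform R) (S T U : {set idx}).

(** Type (1,2): the single holomorphic index [l] and both antiholomorphic indices other than [n]. *)
Definition U12 l n : {set idx} := lshift 3 l |: ~: (rshift 3 n |: [set lshift 3 k | k : 'I_3]).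

Lemma lshift_U12 j l n : (lshift 3 j \in U12 l n) = (j == l).
Proof.
rewrite !inE eq_lshift eq_lrshift /= finset.mem_imset ?inE ?orbF //.
exact: lshift_inj.
Qed.
Lemma rshift_U12 j l n : (rshift 3 j \in U12 l n) = (j != n).
Proof.
rewrite !inE eq_rlshift eq_rshift /=; case: (j == n) => //=.
by apply/imsetP => -[k _] /eqP; rewrite eq_rlshift.
Qed.

(* The index different from both (distinct) arguments. *)
Definition third m j : 'I_3 := inord (3 - m - j).

Lemma third12 : third i1 i2 = i3. Proof. by apply: val_inj; rewrite /= inordK. Qed.
Lemma third13 : third i1 i3 = i2. Proof. by apply: val_inj; rewrite /= inordK. Qed.
Lemma third21 : third i2 i1 = i3. Proof. by apply: val_inj; rewrite /= inordK. Qed.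
Lemma third23 : third i2 i3 = i1. Proof. by apply: val_inj; rewrite /= inordK. Qed.
Lemma third31 : third i3 i1 = i2. Proof. by apply: val_inj; rewrite /= inordK. Qed.
Lemma third32 : third i3 i2 = i1. Proof. by apply: val_inj; rewrite /= inordK. Qed.
Definition thirdE := (third12, third13, third21, third23, third31, third32).

Lemma thirdP m j l : j != m -> (l != m) && (l != j) = (l == third m j).
Proof.
by move: m j l; apply: I3P; apply: I3P => //= l _; rewrite thirdE;
  move: l; apply: I3P.
Qed.

Lemma S22Dl m n j : j != m -> S22 m n :\ lshift 3 j = U12 (third m j) n.
Proof.
move=> jm; apply: setP_idx => l; rewrite finset.in_setD1.
  by rewrite eq_lshift lshift_S22 lshift_U12 -(thirdP _ jm) andbC.
by rewrite eq_rlshift rshift_S22 rshift_U12.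
Qed.

Lemma U12Dr l n k : k != n -> U12 l n :\ rshift 3 k = S11 l (third n k).
Proof.
move=> kn; apply: setP_idx => j; rewrite finset.in_setD1.
  by rewrite eq_lrshift lshift_S11 lshift_U12.
by rewrite eq_rshift rshift_S11 rshift_U12 -(thirdP _ kn) andbC.
Qed.

Lemma S22D_S11 m n j k : j != m -> k != n ->
  S22 m n :\: S11 j k = S11 (third m j) (third n k).
Proof.
move=> jm kn; apply: setP_idx => l; rewrite finset.in_setD !inS.
  by rewrite -(thirdP _ jm) andbC.
by rewrite -(thirdP _ kn) andbC.
Qed.

Definition cnt (i : idx) T : nat := \sum_t ((t \in T) && (t < i)%N).

Lemma nsgn_cnt S T : nsgn S T = (\sum_(i in S) cnt i T)%N.
Proof.
rewrite /nsgn [RHS]big_mkcond; apply: eq_bigr => i _.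
by case: (i \in S) => //=; apply: big1.
Qed.

Lemma cnt_l j T : cnt (lshift 3 j) T = (\sum_l ((lshift 3 l \in T) && (l < j)))%N.
Proof.
rewrite /cnt big_split_ord /= [X in (_ + X)%N]big1 ?addn0 // => l _.
by rewrite ltnNge (leq_trans (ltnW (ltn_ord j))) ?leq_addr ?andbF.
Qed.

Lemma cnt_r k T : cnt (rshift 3 k) T =
  (holdeg T + \sum_l ((rshift 3 l \in T) && (l < k)))%N.
Proof.
rewrite /cnt big_split_ord holdegE /=; congr (_ + _)%N.
by apply: eq_bigr => l _; rewrite (leq_trans (ltn_ord l)) ?leq_addr ?andbT.
Qed.

Lemma sgn_cnt1 (i : idx) T p : odd (cnt i T) = odd p -> sgn R [set i] T = (-1) ^+ p.
Proof. by move=> e; apply: sgn_odd; rewrite nsgn_cnt big_set1. Qed.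

Lemma sgn_l_U12 j l n : sgn R [set lshift 3 j] (U12 l n) = (-1) ^+ (l < j)%N.
Proof.
apply: sgn_cnt1; rewrite cnt_l big_I3 !lshift_U12.
by move: j l; apply: I3P; apply: I3P.
Qed.

Lemma sgn_r_S11 k l m : sgn R [set rshift 3 k] (S11 l m) = (-1) ^+ (m < k)%N.+1.
Proof.
apply: sgn_cnt1; rewrite cnt_r holdeg_S11 big_I3 !rshift_S11.
by move: k m; apply: I3P; apply: I3P.
Qed.

Lemma sgn_S11_S11 j k l m :
  sgn R (S11 j k) (S11 l m) = (-1) ^+ ((l < j)%N + (m < k)%N).+1.
Proof.
apply: sgn_odd; rewrite nsgn_cnt /S11 big_setU1 ?finset.in_set1 ?eq_lrshift //=.
rewrite big_set1 cnt_l cnt_r -/(S11 l m) holdeg_S11 !big_I3 !inS.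
by move: j k l m; do 4!apply: I3P.
Qed.

Section DelDelbar11.
Variables (b : cform R) (be : 'I_3 -> 'I_3 -> smf).
Hypotheses (tb : of_type 1 1 b) (bE : forall j k x, b x (S11 j k) = be j k x).

Let bF j k : (fun y => b y (S11 j k)) = (be j k : smf).
Proof. by apply/funext => y; rewrite bE. Qed.

Lemma delbar11E l n x : delbar b x (U12 l n) = - curldb (be l) n x.
Proof.
have e k : k != n -> sgn R [set rshift 3 k] (U12 l n :\ rshift 3 k) *
    wirtinger (rshift 3 k) (fun y => b y (U12 l n :\ rshift 3 k)) x =
    - ((-1) ^+ (third n k < k)%N * dr k (be l (third n k)) x).
  by move=> kn; rewrite (U12Dr _ kn) sgn_r_S11 bF -ddE exprS mulN1r mulNr.
rewrite /delbar (eq_bigl (fun k => k != n)); last by move=> k; rewrite rshift_U12.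
rewrite (eq_bigr _ e) sumrN; congr (- _); rewrite big_mkcond big_I3 /curldb.
move: n {e}; apply: I3P; rewrite /= !thirdE /= !(expr0, expr1, mul1r, mulN1r, add0r, addr0) //.
Qed.

Lemma del_delbar11E m n x : del (delbar b) x (S22 m n) =
  - curld (fun j => curldb (be j) n) m x.
Proof.
have bd l : (fun y => delbar b y (U12 l n)) = (- curldb (be l) n : smf).
  by apply/funext => y; rewrite delbar11E.
have e j : j != m -> sgn R [set lshift 3 j] (S22 m n :\ lshift 3 j) *
    wirtinger (lshift 3 j) (fun y => delbar b y (S22 m n :\ lshift 3 j)) x =
    - ((-1) ^+ (third m j < j)%N * dl j (curldb (be (third m j)) n) x).
  move=> jm; rewrite (S22Dl _ jm) sgn_l_U12 bd.
  by rewrite -[X in _ * X]/(dl j (- curldb (be (third m j)) n) x) dlN smfN mulrN.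
rewrite /del (eq_bigl (fun j => j != m)); last by move=> j; rewrite lshift_S22.
rewrite (eq_bigr _ e) sumrN; congr (- _); rewrite big_mkcond big_I3 /curld.
by move: m {e}; apply: I3P; rewrite /= !thirdE /= !(expr0, expr1, mul1r, mulN1r, add0r, addr0).
Qed.

Lemma del_delbar11_eq0 : del (delbar b) = 0 <->
  (forall m n, curld (fun j => curldb (be j) n) m = 0).
Proof.
split=> [e m n|e].
  apply: smf_eq => x; apply/eqP; rewrite -oppr_eq0 -del_delbar11E e.
  by rewrite eqxx.
apply: (type_eq0 (of_type_del (of_type_delbar tb))) => x U h d.
by have [m [n ->]] := type22P h d; rewrite del_delbar11E e smf0 oppr0.
Qed.

End DelDelbar11.

Lemma wedge2211 a b : of_type 2 2 a -> of_type 1 1 b ->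
  wedge a b = 0 <-> forall x, \sum_j \sum_k c22 a x j k * c11 b x j k = 0.
Proof.
move=> ta tb.
have top x : wedge a b x [set: idx]%SET = \sum_j \sum_k c22 a x j k * c11 b x j k.
  rewrite /wedge (eq_bigl xpredT) => [|S]; last by rewrite finset.subsetT.
  rewrite big_S22 => [|S]; last first.
    by rewrite !mulf_eq0 !negb_or => /andP[/andP[_ /ta]].
  apply: eq_bigr => j _; apply: eq_bigr => k _; rewrite !mxE.
  by rewrite finset.setTD /S22 finset.setCK -/(S22 j k) sgn_S22_S11.
split=> [e x|e]; first by rewrite -top e.
apply: (type_eq0 (of_type_wedge ta tb)) => x U h d.
suff -> : U = [set: idx]%SET by rewrite top.
apply: finset.setC_inj; rewrite finset.setCT; apply/eqP; rewrite -cards_eq0 card_idx.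
have ea := antidegC U; have eh := holdegC U; rewrite d in ea; rewrite h in eh.
by rewrite (@addnI 3 _ 0 ea) (@addnI 3 _ 0 eh).
Qed.

Lemma wedge1111 a b m n x : of_type 1 1 a -> of_type 1 1 b ->
  wedge a b x (S22 m n) = \sum_(j | j != m) \sum_(k | k != n)
    sgn R (S11 j k) (S11 (third m j) (third n k)) *
    a x (S11 j k) * b x (S11 (third m j) (third n k)).
Proof.
move=> ta tb; rewrite /wedge big_mkcond big_S11 => [|S]; last first.
  by case: ifP => _; rewrite ?eqxx // !mulf_eq0 !negb_or => /andP[/andP[_ /ta]].
rewrite [RHS]big_mkcond; apply: eq_bigr => j _.
have sub k : (S11 j k \subset S22 m n) = (j != m) && (k != n).
  by rewrite /S11 finset.subUset !finset.sub1set !inS.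
case: (boolP (j != m)) => jm; last by apply: big1 => k _; rewrite sub (negPf jm).
rewrite [RHS]big_mkcond; apply: eq_bigr => k _; rewrite sub jm /=.
by case: ifP => // kn; rewrite S22D_S11.
Qed.

Lemma wedge1122 a b x : of_type 1 1 a -> of_type 2 2 b ->
  wedge a b x [set: idx]%SET =
    \sum_(j < 3) \sum_(k < 3) (-1) ^+ (j + k) * a x (S11 j k) * b x (S22 j k).
Proof.
move=> ta tb.
rewrite /wedge (eq_bigl xpredT) => [|S]; last by rewrite finset.subsetT.
rewrite big_S11 => [|S]; last first.
  by rewrite !mulf_eq0 !negb_or => /andP[/andP[_ /ta]].
apply: eq_bigr => j _; apply: eq_bigr => k _.
by rewrite finset.setTD -/(S22 j k) sgn_S11_S22.
Qed.

Lemma big_I3D n (G : 'I_3 -> C) : \sum_(k | k != n) G k =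
  (if n == i1 then G i2 + G i3 else if n == i2 then G i1 + G i3 else G i1 + G i2).
Proof.
by rewrite big_mkcond big_I3; move: n; apply: I3P => /=; rewrite ?add0r ?addr0.
Qed.

(** The coefficients of F^2 are -2 times the complementary minors. Wedging with F sums the Laplace
    expansions along all three rows, which gives -6 times the determinant. *)
Lemma volumeE F x : of_type 1 1 F -> volume F x [set: idx]%SET = - \det (c11 F x).
Proof.
move=> tF; rewrite /volume -[LHS]/(6%:R^-1 * wedge F (wedge F F) x [set: idx]%SET).
rewrite (wedge1122 _ tF (of_type_wedge tF tF)).
have det2 (M : 'M[C]_2) : \det M = M ord0 ord0 * M ord_max ord_max -
    M ord0 ord_max * M ord_max ord0.
  rewrite (expand_det_row _ ord0) !big_ord_recl big_ord0 /cofactor !det_mx11 !mxE /=.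
  rewrite addr0 expr0 expr1 mul1r mulN1r mulrN.
  by congr (M _ _ * M _ _ - M _ _ * M _ _); apply: val_inj.
have W m n : wedge F F x (S22 m n) = - 2%:R * \det (row' m (col' n (c11 F x))).
  have l1 p : lift i1 p = if p == ord0 then i2 else i3.
    by case: p => [[|[|]] ?] //; apply: val_inj.
  have l2 p : lift i2 p = if p == ord0 then i1 else i3.
    by case: p => [[|[|]] ?] //; apply: val_inj.
  have l3 p : lift i3 p = if p == ord0 then i1 else i2.
    by case: p => [[|[|]] ?] //; apply: val_inj.
  rewrite det2 !mxE (wedge1111 _ _ _ tF tF).
  have e0 : (-1) ^+ (0 + 0).+1 = -1 :> C by rewrite -signr_odd.
  have e1 : (-1) ^+ (0 + 1).+1 = 1 :> C by rewrite -signr_odd.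
  have e2 : (-1) ^+ (1 + 0).+1 = 1 :> C by rewrite -signr_odd.
  have e3 : (-1) ^+ (1 + 1).+1 = -1 :> C by rewrite -signr_odd.
  by move: m n; apply: I3P; apply: I3P;
    rewrite !big_I3D /= ?big_I3D /= !thirdE !sgn_S11_S11 !(l1, l2, l3) /=
      ?(e0, e1, e2, e3); ring.
rewrite (eq_bigr (fun=> - 2%:R * \det (c11 F x))) => [|j _].
  rewrite sumr_const card_ord.
  have n6 : (6%:R : C) != 0 by rewrite pnatr_eq0.
  apply: (mulfI n6); rewrite mulVKf //; ring.
rewrite (expand_det_row _ j) mulr_sumr; apply: eq_bigr => k _.
rewrite W /cofactor [c11 F x j k]mxE; ring.
Qed.

End Coefficients.

(** * The Hodge star of a (2,2)-form *)

Section Star.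
Variable R : realType.
Notation V := (C3 R).
Notation C := R[i].
Notation smf := (smf R).
Implicit Types (j k l m n : 'I_3) (x g : V) (a b F : cform R) (S T U : {set idx}).

(** The Hermitian matrix H with F = i sum H_jk dz_j /\ d\bar z_k. *)
Definition Hm F x : 'M[C]_3 := (- 'i%C) *: c11 F x.

Section Gram.
Variable F : cform R.
Hypothesis tF : of_type 1 1 F.

Lemma comp2_ll x j k : comp2 F x (lshift 3 j) (lshift 3 k) = 0.
Proof.
have F0 : F x [set lshift 3 j; lshift 3 k] = 0.
  apply: (type_neq0 _ tF) => -[_]; rewrite /antideg => /eqP/cards1P[l /setP/(_ l)].
  by rewrite !inE !eq_rlshift eqxx.
by rewrite /comp2 F0 oppr0; case: ifP => // _; case: ifP.
Qed.

Lemma comp2_rr x j k : comp2 F x (rshift 3 j) (rshift 3 k) = 0.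
Proof.
have F0 : F x [set rshift 3 j; rshift 3 k] = 0.
  apply: (type_neq0 _ tF) => -[+ _]; rewrite /holdeg => /eqP/cards1P[l /setP/(_ l)].
  by rewrite !inE !eq_lrshift eqxx.
by rewrite /comp2 F0 oppr0; case: ifP => // _; case: ifP.
Qed.

Lemma lt_lr j k : (lshift 3 j < rshift 3 k)%N.
Proof. by rewrite /= (leq_trans (ltn_ord j)) ?leq_addr. Qed.

Lemma gramE x : gram F x = block_mx 0 (Hm F x) (Hm F x)^T 0.
Proof.
apply/matrixP => p q; rewrite mxE -(splitK p) -(splitK q).
case: (fintype.split p) => j; case: (fintype.split q) => k;
  rewrite [unsplit _]/= [unsplit _]/= ?(block_mxEul, block_mxEur, block_mxEdl, block_mxEdr).
- by rewrite comp2_ll mul0r mxE.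
- by rewrite /comp2 lt_lr /Jeig split_r !mxE mulrC.
- rewrite /comp2 ltnNge (ltnW (lt_lr k j)) /= lt_lr /Jeig split_l.
  by rewrite finset.setUC -/(S11 k j) !mxE mulrC mulrN mulNr.
- by rewrite comp2_rr mul0r mxE.
Qed.

Lemma invmx_gram x : Hm F x \in unitmx ->
  invmx (gram F x) = block_mx 0 (invmx (Hm F x)^T) (invmx (Hm F x)) 0.
Proof.
move=> uH; have uHT : (Hm F x)^T \in unitmx by rewrite unitmx_tr.
have e : gram F x *m block_mx 0 (invmx (Hm F x)^T) (invmx (Hm F x)) 0 = 1%:M.
  rewrite gramE mulmx_block !mul0mx !mulmx0 mulmxV // mulmxV //.
  by rewrite ?addr0 ?add0r -scalar_mx_block.
have [uG _] := mulmx1_unit e.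
by rewrite -[LHS]mulmx1 -e mulmxA mulVmx // mul1mx.
Qed.

Lemma starE a x U : of_type 2 2 a -> star F a x U =
  sgn R (~: U) U * (\sum_j \sum_k minor (invmx (gram F x)) (~: U) (S22 j k) *
   a x (S22 j k)) * volume F x [set: idx]%SET.
Proof.
move=> ta; rewrite /star; congr (_ * _ * _); rewrite /inner (bigD1 (~: U)) //=.
rewrite [X in _ + X]big1 ?addr0 => [|S SU]; last first.
  by apply: big1 => T _; rewrite /monomial (negPf SU) !mul0r.
rewrite big_S22 => [|S]; last by rewrite mulf_eq0 negb_or => /andP[_ /ta].
by apply: eq_bigr => j _; apply: eq_bigr => k _; rewrite /monomial eqxx mul1r.
Qed.

(** The inverse Gram matrix exchanges the two kinds of indices, so its nonzero minors pair type
    (p,q) with type (q,p); here the complement of [U] must be of type (2,2). *)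
Lemma of_type_star a : (forall x, Hm F x \in unitmx) -> of_type 2 2 a ->
  of_type 1 1 (star F a).
Proof.
move=> uH ta x U; apply: contra_neqP => nU; rewrite starE // big1 ?mulr0 ?mul0r // => j _.
apply: big1 => k _; have [->|m0] := eqVneq (minor (invmx (gram F x)) (~: U) (S22 j k)) 0.
  by rewrite mul0r.
case: nU; have cU : #|~: U| = #|S22 j k|.
  by apply/eqP; move: m0; rewrite /minor; case: ifP => //; rewrite eqxx.
have card_anti (S : {set idx}) : #|[set i in S | ~~ (i < 3)%N]| = antideg S.
  rewrite antidegE -sum1dep_card big_mkcond /= big_split_ord /=.
  rewrite big1 ?add0n => [|l _]; last by rewrite ltn_ord andbF.
  apply: eq_bigr => l _.
  by rewrite andbT; case: ifP.
have hU : holdeg (~: U) = antideg (S22 j k).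
  apply: contrapT => hn; move/eqP: m0; apply.
  apply: (@minor_vanish _ _ _ _ (fun i => (i < 3)%N) (fun i => ~~ (i < 3)%N)).
    move=> i t; rewrite invmx_gram // !idx_lt3 -{1}(splitK i) -{1}(splitK t).
    by case: (fintype.split i) => p; case: (fintype.split t) => q //=;
      rewrite ?block_mxEul ?block_mxEdr mxE eqxx.
  by rewrite card_hol card_anti.
rewrite antideg_S22 in hU; move: cU; rewrite !card_idx hU holdeg_S22 antideg_S22.
move=> /addnI aU; have := holdegC U; have := antidegC U; rewrite hU aU.
by rewrite !addn2 => -[->] [->].
Qed.

(** Minors of size 2 of the inverse of a 3 x 3 matrix are its entries divided by its determinant.
    The block exchange in the Gram matrix produces the transpose and one factor [H] on either
    side. *)
Lemma c11_star a x : Hm F x \in unitmx -> of_type 2 2 a ->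
  c11 (star F a) x = (volume F x [set: idx]%SET / (\det (Hm F x)) ^+ 2) *:
    (Hm F x *m (c22 a x)^T *m Hm F x).
Proof.
move=> uH ta; have uHT : (Hm F x)^T \in unitmx by rewrite unitmx_tr.
set H := Hm F x in uH uHT *; set v := volume F x _.
have d0 : \det H != 0 by rewrite -unitfE -unitmxE.
have cof1 j k : cofactor (invmx H) j k = H k j / \det H.
  have e : \adj (invmx H) = (\det H)^-1 *: H.
    rewrite -[LHS]mulmx1 -(mulVmx uH) mulmxA mul_adj_mx mul_scalar_mx.
    by rewrite det_inv.
  have -> : cofactor (invmx H) j k = (\adj (invmx H)) k j by rewrite [RHS]mxE.
  by rewrite e mxE mulrC.
have cof2 j k : cofactor (invmx H^T) j k = H j k / \det H.
  by rewrite -trmx_inv cofactor_tr cof1.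
have sq (p : nat) : (-1) ^+ p * (-1) ^+ p = 1 :> C by rewrite -expr2 sqrr_sign.
have dc (M : 'M[C]_3) p q : \det (row' p (col' q M)) =
    (-1) ^+ p * (-1) ^+ q * cofactor M p q.
  by rewrite /cofactor -exprD mulrA sq mul1r.
have G := invmx_gram uH; rewrite -/H in G.
have ll j k : invmx (gram F x) (lshift 3 j) (lshift 3 k) = 0.
  by rewrite G block_mxEul mxE.
have rr j k : invmx (gram F x) (rshift 3 j) (rshift 3 k) = 0.
  by rewrite G block_mxEdr mxE.
have lr j k : invmx (gram F x) (lshift 3 j) (rshift 3 k) = invmx H^T j k.
  by rewrite G block_mxEur.
have rl j k : invmx (gram F x) (rshift 3 j) (lshift 3 k) = invmx H j k.
  by rewrite G block_mxEdl.
apply/matrixP => j k; rewrite [LHS]mxE starE // -/v.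
rewrite [RHS]mxE -[H in X in _ = _ * X]trmxK mulmx3E !trmxK.
rewrite -[~: S11 j k]/(S22 j k) sgn_S22_S11 mulrAC mulrC.
rewrite mulr_suml mulr_sumr; apply: eq_bigr => l _.
rewrite mulr_suml mulr_sumr; apply: eq_bigr => m _.
rewrite (minor_anti ll rr lr rl) !dc cof1 cof2 [H^T k l]mxE [(c22 a x)^T m l]mxE.
rewrite [c22 a x l m]mxE !exprD expr2 invfM.
move: (H j m) (H l k) (a x _) (\det H)^-1 => p q r d.
transitivity (((-1) ^+ j * (-1) ^+ j) * ((-1) ^+ k * (-1) ^+ k) *
  (v * (d * d) * (p * ((-1) ^+ l * (-1) ^+ m * r) * q))); first by ring.
by rewrite !sq !mul1r.
Qed.

End Gram.

Lemma posdef_unit (H : 'M[C]_3) : (forall u : 'rV[C]_3, u != 0 ->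
    0 < \sum_j \sum_k u 0 j * H j k * conjc (u 0 k)) -> H \in unitmx.
Proof.
move=> Hpos; rewrite unitmxE unitfE; apply/negP => /det0P[u u0 uH].
have := Hpos u u0; rewrite exchange_big /= big1 ?ltxx // => k _.
have := congr1 (fun M : 'rV[C]_3 => M 0 k) uH; rewrite !mxE -mulr_suml => ->.
by rewrite mul0r.
Qed.

Section Hermitian.
Variable F : cform R.
Hypothesis hF : hermitian_structure F.

Let tF : of_type 1 1 F. Proof. by case: hF. Qed.

Lemma conj_idx_l j : conj_idx (lshift 3 j) = rshift 3 j.
Proof. by rewrite /conj_idx split_l. Qed.
Lemma conj_idx_r j : conj_idx (rshift 3 j) = lshift 3 j.
Proof. by rewrite /conj_idx split_r. Qed.

Lemma conj_i : conjc 'i%C = - 'i%C :> C.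
Proof. by apply/eqP; rewrite eq_complex /= oppr0 !eqxx. Qed.

Lemma Hm_hermitian x j k : conjc (Hm F x k j) = Hm F x j k.
Proof.
have [_ _ cF _] := hF; rewrite !mxE conjM conjcV conj_i opprK.
have := congr1 (fun G : cform R => G x (S11 j k)) cF.
rewrite /conj_form holdeg_S11 antideg_S11 expr1 mulN1r => <-.
rewrite imsetU1 finset.imset_set1 conj_idx_l conj_idx_r finset.setUC.
by rewrite mulNr mulrN opprK.
Qed.

Lemma zcoord_row u : \row_i zcoord i u =
  row_mx (\row_j zc u j) (\row_j conjc (zc u j)) :> 'rV[C]_(3 + 3).
Proof.
apply/rowP => i; rewrite mxE -(splitK i); case: (fintype.split i) => j /=.
  by rewrite row_mxEl mxE zcoord_l.
by rewrite row_mxEr mxE zcoord_r.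
Qed.

(** A real tangent vector with complex coordinates [u] has frame components (u, conj u), on which
    the Gram form takes twice the value of the Hermitian form at [u]. *)
Lemma Hm_posdef x (u : 'rV[C]_3) : u != 0 ->
  0 < \sum_j \sum_k u 0 j * Hm F x j k * conjc (u 0 k).
Proof.
move=> u0; have [_ _ _ pF] := hF.
pose w : V := row_mx (\row_j complex.Re (u 0 j)) (\row_j complex.Im (u 0 j)).
have zw j : zc w j = u 0 j.
  by rewrite /zc /w row_mxEl row_mxEr !mxE; case: (u 0 j).
have w0 : w != 0.
  apply: contra_neq u0 => w0; apply/rowP => j.
  by rewrite -zw w0 zc0 mxE.
have := pF x w w0; rewrite /= zcoord_row gramE //.
have -> : \row_j zc w j = u by apply/rowP => j; rewrite mxE zw.
set v := \row_j conjc (zc w j).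
have vE k : v 0 k = conjc (u 0 k) by rewrite mxE zw.
rewrite tr_row_mx mul_row_block !mulmx0 addr0 add0r mul_row_col.
have e : v *m (Hm F x)^T *m u^T = (u *m Hm F x *m v^T)^T.
  by rewrite !trmx_mul trmxK mulmxA.
rewrite mxE e [(_ *m _)^T 0 0]mxE.
rewrite -mulr2n pmulrn_lgt0 // mxE exchange_big /=.
congr (0 < _); apply: eq_bigr => k _.
by rewrite [v^T _ _]mxE vE [(u *m _) _ _]mxE mulr_suml.
Qed.

Lemma Hm_unit x : Hm F x \in unitmx.
Proof. exact: posdef_unit (Hm_posdef x). Qed.

End Hermitian.
End Star.

(** * The space L22 for a left-invariant metric *)

Section FrameForms.
Variable R : realType.
Notation V := (C3 R).
Notation C := R[i].
Notation smf := (smf R).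
Notation z1 := (zs R i1).
Implicit Types (j k l m n : 'I_3) (x : V) (a b F : cform R).

Lemma ez_num (h : 'I_3 -> 'I_3 -> C) (z w : C) j k :
  (if j == i2
   then (if k == i2 then h i2 i2 + w * h i2 i3 else h i2 k) +
     z * (if k == i2 then h i3 i2 + w * h i3 i3 else h i3 k)
   else if k == i2 then h j i2 + w * h j i3 else h j k) =
  \sum_l \sum_m ez z j m * h m l * ez w k l.
Proof.
rewrite !big_I3 !ezE; move: j k; apply: I3P; apply: I3P => /=; ring.
Qed.

Lemma tz_num (h : 'I_3 -> 'I_3 -> C) (z w : C) j k :
  (if j == i3
   then (if k == i3 then h i3 i3 - w * h i3 i2 else h i3 k) -
     z * (if k == i3 then h i2 i3 - w * h i2 i2 else h i2 k)
   else if k == i3 then h j i3 - w * h j i2 else h j k) =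
  \sum_l \sum_m tz z j m * h m l * tz w k l.
Proof.
rewrite !big_I3 !tzE; move: j k; apply: I3P; apply: I3P => /=; ring.
Qed.

Lemma vecfr_ptw (g : 'I_3 -> 'I_3 -> smf) (G : 'M[C]_3) j k x :
  (forall l m, g l m x = G l m) ->
  vecfr (fun j => vecfrb (g j) k) j x =
  (tz (zc x i1) *m G *m (tz (conjc (zc x i1)))^T) j k.
Proof.
move=> gG; rewrite mulmx3E.
under eq_bigr do under eq_bigr do rewrite -gG.
rewrite -(tz_num (fun l m => g l m x)) /vecfr /vecfrb.
by case: (j == i3); case: (k == i3).
Qed.

Lemma covfr_ptw (g : 'I_3 -> 'I_3 -> smf) (G : 'M[C]_3) j k x :
  (forall l m, g l m x = G l m) ->
  covfr (fun j => covfrb (g j) k) j x =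
  (ez (zc x i1) *m G *m (ez (conjc (zc x i1)))^T) j k.
Proof.
move=> gG; rewrite mulmx3E.
under eq_bigr do under eq_bigr do rewrite -gG.
rewrite -(ez_num (fun l m => g l m x)) /covfr /covfrb.
by case: (j == i2); case: (k == i2).
Qed.

(** Inverse of [covfr], used to recover smooth coordinate coefficients from frame components. *)
Definition icov (f : 'I_3 -> smf) j := if j == i2 then f i2 - z1 * f i3 else f j.
Definition icovb (f : 'I_3 -> smf) k := if k == i2 then f i2 - cj z1 * f i3 else f k.

Lemma covfr_icov (g : 'I_3 -> 'I_3 -> smf) j k :
  covfr (fun j => covfrb (fun k => icov (fun j => icovb (g j) k) j) k) j = g j k.
Proof.
rewrite /covfr /covfrb /icov /icovb /=.
by move: j k; apply: I3P; apply: I3P => /=; ring.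
Qed.

Lemma trace_mulT (M N : 'M[C]_3) :
  \sum_j \sum_k M j k * N j k = \tr (M *m N^T).
Proof.
by apply: eq_bigr => j _; rewrite mxE; apply: eq_bigr => k _; rewrite mxE.
Qed.

Lemma tr_mul3 (A B D : 'M[C]_3) : (A *m B *m D^T)^T = D *m B^T *m A^T.
Proof. by rewrite trmx_mul trmxK trmx_mul mulmxA. Qed.

Lemma mulmx_cancel (A B D E : 'M[C]_3) : B *m D = 1%:M -> A *m B *m (D *m E) = A *m E.
Proof. by move=> e; rewrite mulmxA -(mulmxA A) e mulmx1. Qed.

(** [tz] is contragredient to [ez], so the pairing does not depend on the frame. *)
Lemma frame_pairing a b x : \sum_j \sum_k c22 a x j k * c11 b x j k =
  \sum_j \sum_k frame22 a x j k * frame11 b x j k.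
Proof.
rewrite !trace_mulT /frame22 /frame11; set z := zc x i1.
rewrite tr_mul3 -[ez _ *m _ *m _]mulmxA (mulmx_cancel _ _ (tzT_ez _)).
by rewrite !mulmxA [RHS]mxtrace_mulC !mulmxA ez_tz mul1mx.
Qed.

Lemma frame110 a : frame11 a 0 = c11 a 0.
Proof. by rewrite /frame11 zc0 conjc0 ez0 !trmx1 mul1mx mulmx1. Qed.

Lemma frame11_inj (M N : 'M[C]_3) z :
  ez z *m M *m (ez (conjc z))^T = ez z *m N *m (ez (conjc z))^T -> M = N.
Proof.
have K P : (tz z)^T *m (ez z *m P *m (ez (conjc z))^T) *m tz (conjc z) = P.
  by rewrite !mulmxA tzT_ez mul1mx -mulmxA ez_tz mulmx1.
by move=> e; rewrite -(K M) e K.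
Qed.

Section ConstantMetric.
Variables (F : cform R).
Hypotheses (tF : of_type 1 1 F) (cF : forall x, frame11 F x = frame11 F 0)
  (uH : Hm F 0 \in unitmx).
Let H := Hm F 0.

Lemma Hm_frame x : ez (zc x i1) *m Hm F x *m (ez (conjc (zc x i1)))^T = H.
Proof.
rewrite /Hm -scalemxAr -scalemxAl -/(frame11 F x) cF frame110.
by [].
Qed.

Lemma det_Hm x : \det (Hm F x) = \det H.
Proof. by rewrite -(Hm_frame x) !det_mulmx det_tr !det_ez mul1r mulr1. Qed.

Lemma Hm_unitx x : Hm F x \in unitmx.
Proof. by rewrite unitmxE det_Hm -unitmxE. Qed.

(** The factor vol / (det H)^2 of [c11_star], with vol = i det H. *)
Definition star_cst : C := 'i%C / \det H.

Lemma det_neq0 : \det H != 0.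
Proof. by rewrite -unitfE -unitmxE. Qed.

Lemma star_cst_neq0 : star_cst != 0.
Proof.
by rewrite mulf_neq0 ?invr_neq0 ?det_neq0 // eq_complex /= oner_eq0 andbF.
Qed.

Lemma volume_cst x : volume F x [set: idx]%SET = 'i%C * \det H.
Proof.
have ii : 'i%C * 'i%C = -1 :> C by rewrite -expr2 sqr_i.
rewrite volumeE // -(det_Hm x) detZ exprS expr2 mulrNN ii mulrN1 opprK.
by rewrite mulrA ii mulN1r.
Qed.

Lemma frame11_star a x : of_type 2 2 a -> frame11 (star F a) x =
  star_cst *: (H *m (frame22 a x)^T *m H).
Proof.
move=> ta; rewrite /frame11 (c11_star tF (Hm_unitx x) ta) volume_cst det_Hm.
rewrite -scalemxAr -scalemxAl; congr (_ *: _).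
  by rewrite /star_cst expr2 invfM mulrA mulfK ?det_neq0.
rewrite -{1 2}(Hm_frame x) /frame22 tr_mul3; set z := zc x i1.
move: (Hm F x) (c22 a x)^T => M N.
rewrite -(mulmxA (tz _) N) (mulmx_cancel _ _ (ez_tz _)) -(mulmxA (ez z) M (ez _)^T).
by rewrite (mulmxA (ez z *m M) N) (mulmx_cancel _ _ (tzT_ez _)) !mulmxA.
Qed.

Section Data.
Variables (Gamma : set V) (a : cform R) (al : 'I_3 -> 'I_3 -> smf).
Hypotheses (ta : of_type 2 2 a) (alE : forall j k x, c22 a x j k = al j k x).

Definition Afr j k : smf := vecfr (fun j => vecfrb (al j) k) j.

Lemma AfrE j k x : Afr j k x = frame22 a x j k.
Proof. by rewrite /frame22; apply: vecfr_ptw => l m; rewrite alE. Qed.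

Lemma pullbackP : (forall g, Gamma g -> pullback (heis_mul g) a = a) <->
  (forall j k, Ginv Gamma (Afr j k)).
Proof.
split=> [pa j k g Gg x|Ai g Gg].
  by rewrite !AfrE; have /(pullback22P g ta) -> := pa g Gg.
apply/(pullback22P g ta) => x; apply/matrixP => j k.
exact: etrans (esym (AfrE j k _)) (etrans (Ai j k g Gg x) (AfrE j k x)).
Qed.

Lemma a_al j k x : a x (S22 j k) = (cs ((-1) ^+ (j + k)) * al j k) x.
Proof. by rewrite smfM csE -alE mxE mulrA -expr2 sqrr_sign mul1r. Qed.

(** In the index that is not differentiated the frame change only subtracts a multiple of the second
    line from the third, with a coefficient that the derivatives in question annihilate. So the two
    systems are triangularly equivalent. *)
Lemma closedP : ext_d a = 0 <->
  (forall k, \sum_j X j (Afr j k) = 0) /\ (forall j, \sum_k Y k (Afr j k) = 0).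
Proof.
rewrite (ext_d22 ta a_al).
have dX k : \sum_j X j (Afr j k) = if k == i3 then
    \sum_j dl j (al j i3) - cj z1 * \sum_j dl j (al j i2)
    else \sum_j dl j (al j k).
  rewrite div_vecfr /vecfrb; case: (k == i3) => //.
  rewrite mulr_sumr -sumrB; apply: eq_bigr => j _.
  by rewrite dlB dlM dlz1b mul0r add0r.
have dY j : \sum_k Y k (Afr j k) = if j == i3 then
    \sum_k dr k (al i3 k) - z1 * \sum_k dr k (al i2 k)
    else \sum_k dr k (al j k).
  rewrite /Afr (eq_bigr _ (fun k _ => congr1 (Y k) (vecfrC al j k))).
  rewrite div_vecfrb /vecfr; case: (j == i3) => //.
  rewrite mulr_sumr -sumrB; apply: eq_bigr => k _.
  by rewrite drB drM drz1 mul0r add0r.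
split=> -[e1 e2]; split.
- by move=> k; rewrite dX !e1 mulr0 subr0 if_same.
- by move=> j; rewrite dY !e2 mulr0 subr0 if_same.
- have f1 := e1 i1; have f2 := e1 i2; have f3 := e1 i3.
  rewrite dX /= in f1; rewrite dX /= in f2; rewrite dX /= f2 mulr0 subr0 in f3.
  exact: I3P.
- have f1 := e2 i1; have f2 := e2 i2; have f3 := e2 i3.
  rewrite dY /= in f1; rewrite dY /= in f2; rewrite dY /= f2 mulr0 subr0 in f3.
  exact: I3P.
Qed.

Lemma curl_scale (c : C) (g : 'I_3 -> 'I_3 -> smf) m n :
  curlX (fun j => curlY (fun k => cs c * g j k) n) m =
  cs c * curlX (fun j => curlY (fun k => g j k) n) m.
Proof.
have cY p l : curlY (fun k => cs c * p k) l = cs c * curlY p l :> smf.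
  by rewrite /curlY !Y_csM -!mulrBr; case: ifP => _ //; case: ifP.
have cX p l : curlX (fun k => cs c * p k) l = cs c * curlX p l :> smf.
  by rewrite /curlX !X_csM -!mulrBr; case: ifP => _ //; case: ifP.
transitivity (curlX (fun j => cs c * curlY (fun k => g j k) n) m); last exact: cX.
by rewrite /curlX !cY.
Qed.

Lemma flatE j k x : flat H Afr j k x = (H *m (frame22 a x)^T *m H) j k.
Proof.
rewrite -[X in _ *m X]trmxK mulmx3E [RHS]exchange_big /flat smf_sum.
apply: eq_bigr => l _; rewrite smf_sum; apply: eq_bigr => m _.
by rewrite !smfM !csE AfrE [H^T k m]mxE [(frame22 a x)^T l m]mxE.
Qed.

Lemma starP : del (delbar (star F a)) = 0 <->
  forall m n, curlX (fun j => curlY (fun k => flat H Afr j k) n) m = 0.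
Proof.
(* The coordinate coefficients of the starred form, reconstructed from its known frame components so
   that they are visibly smooth. *)
pose be j k := icov (fun j => icovb (fun k => cs star_cst * flat H Afr j k) k) j.
have be0 j k : covfr (fun j => covfrb (be j) k) j = cs star_cst * flat H Afr j k.
  exact: (covfr_icov (fun j k => cs star_cst * flat H Afr j k) j k).
have beE j k x : star F a x (S11 j k) = be j k x.
  suff e : c11 (star F a) x = \matrix_(j, k) be j k x.
    by have /matrixP/(_ j k) := e; rewrite [LHS]mxE [RHS]mxE.
  apply: (@frame11_inj _ _ (zc x i1)); rewrite -/(frame11 (star F a) x).
  rewrite (frame11_star _ ta); apply/matrixP => p q; rewrite mxE -flatE.
  rewrite -(@covfr_ptw be _ p q x) => [|l m]; last by rewrite mxE.
  by rewrite be0 smfM csE.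
rewrite (del_delbar11_eq0 (of_type_star tF Hm_unitx ta) beE) -curlfr_eq0.
have cE m n : curlfr (fun m => curlfrb (fun n => curld (fun j => curldb (be j) n) m) n) m =
  cs star_cst * curlX (fun j => curlY (fun k => flat H Afr j k) n) m.
  rewrite -curl_curl_covfr -curl_scale.
  by congr (curlX _ m); apply/funext => j; congr (curlY _ n); apply/funext => k; rewrite be0.
split=> e m n; last by rewrite cE e mulr0.
have := e m n; rewrite cE => /(congr1 (fun u => cs star_cst^-1 * u)).
by rewrite mulr0 mulrA -rmorphM mulVf ?star_cst_neq0 // rmorph1 mul1r.
Qed.

Lemma frame11_const x : frame11 F x = 'i%C *: H.
Proof.
rewrite cF frame110 /H /Hm scalerA mulrN -expr2 sqr_i opprK scale1r.
by [].
Qed.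

Lemma wedgeP : wedge a F = 0 <->
  forall x, \sum_j \sum_k frame22 a x j k * H j k = 0.
Proof.
have e x : \sum_j \sum_k c22 a x j k * c11 F x j k =
    'i%C * \sum_j \sum_k frame22 a x j k * H j k.
  rewrite frame_pairing frame11_const mulr_sumr; apply: eq_bigr => j _.
  by rewrite mulr_sumr; apply: eq_bigr => k _; rewrite [('i%C *: H) j k]mxE mulrCA.
rewrite (wedge2211 ta tF); split=> h x; last by rewrite e h mulr0.
have i0 : 'i%C != 0 :> C by rewrite eq_complex /= oner_eq0 andbF.
by apply: (mulfI i0); rewrite -e h mulr0.
Qed.

End Data.
End ConstantMetric.
End FrameForms.

(** * Forms with constant frame components *)

Section InvariantForms.
Variable R : realType.
Notation V := (C3 R).
Notation C := R[i].
Notation smf := (smf R).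
Notation z1 := (zs R i1).
Implicit Types (j k l m n : 'I_3) (x : V) (a b F : cform R) (A B : 'M[C]_3).

Definition form_of A : cform R := fun x S =>
  \sum_j \sum_k (S == S22 j k)%:R * ((-1) ^+ (j + k) *
    ((ez (zc x i1))^T *m A *m ez (conjc (zc x i1))) j k).

Lemma form_of_S22 A x j k : form_of A x (S22 j k) = (-1) ^+ (j + k) *
    ((ez (zc x i1))^T *m A *m ez (conjc (zc x i1))) j k.
Proof.
rewrite /form_of (bigD1 j) //= (bigD1 k) //= eqxx mul1r.
rewrite [X in _ + X + _]big1 => [|k' k'k]; last first.
  by case: eqP => [/S22_inj[e]|]; [rewrite e eqxx in k'k|rewrite mul0r].
rewrite [X in _ + X]big1 ?addr0 // => j' j'j; apply: big1 => k' _.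
by case: eqP => [/S22_inj[e]|]; [rewrite e eqxx in j'j|rewrite mul0r].
Qed.

Lemma of_type_form_of A : of_type 2 2 (form_of A).
Proof.
move=> x S; apply: contra_neqP => nS; apply: big1 => j _; apply: big1 => k _.
case: eqP => [e|]; last by rewrite mul0r.
by case: nS; rewrite e holdeg_S22 antideg_S22.
Qed.

Lemma c22_form_of A x :
  c22 (form_of A) x = (ez (zc x i1))^T *m A *m ez (conjc (zc x i1)).
Proof.
apply/matrixP => j k; rewrite [LHS]mxE form_of_S22 mulrA -expr2 sqrr_sign mul1r.
by [].
Qed.

Lemma frame22_form_of A x : frame22 (form_of A) x = A.
Proof.
rewrite /frame22 c22_form_of; set z := zc x i1.
rewrite !mulmxA tz_ez mul1mx -mulmxA.
by rewrite ez_tzT mulmx1.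
Qed.

Lemma form_of_frame a : of_type 2 2 a -> (forall x, frame22 a x = frame22 a 0) ->
  a = form_of (frame22 a 0).
Proof.
move=> ta ca; apply: form22_eq => // [|x]; first exact: of_type_form_of.
by apply: frame22_inj; rewrite frame22_form_of.
Qed.

Lemma form_of_inj : injective form_of.
Proof. by move=> A B e; rewrite -(frame22_form_of A 0) e frame22_form_of. Qed.

Lemma form_of_linear c A B : form_of (c *: A + B) = c *: form_of A + form_of B.
Proof.
apply/funext => x; apply/funext => S.
rewrite -[RHS]/(c * form_of A x S + form_of B x S) /form_of mulr_sumr -big_split.
apply: eq_bigr => j _; rewrite mulr_sumr -big_split; apply: eq_bigr => k _ /=.
move: (ez (zc x i1))^T (ez (conjc (zc x i1))) => P Q; rewrite mulmxDr mulmxDl -scalemxAr -scalemxAl.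
move: (_ *m A *m _) (_ *m B *m _) => M N; rewrite [(_ + _ : 'M_3) j k]mxE.
rewrite [(c *: M) j k]mxE; ring.
Qed.

HB.instance Definition _ := GRing.isLinear.Build C 'M[C]_3 (cform R) _ form_of
  form_of_linear.

Definition ezs j k : smf := (j == k)%:R + z1 * ((j == i2) && (k == i3))%:R.

Lemma ezsE j k x : ezs j k x = ez (zc x i1) j k.
Proof. by rewrite smfD smfM !smf_nat ezE. Qed.

Lemma cj_ezsE j k x : cj (ezs j k) x = ez (conjc (zc x i1)) j k.
Proof. by rewrite /ezs rmorphD rmorphM !rmorph_nat smfD smfM !smf_nat ezE cjE. Qed.

Lemma smooth_form_of A S : smooth (fun x => form_of A x S).
Proof.
pose f : smf := \sum_j \sum_k (S == S22 j k)%:R * ((-1) ^+ (j + k) *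
  \sum_l \sum_m (ezs m j * cs (A m l) * cj (ezs l k))).
have -> : (fun x => form_of A x S) = f; last exact: smf_smooth.
apply/funext => x; rewrite /f smf_sum; apply: eq_bigr => j _.
rewrite smf_sum; apply: eq_bigr => k _; rewrite !smfM smf_nat; congr (_ * _).
have -> : ((-1) ^+ (j + k) : smf) x = (-1) ^+ (j + k).
  rewrite -signr_odd -[in RHS]signr_odd; case: (odd _) => //=.
congr (_ * _); rewrite -[ez (conjc _)]trmxK mulmx3E smf_sum; apply: eq_bigr => l _.
rewrite smf_sum; apply: eq_bigr => m _; rewrite !smfM csE ezsE cj_ezsE.
by rewrite !ezTE.
Qed.

Section ConstantMetric.
Variables (Gamma : set V) (F : cform R).
Hypotheses (lG : lattice Gamma) (tF : of_type 1 1 F)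
  (cF : forall x, frame11 F x = frame11 F 0).
Let H := Hm F 0.
Hypotheses (Hh : forall j k, conjc (H k j) = H j k)
  (Hpos : forall u : 'rV[C]_3, u != 0 ->
     0 < \sum_j \sum_k u 0 j * H j k * conjc (u 0 k))
  (uH : H \in unitmx).

(** The direct implication is the rigidity statement [invariant_data_const]; the converse rests on
    the frame fields killing constants. *)
Lemma L22P a : L22 Gamma F a <-> exists A, [/\ a = form_of A,
  \sum_j \sum_k A j k * H j k = 0 & (H *m A^T *m H) i3 i3 = 0].
Proof.
split=> [[[sa ta pa] da sta wa]|[A [-> AH A33]]].
  pose al j k : smf := cs ((-1) ^+ (j + k)) * mk_smf (sa (S22 j k)).
  have alE j k x : c22 a x j k = al j k x by rewrite mxE.
  have /(pullbackP Gamma ta alE) Ai := pa.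
  have [divX divY] := (closedP ta alE).1 da.
  have curl0 := (starP tF cF uH ta alE).1 sta.
  have [Ac A33] := invariant_data_const lG Hh Hpos Ai divX divY curl0.
  exists (frame22 a 0); split.
  - apply: (form_of_frame ta) => x; apply/matrixP => j k.
    have e : Afr al j k x = Afr al j k 0 := congr1 (fun f : smf => f x) (Ac j k).
    exact: etrans (etrans (esym (AfrE alE j k x)) e) (AfrE alE j k 0).
  - exact: (wedgeP tF cF ta).1 wa 0.
  - by rewrite -(flatE F alE) A33.
have ta : of_type 2 2 (form_of A) by exact: of_type_form_of.
pose al j k : smf := cs ((-1) ^+ (j + k)) * mk_smf (smooth_form_of A (S22 j k)).
have alE j k x : c22 (form_of A) x j k = al j k x by rewrite mxE.
have Ac j k : Afr al j k = cs (A j k).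
  by apply: smf_eq => x; rewrite (AfrE alE) frame22_form_of.
split.
- split; [exact: smooth_form_of|exact: ta|].
  by apply/(pullbackP Gamma ta alE) => j k; rewrite Ac; exact: Ginv_cs.
- apply/(closedP ta alE); split=> j; apply: big1 => k _; rewrite Ac.
    exact: X_cs.
  exact: Y_cs.
- apply/(starP tF cF uH ta alE).
  have fc j k : flat H (Afr al) j k = cs ((H *m A^T *m H) j k).
    by apply: smf_eq => x; rewrite (flatE F alE) frame22_form_of.
  (* Only the structure term of each curl survives on constants: the first leaves -G_j3 in component
     3, the second then picks out G_33. *)
  have cY n j : curlY (fun k => flat H (Afr al) j k) n =
      cs (- ((H *m A^T *m H) j i3 * (n == i3)%:R)).
    rewrite /curlY !fc !Y_cs; move: (_ j i3) => h; move: n.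
    by apply: I3P; rewrite /= ?subrr ?sub0r ?mulr0 ?oppr0 ?rmorph0 // mulr1 rmorphN.
  move=> m n; rewrite /curlX !cY !X_cs !subrr sub0r A33 mul0r oppr0 rmorph0 oppr0.
  by case: (m == i1); case: (m == i2).
- by apply/(wedgeP tF cF ta) => x; rewrite frame22_form_of.
Qed.

End ConstantMetric.
End InvariantForms.

(** * The two linear equations on constant matrices *)

Section PrimitiveMatrices.
Variable K : fieldType.
Implicit Types (A B : 'M[K]_3).

Lemma mxvec_dot A B : mxvec A *m (mxvec B)^T = (\sum_j \sum_k A j k * B j k)%:M.
Proof.
apply/rowP => i; rewrite ord1 !mxE eqxx mulr1n pair_big.
rewrite (reindex _ (curry_mxvec_bij _ _)); apply: eq_bigr => -[j k] _ /=.
by rewrite mxE !mxvecE.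
Qed.

(** The coefficient matrices of the equations are [H], of rank 3, and [P], the product of the third
    column and third row of [H], of rank 1. They are independent, so the solutions have dimension 9
    - 2. *)
Lemma two_equations (H : 'M[K]_3) : H \in unitmx -> H i3 i3 != 0 ->
  exists b : 'I_7 -> 'M[K]_3,
  (forall c, \sum_i c i *: b i = 0 -> forall i, c i = 0) /\
  (forall A, \sum_j \sum_k A j k * H j k = 0 /\ (H *m A^T *m H) i3 i3 = 0 <->
     exists c, A = \sum_i c i *: b i).
Proof.
move=> uH H33.
have [P PE rP] : exists2 P : 'M[K]_3,
    (forall j k, P j k = H j i3 * H i3 k) & (\rank P <= 1)%N.
  exists (col i3 H *m row i3 H); first by move=> j k; rewrite mxE big_ord1 !mxE.
  by apply: leq_trans (mxrankM_maxl _ _) _; exact: rank_leq_col.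
have quadE A : (H *m A^T *m H) i3 i3 = \sum_j \sum_k A j k * P j k.
  rewrite mxE; apply: eq_bigr => l _; rewrite mxE mulr_suml.
  by apply: eq_bigr => m _; rewrite [A^T _ _]mxE PE; ring.
pose M : 'M[K]_(1 + 1, 3 * 3) := col_mx (mxvec H) (mxvec P).
have fM : row_free M.
  apply: inj_row_free => v; rewrite -[v]hsubmxK mul_row_col.
  set c := lsubmx v; set d := rsubmx v; rewrite (mx11_scalar c) (mx11_scalar d).
  rewrite !mul_scalar_mx -!linearZ -linearD => /eqP.
  rewrite mxvec_eq0 => /eqP e.
  (* Otherwise [H] would be a multiple of [P], hence of rank at most 1. *)
  have c0 : c 0 0 = 0.
    apply: contraTeq (leqnn 3) => cn0; rewrite -ltnNge.
    have eH : H = (- (d 0 0 / c 0 0)) *: P.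
      apply: (scalerI cn0); rewrite scalerA mulrN mulrCA divff // mulr1 scaleNr.
      by apply/eqP; rewrite -addr_eq0 e.
    rewrite -{1}(mxrank_unit uH) eH; apply: leq_ltn_trans (mxrank_scale _ _) _.
    exact: leq_ltn_trans rP _.
  have d0 : d 0 0 = 0.
    have := congr1 (fun N : 'M_3 => N i3 i3) e; rewrite /= c0 scale0r add0r !mxE.
    by rewrite -/(P i3 i3) PE => /eqP; rewrite !mulf_eq0 !(negPf H33) !orbF => /eqP.
  by rewrite c0 d0 !raddf0 row_mx0.
have rk : \rank (kermx M^T) = 7%N by rewrite mxrank_ker mxrank_tr (eqP fM).
(* The rank equals 7 only propositionally, so the basis of the kernel needs a cast to be indexed by
   ['I_7]. *)
pose B : 'M[K]_(7, 3 * 3) := castmx (rk, erefl) (row_base (kermx M^T)).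
have fB : row_free B by rewrite /B row_free_castmx row_base_free.
have BE : (B :=: kermx M^T)%MS by apply: eqmx_trans (eq_row_base _); exact: eqmx_cast.
have sumE (c : 'I_7 -> K) : \sum_i c i *: vec_mx (row i B) = vec_mx ((\row_i c i) *m B).
  rewrite mulmx_sum_row linear_sum; apply: eq_bigr => i _.
  by rewrite linearZ mxE.
exists (fun i => vec_mx (row i B)); split=> [c|A].
  rewrite sumE => /eqP; rewrite vec_mx_eq0 => /eqP.
  rewrite -(mul0mx _ B) => /(row_free_inj fB) e i.
  by have /rowP/(_ i) := e; rewrite !mxE.
have kerP : (mxvec A <= B)%MS <->
    \sum_j \sum_k A j k * H j k = 0 /\ (H *m A^T *m H) i3 i3 = 0.
  rewrite BE; split=> [/sub_kermxP|[e1 e2]].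
    rewrite tr_col_mx mul_mx_row !mxvec_dot -row_mx0 => /eq_row_mx[].
    rewrite -quadE => /(congr1 (fun N : 'M_1 => N 0 0)) + /(congr1 (fun N : 'M_1 => N 0 0)).
    by rewrite !mxE !eqxx !mulr1n.
  apply/sub_kermxP; rewrite tr_col_mx mul_mx_row !mxvec_dot -quadE e1 e2.
  by rewrite raddf0 row_mx0.
rewrite -kerP; split=> [/submxP[D e]|[c ->]].
  exists (fun i => D 0 i); rewrite sumE -[A]mxvecK e.
  by congr (vec_mx (_ *m _)); apply/rowP => i; rewrite mxE.
by rewrite sumE vec_mxK submxMl.
Qed.

End PrimitiveMatrices.

Section Dimension.
Variable R : realType.
Notation C := R[i].

Lemma form_of_sum n (c : 'I_n -> C) (b : 'I_n -> 'M[C]_3) :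
  form_of (\sum_i c i *: b i) = \sum_i c i *: form_of (b i).
Proof.
rewrite (raddf_sum (@form_of R)); apply: eq_bigr => i _.
transitivity (form_of (c i *: b i + 0)); first by rewrite addr0.
by rewrite form_of_linear (raddf0 (@form_of R)) addr0.
Qed.

Lemma has_dim_L22 (Gamma : set (C3 R)) (F : cform R) : lattice Gamma ->
  hermitian_structure F -> left_invariant F -> has_dim (L22 Gamma F) 7.
Proof.
move=> lG hF iF; have [_ tF _ _] := hF.
have Hh := Hm_hermitian hF 0; have Hpos := Hm_posdef hF 0; have uH := Hm_unit hF 0.
have H33 : Hm F 0 i3 i3 != 0.
  have := Hpos (delta_mx 0 i3); rewrite (bigD1 i3) //= [X in _ + X]big1 ?addr0 => [|j j3].
    rewrite (bigD1 i3) //= [X in _ + X]big1 ?addr0 => [|k k3].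
      rewrite !mxE !eqxx conjc1 mul1r mulr1 => h.
      apply: contraTneq isT => h0; move: h; rewrite h0 ltxx; apply.
      by apply/eqP => /rowP/(_ i3); rewrite !mxE eqxx => /eqP; rewrite oner_eq0.
    by rewrite !mxE (negPf k3) andbF conjc0 mulr0.
  by apply: big1 => k _; rewrite !mxE (negPf j3) andbF !mul0r.
have LP := L22P lG tF (left_inv11 tF iF) Hh Hpos uH.
have [b [fb sb]] := two_equations uH H33.
exists (fun i => form_of (b i)); split=> [c|].
  rewrite -form_of_sum -(raddf0 (@form_of R)) => /form_of_inj; exact: fb.
apply/seteqP; split=> a.
  move=> /LP[A [-> e1 e2]]; have [c ->] := (sb A).1 (conj e1 e2).
  by exists c; rewrite form_of_sum.
move=> [c ->]; apply/LP; exists (\sum_i c i *: b i).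
have [e1 e2] := (sb (\sum_i c i *: b i)).2 (ex_intro _ c erefl).
by rewrite form_of_sum.
Qed.

End Dimension.

(** * The diagonal metrics *)

Section CoframeProducts.
Variable R : realType.
Notation V := (C3 R).
Notation C := R[i].
Implicit Types (j k l m n p q r : 'I_3) (x : V) (a b : cform R) (S T U : {set idx}) (z : C).

Lemma sgn_set1 (s t : idx) : sgn R [set s] [set t] = (-1) ^+ (t < s)%N.
Proof.
apply: sgn_cnt1; congr odd; rewrite /cnt (bigD1 t) //= finset.in_set1 eqxx.
by rewrite big1 ?addn0 // => u ut; rewrite finset.in_set1 (negPf ut).
Qed.

Lemma sgn_sorted S T : (forall i t, i \in S -> t \in T -> (i <= t)%N) -> sgn R S T = 1.
Proof.
move=> ST; rewrite sgnE /nsgn big1 // => i _; apply: big1 => t _.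
case: (boolP (i \in S)) => // iS; case: (boolP (t \in T)) => // tT.
by rewrite ltnNge ST.
Qed.

Definition Hol U : {set idx} := [set i in U | (i < 3)%N].

Lemma lshift_Hol U j : (lshift 3 j \in Hol U) = (lshift 3 j \in U).
Proof. by rewrite inE /= ltn_ord andbT. Qed.
Lemma rshift_Hol U j : (rshift 3 j \in Hol U) = false.
Proof. by rewrite inE idx_lt3 split_r andbF. Qed.

Lemma Hol_S11 m n : Hol (S11 m n) = [set lshift 3 m].
Proof.
by apply: setP_idx => l; rewrite ?lshift_Hol ?rshift_Hol ?inI ?inS ?inI.
Qed.

Lemma S11DHol m n : S11 m n :\: Hol (S11 m n) = [set rshift 3 n].
Proof.
by apply: setP_idx => l; rewrite finset.in_setD ?lshift_Hol ?rshift_Hol ?inI ?inS ?inI ?andNb.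
Qed.

Lemma Hol_S22 m n : Hol (S22 m n) = lshift 3 @: [set~ m].
Proof.
apply: setP_idx => l; rewrite ?lshift_Hol ?rshift_Hol ?inS.
  by rewrite finset.mem_imset ?inE //; exact: lshift_inj.
by apply/esym/imsetP => -[k _] /eqP; rewrite eq_rlshift.
Qed.

Lemma S22DHol m n : S22 m n :\: Hol (S22 m n) = @rshift 3 3 @: [set~ n].
Proof.
apply: setP_idx => l; rewrite finset.in_setD ?lshift_Hol ?rshift_Hol ?inS ?andNb.
  by apply/esym/imsetP => -[k _] /eqP; rewrite eq_lrshift.
by rewrite finset.mem_imset ?inE //; exact: rshift_inj.
Qed.

(** Only the splitting of [U] into its holomorphic and antiholomorphic parts contributes, without
    sign because the dz_j come first in the order of monomials. *)
Lemma wedge_hol_anti (p q : nat) a b x U : of_type p 0 a -> of_type 0 q b ->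
  wedge a b x U = a x (Hol U) * b x (U :\: Hol U).
Proof.
move=> ta tb.
have HU : Hol U \subset U by apply/fintype.subsetP => i; rewrite inE => /andP[].
rewrite /wedge (bigD1 (Hol U)) //= [X in _ + X]big1 ?addr0 => [|S /andP[SU SH]].
  rewrite sgn_sorted ?mul1r // => i t; rewrite inE => /andP[_ i3].
  rewrite finset.in_setD inE => /andP[+ tU]; rewrite tU /= -leqNgt => t3.
  exact: leq_trans (ltnW i3) t3.
have [->|aS] := eqVneq (a x S) 0; first by rewrite mulr0 mul0r.
have [->|bS] := eqVneq (b x (U :\: S)) 0; first by rewrite mulr0.
case/eqP: SH; have [_ aS0] := ta _ _ aS; have [bS0 _] := tb _ _ bS.
apply: setP_idx => j; rewrite ?lshift_Hol ?rshift_Hol.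
  apply/idP/idP => [|jU]; first exact: (fintype.subsetP SU).
  apply: contraT => jS; have := card0_eq bS0 => /(_ j).
  by rewrite inE finset.in_setD jS jU.
by have := card0_eq aS0 => /(_ j); rewrite inE.
Qed.

(** The embedding [sh] is kept abstract to cover products of two omega's and of two conjugates
    together. *)
Lemma wedge_pair (sh : 'I_3 -> idx) a b x m : injective sh ->
  (forall r q, (sh r < sh q)%N = (r < q)%N) ->
  (forall S, a x S != 0 -> exists r, S = [set sh r]) ->
  wedge a b x (sh @: [set~ m]) = \sum_(r | r != m) (-1) ^+ (third m r < r)%N *
     a x [set sh r] * b x [set sh (third m r)].
Proof.
move=> shi shm aS; rewrite /wedge big_mkcond [RHS]big_mkcond /=.
rewrite (big_supp (G := fun r => [set sh r])) => [|r r' /finset.set1_inj/shi //|S nS].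
  apply: eq_bigr => r _; rewrite finset.sub1set finset.mem_imset // !inE.
  case: (boolP (r != m)) => // rm.
  have -> : (sh @: [set~ m]) :\ sh r = [set sh (third m r)].
    apply/setP => i; rewrite finset.in_setD1 finset.in_set1; apply/andP/eqP.
      move=> [ir /imsetP[l lm e]]; rewrite e; congr sh; apply/eqP.
      rewrite -(thirdP _ rm); apply/andP; split; first by rewrite !inE in lm.
      by apply: contraNneq ir => <-; rewrite e.
    have := thirdP (third m r) rm; rewrite eqxx => /andP[tm tr] ->.
    by rewrite (inj_eq shi) finset.mem_imset // !inE.
  by rewrite sgn_set1 shm.
case: ifP => // _; suff -> : a x S = 0 by rewrite mulr0 mul0r.
by apply/eqP; apply: contraT => /aS[r /nS].
Qed.

(** The coefficients of omega^j on the dz_p at a point with first coordinate [z]. *)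
Definition wv z j : 'I_3 -> C := fun p =>
  if j == i3 then (p == i2)%:R * z - (p == i3)%:R else (p == j)%:R.

Lemma wv_conj z j p : conjc (wv z j p) = wv (conjc z) j p.
Proof.
rewrite /wv; case: ifP => _; last exact: rmorph_nat.
by rewrite conjD conjM conjcV !rmorph_nat.
Qed.

Lemma omega_coef j x S : omega j x S =
  \sum_p (S == [set lshift 3 p])%:R * wv (zc x i1) j p.
Proof.
rewrite big_I3 /omega /wv; move: j; apply: I3P;
  rewrite /= ?mulr0 ?mulr1 ?addr0 ?add0r //.
rewrite -[LHS]/(zc x i1 * (S == _)%:R - (S == _)%:R); ring.
Qed.

Lemma omega_type S j x : omega j x S != 0 -> exists r, S = [set lshift 3 r].
Proof.
rewrite omega_coef => s0; apply: contrapT => nS; move/eqP: s0; apply.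
apply: big1 => p _; case: eqP => [e|]; last by rewrite mul0r.
by case: nS; exists p.
Qed.

Lemma omega1 j x p : omega j x [set lshift 3 p] = wv (zc x i1) j p.
Proof.
rewrite omega_coef (bigD1 p) //= eqxx mul1r big1 ?addr0 // => q qp.
by rewrite (inj_eq finset.set1_inj) eq_lshift eq_sym (negPf qp) mul0r.
Qed.

Lemma of_type_omega j : of_type 1 0 (omega (R:=R) j).
Proof.
move=> x S /omega_type[r ->]; split.
  rewrite /holdeg (_ : [set l | _] = [set r]) ?cards1 //.
  by apply/setP => l; rewrite !inE eq_lshift.
rewrite /antideg (_ : [set l | _] = finset.set0) ?cards0 //.
by apply/setP => l; rewrite !inE eq_rlshift.
Qed.

Lemma conj_idxK : involutive conj_idx.
Proof. by apply: idx_cases => j; rewrite ?conj_idx_l ?conj_idx_r ?conj_idx_l. Qed.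

Lemma mem_conj_idx (i : idx) S : (i \in conj_idx @: S) = (conj_idx i \in S).
Proof.
by rewrite -[X in X \in _]conj_idxK finset.mem_imset //; exact: inv_inj conj_idxK.
Qed.

Lemma of_type_conj (p q : nat) a : of_type p q a -> of_type q p (conj_form a).
Proof.
move=> ta x S; rewrite mulf_eq0 negb_or signr_eq0 /= conjc_eq0 => /ta[h d].
split; [rewrite -d|rewrite -h]; apply: eq_card => j; rewrite !inE mem_conj_idx.
  by rewrite conj_idx_r.
by rewrite conj_idx_l.
Qed.

Lemma omegab_type S j x : omegab j x S != 0 -> exists r, S = [set rshift 3 r].
Proof.
rewrite mulf_eq0 negb_or signr_eq0 /= conjc_eq0 => /omega_type[r e]; exists r.
apply/setP => i; rewrite -(conj_idxK i) -mem_conj_idx e !finset.in_set1.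
by rewrite -(inj_eq (inv_inj conj_idxK)) conj_idx_l.
Qed.

Lemma omegab1 j x p : omegab j x [set rshift 3 p] = wv (conjc (zc x i1)) j p.
Proof.
rewrite /omegab /conj_form (_ : holdeg _ = 0%N) ?expr0 ?mul1r; last first.
  apply: eq_card0 => l; by rewrite !inE eq_lrshift.
by rewrite finset.imset_set1 conj_idx_r omega1 wv_conj.
Qed.

Lemma of_type_omegab j : of_type 0 1 (omegab (R:=R) j).
Proof. exact: of_type_conj (@of_type_omega j). Qed.

Lemma of_type_omega11 j k : of_type 1 1 (omega11 (R:=R) j k).
Proof. exact: of_type_wedge (@of_type_omega j) (@of_type_omegab k). Qed.

Lemma of_type_omega22 j k l m : of_type 2 2 (omega22 (R:=R) j k l m).
Proof.
exact: of_type_wedge (of_type_wedge (@of_type_omega j) (@of_type_omega k))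
  (of_type_wedge (@of_type_omegab l) (@of_type_omegab m)).
Qed.

(** The frame is dual to omega^1, omega^2 and minus omega^3. *)
Definition wsgn j : C := if j == i3 then -1 else 1.

Lemma ez_wv z j p : \sum_q ez z p q * wv z j q = wsgn j * (p == j)%:R.
Proof.
rewrite big_I3 !ezE /wv /wsgn.
move: j p; apply: I3P; apply: I3P => /=; ring.
Qed.

Lemma frame11_omega11 j k x : frame11 (omega11 j k) x =
  (wsgn j * wsgn k) *: delta_mx j k.
Proof.
apply/matrixP => p q; rewrite /frame11 mulmx3E [RHS]mxE mxE.
transitivity ((\sum_m ez (zc x i1) p m * wv (zc x i1) j m) *
    (\sum_l ez (conjc (zc x i1)) q l * wv (conjc (zc x i1)) k l)).
  rewrite mulr_sumr; apply: eq_bigr => l _; rewrite mulr_suml; apply: eq_bigr => m _.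
  rewrite [c11 _ _ _ _]mxE /omega11.
  rewrite (wedge_hol_anti _ _ (@of_type_omega j) (@of_type_omegab k)).
  rewrite S11DHol Hol_S11 omega1 omegab1; ring.
by rewrite !ez_wv mulrACA -natrM mulnb.
Qed.

(** [o1 m] and [o2 m] are the two indices other than [m], in increasing order. *)
Definition o1 m := if m == i1 then i2 else i1.
Definition o2 m := if m == i3 then i2 else i3.

Definition wminor z m p : C := \sum_(r | r != p) (-1) ^+ (third p r < r)%N *
  wv z (o1 m) r * wv z (o2 m) (third p r).

(** The sign (-1)^m of [c22], with [m] counted from 0, times -1 when omega^3 is one of the two
    factors. *)
Definition wsgn2 m : C := if m == i1 then -1 else 1.

Lemma tz_wminor z m j : \sum_p tz z j p * ((-1) ^+ p * wminor z m p) =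
  wsgn2 m * (j == m)%:R.
Proof.
rewrite big_I3 /wminor !big_I3D /= !thirdE !tzE /wv /wsgn2 /o1 /o2.
move: m j; apply: I3P; apply: I3P => /=; ring.
Qed.

Lemma frame22_omega22 m n x : frame22 (omega22 (o1 m) (o2 m) (o1 n) (o2 n)) x =
  (wsgn2 m * wsgn2 n) *: delta_mx m n.
Proof.
have e1 p : wedge (omega (o1 m)) (omega (o2 m)) x (lshift 3 @: [set~ p]) =
    wminor (zc x i1) m p.
  rewrite (wedge_pair _ _ (@lshift_inj 3 3)) // => [|S]; last exact: omega_type.
  by apply: eq_bigr => r _; rewrite !omega1.
have e2 q : wedge (omegab (o1 n)) (omegab (o2 n)) x (@rshift 3 3 @: [set~ q]) =
    wminor (conjc (zc x i1)) n q.
  rewrite (wedge_pair _ _ (@rshift_inj 3 3)) => [|r s|S]; last exact: omegab_type.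
    by apply: eq_bigr => r _; rewrite !omegab1.
  by rewrite /= ltn_add2l.
apply/matrixP => j k; rewrite /frame22 mulmx3E [RHS]mxE mxE.
transitivity ((\sum_p tz (zc x i1) j p * ((-1) ^+ p * wminor (zc x i1) m p)) *
    (\sum_q tz (conjc (zc x i1)) k q * ((-1) ^+ q * wminor (conjc (zc x i1)) n q))).
  rewrite mulr_sumr; apply: eq_bigr => q _; rewrite mulr_suml; apply: eq_bigr => p _.
  rewrite [c22 _ _ _ _]mxE /omega22 (wedge_hol_anti _ _
    (of_type_wedge (@of_type_omega _) (@of_type_omega _))
    (of_type_wedge (@of_type_omegab _) (@of_type_omegab _))).
  rewrite S22DHol Hol_S22.
  rewrite e1 e2 exprD.
  move: (wminor _ m p) (wminor _ n q) (tz _ j p) (tz _ k q) => u v s t; ring.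
by rewrite !tz_wminor mulrACA -natrM mulnb.
Qed.

Lemma omega22E m n : omega22 (o1 m) (o2 m) (o1 n) (o2 n) =
  form_of ((wsgn2 m * wsgn2 n) *: delta_mx m n).
Proof.
rewrite -(frame22_omega22 m n 0); apply: form_of_frame; first exact: of_type_omega22.
by move=> x; rewrite !frame22_omega22.
Qed.

End CoframeProducts.

Section DiagonalMetric.
Variable R : realType.
Notation V := (C3 R).
Notation C := R[i].
Implicit Types (j k l m n : 'I_3) (x : V) (a b F : cform R).

Definition metric_weight (t : R) j : R := if j == i3 then t ^+ 2 else 1.

Section Metric.
Variables (t : R) (F : cform R).
Hypotheses (t0 : t != 0) (FE : 2%:R *: F = 'i%C *: (omega11 i1 i1 + omega11 i2 i2 +
  (t ^+ 2)%:C *: omega11 i3 i3)).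

Lemma metric_coef x S : F x S = 2%:R^-1 * ('i%C * (omega11 i1 i1 x S + omega11 i2 i2 x S +
  (t ^+ 2)%:C * omega11 i3 i3 x S)).
Proof.
have n2 : (2%:R : C) != 0 by rewrite pnatr_eq0.
apply: (mulfI n2); rewrite mulVKf //.
exact: (congr1 (fun f : cform R => f x S) FE).
Qed.

Lemma metric_type : of_type 1 1 F.
Proof.
move=> x S; apply: contra_neqP => nS; rewrite metric_coef.
have o j k : omega11 j k x S = 0 := type_neq0 _ (@of_type_omega11 R j k) nS.
by rewrite !o !mulr0 !addr0 !mulr0.
Qed.

Lemma frame11_metric x : frame11 F x =
  (2%:R^-1 * 'i%C) *: \matrix_(j, k) ((j == k)%:R * (metric_weight t j)%:C).
Proof.
have -> : frame11 F x = (2%:R^-1 * 'i%C) *: (frame11 (omega11 i1 i1) x +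
    frame11 (omega11 i2 i2) x + (t ^+ 2)%:C *: frame11 (omega11 i3 i3) x).
  rewrite /frame11; set P := ez (zc x i1); set Q := (ez (conjc (zc x i1)))^T.
  have -> : c11 F x = (2%:R^-1 * 'i%C) *: (c11 (omega11 i1 i1) x +
      c11 (omega11 i2 i2) x + (t ^+ 2)%:C *: c11 (omega11 i3 i3) x).
    by apply/matrixP => j k; rewrite !mxE metric_coef mulrA.
  move: P Q (c11 _ x) (c11 _ x) (c11 _ x) => P Q M N L.
  by rewrite -scalemxAr -scalemxAl !mulmxDr !mulmxDl -scalemxAr -scalemxAl.
congr (_ *: _); rewrite !frame11_omega11 /wsgn /= mulrNN !mulr1 !scale1r.
apply/matrixP => j k; rewrite !mxE /metric_weight.
by move: j k; apply: I3P; apply: I3P; rewrite /= ?mulr0 ?mul0r ?mulr1 ?mul1r ?addr0 ?add0r.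
Qed.

Lemma metric_Hm j k : Hm F 0 j k = (j == k)%:R * (2%:R^-1 * (metric_weight t j)%:C).
Proof.
rewrite /Hm -frame110 frame11_metric scalerA mulNr mulrCA -expr2 sqr_i mulrN1 opprK.
by rewrite !mxE mulrCA.
Qed.

Lemma metric_weight_gt0 j : 0 < metric_weight t j.
Proof. by rewrite /metric_weight; case: ifP => _; rewrite ?ltr01 // exprn_even_gt0. Qed.

(** Here H = diag(1, 1, t^2) / 2: the second-order condition is a nonzero multiple of A_33, and once
    A_33 = 0 the weight t^2 drops out of the primitivity condition. *)
Lemma L22_metric (Gamma : set V) a : lattice Gamma ->
  L22 Gamma F a <-> exists A, [/\ a = form_of A, A i3 i3 = 0 & A i1 i1 + A i2 i2 = 0].
Proof.
move=> lG; have n2 : (2%:R : C) != 0 by rewrite pnatr_eq0.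
have c2 : conjc (2%:R^-1 : C) = 2%:R^-1 by rewrite fmorphV rmorph_nat.
have cR (r : R) : conjc r%:C = r%:C by apply/eqP; rewrite eq_complex /= oppr0 !eqxx.
have Hh j k : conjc (Hm F 0 k j) = Hm F 0 j k.
  rewrite !metric_Hm !conjM c2 cR rmorph_nat eq_sym.
  by case: eqP => [->|] //; rewrite !mul0r.
have Hpos (u : 'rV[C]_3) : u != 0 ->
    0 < \sum_j \sum_k u 0 j * Hm F 0 j k * conjc (u 0 k).
  move=> u0.
  have -> : \sum_j \sum_k u 0 j * Hm F 0 j k * conjc (u 0 k) =
      \sum_j (2%:R^-1 * (metric_weight t j)%:C) * (u 0 j * conjc (u 0 j)).
    apply: eq_bigr => j _; rewrite (bigD1 j) //= big1 ?addr0 => [|k kj].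
      rewrite metric_Hm eqxx mul1r; move: (2%:R^-1) (_%:C) (u 0 j) (conjc _) => p q r s; ring.
    by rewrite metric_Hm eq_sym (negPf kj) mul0r mulr0 mul0r.
  have ge0 j : 0 <= 2%:R^-1 * (metric_weight t j)%:C * (u 0 j * conjc (u 0 j)).
    rewrite mulr_ge0 ?mul_conjC_ge0 // mulr_ge0 ?invr_ge0 ?ler0n // lecR.
    exact: ltW (metric_weight_gt0 j).
  have [j uj] : exists j, u 0 j != 0.
    apply: contrapT => nu; move/eqP: u0; apply; apply/rowP => j; rewrite mxE.
    by apply/eqP; apply: contraT => uj; case: nu; exists j.
  rewrite (bigD1 j) //= ltr_pwDl ?sumr_ge0 // mulr_gt0 ?mul_conjC_gt0 //.
  by rewrite mulr_gt0 ?invr_gt0 ?ltr0n // ltcR metric_weight_gt0.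
have cF x : frame11 F x = frame11 F 0 by rewrite !frame11_metric.
have w3 : (metric_weight t i3)%:C != 0 :> C.
  by rewrite eq_complex /= eqxx andbT lt0r_neq0 // metric_weight_gt0.
have trE (A : 'M[C]_3) : \sum_j \sum_k A j k * Hm F 0 j k =
    2%:R^-1 * (A i1 i1 + A i2 i2 + A i3 i3 * (metric_weight t i3)%:C).
  rewrite !big_I3 !metric_Hm /= ?mul0r ?mulr0 ?addr0 ?add0r.
  rewrite !mul1r /metric_weight /= -[1%:C]/(1 : C).
  move: (2%:R^-1) (t ^+ 2)%:C => p q; ring.
have quadE A : (Hm F 0 *m A^T *m Hm F 0) i3 i3 =
    A i3 i3 * (2%:R^-1 * (metric_weight t i3)%:C) ^+ 2.
  have := metric_Hm; move: (Hm F 0) => H HE.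
  rewrite mxE big_I3 !mxE !big_I3 !mxE !HE /= ?mul0r ?mulr0 ?addr0 ?add0r.
  rewrite !mul1r; move: (2%:R^-1) (_%:C) => p q; ring.
rewrite (L22P lG metric_type cF Hh Hpos (posdef_unit Hpos)).
split=> -[A [-> e1 e2]]; exists A.
  have A33 : A i3 i3 = 0.
    move/eqP: e2; rewrite quadE mulf_eq0 => /orP[/eqP //|].
    by rewrite expf_eq0 /= mulf_eq0 invr_eq0 (negPf n2) (negPf w3).
  split=> //; move/eqP: e1; rewrite trE A33 mul0r addr0 mulf_eq0 invr_eq0 (negPf n2).
  by move/eqP.
by split=> //; rewrite ?trE ?quadE e1 ?e2 !mul0r ?addr0 ?mulr0.
Qed.

End Metric.

(** Frame matrices of the seven displayed forms in their order: each product of omega's gives the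
    unit matrix at its two missing indices, with a minus sign when exactly one of these is [i1]. *)
Definition basis22 : 7.-tuple 'M[C]_3 := [tuple delta_mx i3 i2; - delta_mx i3 i1;
  delta_mx i2 i3; - delta_mx i2 i1; - delta_mx i1 i3; - delta_mx i1 i2;
  delta_mx i2 i2 - delta_mx i1 i1].

Lemma basis22P (A : 'M[C]_3) : A i3 i3 = 0 /\ A i1 i1 + A i2 i2 = 0 <->
  exists c, A = \sum_i c i *: tnth basis22 i.
Proof.
split=> [[A33 A11]|[c ->]].
  have {}A11 : A i1 i1 = - A i2 i2 by apply/eqP; rewrite -addr_eq0 A11.
  pose s := [tuple A i3 i2; - A i3 i1; A i2 i3; - A i2 i1; - A i1 i3; - A i1 i2; A i2 i2].
  exists (tnth s); apply/matrixP => j k.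
  rewrite summxE !big_ord_recl big_ord0 !(tnth_nth 0) /= !mxE.
  by move: j k; apply: I3P; apply: I3P; rewrite /= ?A33 ?A11; ring.
rewrite !summxE -big_split; split; apply: big1 => i _; rewrite (tnth_nth 0) !mxE;
  by case: i => [[|[|[|[|[|[|[|]]]]]]] ?] //; rewrite !mxE /=; ring.
Qed.

Lemma omega22_basis i : tnth [tuple omega22 (R:=R) i1 i2 i1 i3;
       omega22 i1 i2 i2 i3; omega22 i1 i3 i1 i2; omega22 i1 i3 i2 i3;
       omega22 i2 i3 i1 i2; omega22 i2 i3 i1 i3;
       omega22 i1 i3 i1 i3 - omega22 i2 i3 i2 i3] i = form_of (tnth basis22 i).
Proof.
have fD : {morph @form_of R : A B / A - B} by exact: raddfB.
have e := @omega22E R.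
have E1213 := e i3 i2; have E1223 := e i3 i1; have E1312 := e i2 i3.
have E1323 := e i2 i1; have E2312 := e i1 i3; have E2313 := e i1 i2.
have E1313 := e i2 i2; have E2323 := e i1 i1.
rewrite /wsgn2 /o1 /o2 /= ?mulrNN ?mulr1 ?mul1r ?scaleN1r ?scale1r in
  E1213 E1223 E1312 E1323 E2312 E2313 E1313 E2323.
rewrite !(tnth_nth 0).
case: i => [[|[|[|[|[|[|[|n]]]]]]] lti]; rewrite [val _]/= [nth _ _ _]/= [nth _ _ _]/=.
- exact: E1213.
- exact: E1223.
- exact: E1312.
- exact: E1323.
- exact: E2312.
- exact: E2313.
- by rewrite fD E1313 E2323.
- by case: (notF lti).
Qed.

End DiagonalMetric.

Theorem proposition5p4 (R : realType) (Gamma : set (C3 R))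
    (hGamma : lattice Gamma) :
  (forall F : cform R,
     hermitian_structure F -> left_invariant F -> balanced F ->
     has_dim (L22 Gamma F) 7) /\
  (forall (t : R) (F : cform R), t != 0 ->
     2%:R *: F = 'i%C *: (omega11 i1 i1 + omega11 i2 i2 +
                        (t ^+ 2)%:C *: omega11 i3 i3) ->
     L22 Gamma F =
     cspan (tnth [tuple
       omega22 i1 i2 i1 i3;
       omega22 i1 i2 i2 i3;
       omega22 i1 i3 i1 i2;
       omega22 i1 i3 i2 i3;
       omega22 i2 i3 i1 i2;
       omega22 i2 i3 i1 i3;
       omega22 i1 i3 i1 i3 - omega22 i2 i3 i2 i3])).
Proof.
split=> [F hF iF _|t F t0 FE]; first exact: has_dim_L22.
set b := tnth _.
have spanE (c : 'I_7 -> R[i]) : form_of (\sum_i c i *: tnth (basis22 R) i) =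
    \sum_i c i *: b i.
  by rewrite form_of_sum; apply: eq_bigr => i _; rewrite /b omega22_basis.
apply/seteqP; split=> a.
  move=> /(L22_metric t0 FE _ hGamma)[A [-> e1 e2]].
  by have [c ->] := (basis22P A).1 (conj e1 e2); exists c; rewrite spanE.
move=> [c ->]; apply/(L22_metric t0 FE _ hGamma).
exists (\sum_i c i *: tnth (basis22 R) i).
have [e1 e2] := (basis22P (\sum_i c i *: tnth (basis22 R) i)).2 (ex_intro _ c erefl).
by rewrite spanE.
Qed.
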